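(* Let $M\subset\mathbb{C}P^n$ be a connected austere surface (a connected austere submanifold of real dimension $2$). Then $M$ is either a holomorphic curve or an open subset of a real projective plane $\mathbb{R}P^2\subset\mathbb{C}P^2$, where $\mathbb{C}P^2$ is embedded as a complex linear subspace in $\mathbb{C}P^n$.
   Context: $\mathbb{C}P^n$ carries the Fubini–Study metric for which the Hopf fibration $\pi:S^{2n+1}\to\mathbb{C}P^n$ from the unit sphere in $\mathbb{C}^{n+1}$ is a Riemannian submersion. $NM$ is the normal bundle of $M$ with respect to this metric. Submanifolds are smooth and may be immersed; statements about $\Phi(NM)$ are then read via the immersion $NM\to\mathcal{M}$ obtained by composing $NM\to T\mathbb{C}P^n$ with $\Phi$. A holomorphic curve is a complex submanifold of complex dimension $1$. The $\mathbb{R}P^2\subset\mathbb{C}P^2$ in the claim is the real part of a complex projective plane, i.e. the image under an element of $U(n+1)$ of $\{[x_0:x_1:x_2:0:\cdots:0] : x_i\in\mathbb{R}\}$. For vectors in $\mathbb{C}^{n+1}$ the dot product is $\mathbb{C}$-bilinear. Let $B=\{(\zeta,\xi)\in\mathbb{C}^{n+1}\times\mathbb{C}^{n+1} : \zeta\neq 0,\ \xi\cdot\overline{\zeta}=0\}$. Then $T\mathbb{C}P^n\cong B/\mathbb{C}^*$, where $\lambda\in\mathbb{C}^*$ acts by $(\zeta,\xi)\mapsto(\lambda\zeta,\lambda\xi)$, the class of $(\zeta,\xi)$ being the tangent vector $\frac{d}{ds}\big|_{s=0}[\zeta+s\xi]$ at $[\zeta]$. $\mathcal{M}\subset\mathbb{C}P^n\times\mathbb{C}P^n$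 is the open set of pairs $([z],[w])$ with $\sum_{i=0}^n z_iw_i\neq 0$. The map $\Phi:T\mathbb{C}P^n\to\mathcal{M}$ is the bijective identification (diffeomorphism) induced by $$(\zeta,\xi)\mapsto\Big((\cosh\mu)\zeta+\mathrm{i}\tfrac{\sinh\mu}{\mu}\xi\,;\ (\cosh\mu)\overline{\zeta}+\mathrm{i}\tfrac{\sinh\mu}{\mu}\overline{\xi}\Big),\qquad \mu=\frac{|\xi|}{|\zeta|}$$ (with $\sinh\mu/\mu=1$ at $\mu=0$). The Stenzel Kähler form on $\mathcal{M}$ is $\Omega=\mathrm{i}\,\partial\bar\partial f(\mathcal{N})$, where $\mathcal{N}=\mathcal{A}/|\mathcal{B}|^2$, $\mathcal{A}=\sum_{j,k=0}^n|z_jw_k|^2$, $\mathcal{B}=\sum_{j=0}^n z_jw_j$, and $f'(\mathcal{N})=\mathcal{N}^{-1/2}$ (so $f(\mathcal{N})=2\sqrt{\mathcal{N}}$ up to an additive constant). The holomorphic volume form $\Theta$ on $\mathcal{M}$ is, in affine coordinates $Z_a=z_a/z_0$, $W_a=w_a/w_0$ ($1\le a\le n$), $\Theta=(1+\sum_a Z_aW_a)^{-(n+1)}\,dZ_1\wedge\cdots\wedge dZ_n\wedge dW_1\wedge\cdots\wedge dW_n$, up to a constant factor. Definition: $M$ is austere if its normal bundle is special Lagrangian (with some constant phase) in $T\mathbb{C}P^n$ with respect to the Stenzel Calabi–Yau structure, i.e. there is a constant $\phi\in\mathbb{R}$ such that $\Omega|_{\Phi(NM)}\equiv0$ and $\operatorname{Im}(e^{\mathrm{i}\phi}\Theta)|_{\Phi(NM)}\equiv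 0$. *)

(* Defs.v *)
(* C is R[i] for a realType R; vectors of C^m are row vectors. *)
From mathcomp Require Import all_boot all_order all_algebra.
From mathcomp Require Import all_classical all_reals all_analysis.
From mathcomp Require Import complex.

Set Implicit Arguments.
Unset Strict Implicit.
Unset Printing Implicit Defensive.

Import Order.TTheory GRing.Theory Num.Theory.
Import numFieldNormedType.Exports.

Local Open Scope classical_set_scope.
Local Open Scope ring_scope.
Local Open Scope complex_scope.

Section Smooth.
Context {R : realType} {V : normedModType R}.

(* C^oo on an open set U: every iterated directional derivative of f exists
   and is (Frechet) differentiable at every point of U. *)
Definition smooth_on (U : set V) (f : V -> R) : Prop :=
  forall (s : seq V) (x : V), U x ->
    differentiable (foldr (fun v g => 'D_v g) f s) x.

Definition smoothr_on m (U : set V) (f : V -> 'rV[R]_m) : Prop :=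
  forall j, smooth_on U (fun x => f x 0 j).

Definition csmooth_on (U : set V) (f : V -> R[i]) : Prop :=
  smooth_on U (fun x => complex.Re (f x)) /\ smooth_on U (fun x => complex.Im (f x)).

Definition csmoothr_on m (U : set V) (f : V -> 'rV[R[i]]_m) : Prop :=
  forall j, csmooth_on U (fun x => f x 0 j).

Definition cderive (f : V -> R[i]) (x v : V) : R[i] :=
  'D_v (fun y => complex.Re (f y)) x +i* 'D_v (fun y => complex.Im (f y)) x.

Definition cderiver m (f : V -> 'rV[R[i]]_m) (x v : V) : 'rV[R[i]]_m :=
  \row_j cderive (fun y => f y 0 j) x v.

End Smooth.

Definition CP (R : realType) (n : nat) : Type :=
  {L : {vspace 'rV[R[i]]_n.+1} | \dim L == 1%N}.

Section ComplexProjectiveSpace.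
Context {R : realType}.

(* L = [zeta]; since L is a line, this forces zeta != 0. *)
Definition represents n (zeta : 'rV[R[i]]_n.+1) (L : CP R n) : Prop :=
  sval L = <[zeta]>%VS.

(* xi . conj(zeta), and the Euclidean norm of C^m *)
Definition hdot m (xi zeta : 'rV[R[i]]_m) : R[i] :=
  \sum_j xi 0 j * (zeta 0 j)^*%C.

Definition hnorm m (xi : 'rV[R[i]]_m) : R := Num.sqrt (complex.Re (hdot xi xi)).

(* A tangent vector at [zeta] is a pair (zeta, xi) with hdot xi zeta = 0, up to
   simultaneous rescaling.  A velocity d(zeta) of a lifted curve represents the
   same tangent vector as its component orthogonal to zeta. *)
Definition horizontal n (zeta eta : 'rV[R[i]]_n.+1) : 'rV[R[i]]_n.+1 :=
  eta - (hdot eta zeta / hdot zeta zeta) *: zeta.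

(* The metric making S^{2n+1} -> CP^n a Riemannian submersion: rescale zeta to
   unit length and take the Euclidean inner product of horizontal vectors. *)
Definition FubiniStudy n (zeta xi eta : 'rV[R[i]]_n.+1) : R :=
  complex.Re (hdot xi eta) / hnorm zeta ^+ 2.

End ComplexProjectiveSpace.

Section Stenzel.
Context {R : realType}.

(* Wirtinger derivatives of g : C^m -> C *)
Definition rderiv m (g : 'rV[R[i]]_m -> R[i]) (p u : 'rV[R[i]]_m) : R[i] :=
  cderive (fun t : R => g (p + t%:C *: u)) 0 1.

Definition wirtinger m (a : 'I_m) (g : 'rV[R[i]]_m -> R[i])
    (p : 'rV[R[i]]_m) : R[i] :=
  (rderiv g p (delta_mx 0 a) - 'i%C * rderiv g p ('i%C *: delta_mx 0 a)) / 2%:R.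

Definition wirtinger_bar m (a : 'I_m) (g : 'rV[R[i]]_m -> R[i])
    (p : 'rV[R[i]]_m) : R[i] :=
  (rderiv g p (delta_mx 0 a) + 'i%C * rderiv g p ('i%C *: delta_mx 0 a)) / 2%:R.

(* i \partial\bar\partial u
     = i \sum_{a,b} (d^2 u / dp_a d\bar p_b) dp_a /\ d\bar p_b
   at p, evaluated on the pair X, Y *)
Definition i_ddbar m (u : 'rV[R[i]]_m -> R) (p X Y : 'rV[R[i]]_m) : R[i] :=
  'i%C * \sum_a \sum_b
    wirtinger a (wirtinger_bar b (fun q => (u q)%:C)) p
    * (X 0 a * (Y 0 b)^*%C - Y 0 a * (X 0 b)^*%C).

(* Points and tangent vectors of \mathcal{M}, a subset of CP^n x CP^n, are
   handled in homogeneous coordinates (z, w), stored as row_mx z w.  Forms are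
   pulled back along the holomorphic submersion (z, w) |-> ([z], [w]); for Omega
   this commutes with i \partial\bar\partial. *)

Definition bilin n (z w : 'rV[R[i]]_n.+1) : R[i] := \sum_j z 0 j * w 0 j.

Definition stenzelN n (p : 'rV[R[i]]_(n.+1 + n.+1)) : R :=
  let z := lsubmx p in let w := rsubmx p in
  (\sum_j \sum_k Normc.normc (z 0 j * w 0 k) ^+ 2)
  / Normc.normc (bilin z w) ^+ 2.

(* The additive constant in f is taken to be 0. *)
Definition Omega n (p X Y : 'rV[R[i]]_(n.+1 + n.+1)) : R[i] :=
  i_ddbar (fun q => 2 * Num.sqrt (stenzelN q)) p X Y.

(* Differentials, on the vector dz at z, of the affine coordinates
   z_{lift i a} / z_i, a < n, of the chart z_i != 0. *)
Definition daffine n (i : 'I_n.+1) (z dz : 'rV[R[i]]_n.+1) : 'rV[R[i]]_n :=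
  \row_a ((dz 0 (lift i a) * z 0 i - z 0 (lift i a) * dz 0 i) / z 0 i ^+ 2).

(* Theta at p evaluated on X_0, ..., X_{2n-1}, in the affine chart
   z_i != 0, w_j != 0.  For i = j = 0 this is
     (1 + \sum_a Z_a W_a)^{-(n+1)} dZ_1 /\ ... /\ dZ_n /\ dW_1 /\ ... /\ dW_n ;
   the sign makes the expressions in different charts agree on overlaps, all of
   them being equal to
     (z.w)^{-(n+1)} (\sum_k (-1)^k z_k dz_0 /\ .. omit k .. /\ dz_n)
                 /\ (\sum_k (-1)^k w_k dw_0 /\ .. omit k .. /\ dw_n). *)
Definition Theta n (i j : 'I_n.+1) (p : 'rV[R[i]]_(n.+1 + n.+1))
    (X : 'I_(n + n) -> 'rV[R[i]]_(n.+1 + n.+1)) : R[i] :=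
  let z := lsubmx p in let w := rsubmx p in
  (-1) ^+ (i + j)%N
  * (\sum_k (z 0 k / z 0 i) * (w 0 k / w 0 j)) ^- n.+1
  * \det (\matrix_(k < n + n)
            row_mx (daffine i z (lsubmx (X k))) (daffine j w (rsubmx (X k)))).

Definition cosh (x : R) : R := (expR x + expR (- x)) / 2.
Definition sinhc (x : R) : R :=
  if x == 0 then 1 else (expR x - expR (- x)) / 2 / x.

Definition Phi n (zeta xi : 'rV[R[i]]_n.+1) : 'rV[R[i]]_(n.+1 + n.+1) :=
  let mu := hnorm xi / hnorm zeta in
  let phi (v u : 'rV[R[i]]_n.+1) :=
    (cosh mu)%:C *: v + ('i%C * (sinhc mu)%:C) *: u in
  row_mx (phi zeta xi) (phi (map_mx conjc zeta) (map_mx conjc xi)).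

End Stenzel.

Section Surfaces.
Context {R : realType} {M : topologicalType}.

Record param := Param { pdom : set 'rV[R]_2; pmap :> 'rV[R]_2 -> M }.

(* pmap restricts to a homeomorphism from the open set pdom onto an open
   subset of M. *)
Definition is_param (P : param) : Prop :=
  [/\ open (pdom P),
      forall x, pdom P x -> {for x, continuous P},
      forall x y, pdom P x -> pdom P y -> P x = P y -> x = y
    & forall V, open V -> V `<=` pdom P -> open (P @` V)].

(* The transition map Q^-1 \o P satisfies G near each point of its domain. *)
Definition transition
    (G : set 'rV[R]_2 -> ('rV[R]_2 -> 'rV[R]_2) -> Prop) (P Q : param) : Prop :=
  forall x y, pdom P x -> pdom Q y -> P x = Q y ->
  exists (W : set 'rV[R]_2) (tau : 'rV[R]_2 -> 'rV[R]_2),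
    [/\ open W, W x, W `<=` pdom P, G W tau
      & forall x', W x' -> pdom Q (tau x') /\ Q (tau x') = P x'].

Definition atlas_for
    (G : set 'rV[R]_2 -> ('rV[R]_2 -> 'rV[R]_2) -> Prop) (A : set param) : Prop :=
  [/\ forall P, A P -> is_param P,
      forall p : M, exists P, exists2 x, A P & pdom P x /\ P x = p
    & forall P Q, A P -> A Q -> transition G P Q].

Definition smooth_surface (A : set param) : Prop :=
  [/\ hausdorff_space M, @second_countable M
    & atlas_for (fun W tau => smoothr_on W tau) A].

(* Holomorphy with respect to the coordinate x_0 + i x_1 on R^2 = C *)
Definition holomorphic_on (W : set 'rV[R]_2) (g : 'rV[R]_2 -> R[i]) : Prop :=
  csmooth_on W g /\
  forall x, W x ->
    cderive g x (delta_mx 0 1) = 'i%C * cderive g x (delta_mx 0 0).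

Definition complex_atlas (A : set param) : Prop :=
  atlas_for (fun W tau => smoothr_on W tau /\
    holomorphic_on W (fun x => tau x 0 0 +i* tau x 0 1)) A.

Definition compatible (A A' : set param) : Prop :=
  forall P Q, A P -> A' Q ->
    transition (fun W tau => smoothr_on W tau) P Q /\
    transition (fun W tau => smoothr_on W tau) Q P.

Section Map.
Context {n : nat}.
Variable F : M -> CP R n.

Definition lifts (P : param) (W : set 'rV[R]_2)
    (Z : 'rV[R]_2 -> 'rV[R[i]]_n.+1) : Prop :=
  [/\ open W, W `<=` pdom P
    & forall x, W x -> represents (Z x) (F (P x))].

(* (zeta, xi) represents a vector of the image of the differential of F at
   P x. *)
Definition tangent_vector (P : param) (x : 'rV[R]_2)
    (zeta xi : 'rV[R[i]]_n.+1) : Prop :=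
  exists (W : set 'rV[R]_2) (Z : 'rV[R]_2 -> 'rV[R[i]]_n.+1) (v : 'rV[R]_2),
    [/\ W x, lifts P W Z, csmoothr_on W Z, Z x = zeta
      & xi = horizontal zeta (cderiver Z x v)].

(* F is smooth and its differential is injective. *)
Definition immersion (A : set param) : Prop :=
  forall P x, A P -> pdom P x ->
  exists (W : set 'rV[R]_2) (Z : 'rV[R]_2 -> 'rV[R[i]]_n.+1),
    [/\ W x, lifts P W Z, csmoothr_on W Z
      & forall v, v != 0 -> horizontal (Z x) (cderiver Z x v) != 0].

(* (zeta, xi) represents a vector normal to M at P x. *)
Definition normal_vector (P : param) (x : 'rV[R]_2)
    (zeta xi : 'rV[R[i]]_n.+1) : Prop :=
  [/\ represents zeta (F (P x)), hdot xi zeta = 0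
    & forall eta, tangent_vector P x zeta eta -> FubiniStudy zeta xi eta = 0].

(* X is the velocity, in homogeneous coordinates, at the point Phi(zeta, xi) of
   the image under Phi of a smooth curve in NM through (P x, [(zeta, xi)]). *)
Definition PhiNM_tangent (P : param) (x : 'rV[R]_2)
    (zeta xi : 'rV[R[i]]_n.+1) (X : 'rV[R[i]]_(n.+1 + n.+1)) : Prop :=
  exists (I : set R) (c : R -> 'rV[R]_2) (a b : R -> 'rV[R[i]]_n.+1),
    [/\ [/\ open I, I 0, c 0 = x, a 0 = zeta & b 0 = xi],
        [/\ smoothr_on I c, csmoothr_on I a & csmoothr_on I b],
        forall t, I t -> pdom P (c t) /\ normal_vector P (c t) (a t) (b t)
      & X = cderiver (fun t => Phi (a t) (b t)) 0 1].

Definition austere (A : set param) : Prop :=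
  exists phi : R, forall P x zeta xi,
    A P -> pdom P x -> normal_vector P x zeta xi ->
    (forall X Y, PhiNM_tangent P x zeta xi X -> PhiNM_tangent P x zeta xi Y ->
       Omega (Phi zeta xi) X Y = 0) /\
    (forall X : 'I_(n + n) -> 'rV[R[i]]_(n.+1 + n.+1),
       (forall k, PhiNM_tangent P x zeta xi (X k)) ->
       forall i j : 'I_n.+1,
         lsubmx (Phi zeta xi) 0 i != 0 -> rsubmx (Phi zeta xi) 0 j != 0 ->
         complex.Im ((cos phi +i* sin phi) * Theta i j (Phi zeta xi) X) = 0).

(* The immersed surface is a complex submanifold: M carries a complex structure
   inducing the given smooth structure, for which F is holomorphic. *)
Definition holomorphic_curve (A : set param) : Prop :=
  exists A' : set param,
    [/\ complex_atlas A', compatible A A'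
      & forall P x, A' P -> pdom P x ->
        exists (W : set 'rV[R]_2) (Z : 'rV[R]_2 -> 'rV[R[i]]_n.+1),
          [/\ W x, lifts P W Z
            & forall j, holomorphic_on W (fun y => Z y 0 j)]].

(* The homogeneous coordinates [x_0 : x_1 : x_2 : 0 : ... : 0] (for n >= 2). *)
Definition real_point (x : 'rV[R]_3) : 'rV[R[i]]_n.+1 :=
  \row_j (if insub (val j) is Some k then (x 0 k)%:C else 0).

(* F maps M onto an open subset of the image under a unitary transformation of
   the standard RP^2 in CP^2 in CP^n.  As F need not be injective (it may be the
   covering S^2 -> RP^2), openness is required of the images of all open subsets
   of M: F is a local homeomorphism onto an open subset of RP^2, and identifies
   M with it when F is injective.  RP^2 has the quotient topology of
   R^3 minus the origin. *)
Definition open_in_RP2 : Prop :=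
  (2 <= n)%N /\
  exists2 U : 'M[R[i]]_n.+1, U \is unitarymx &
    (forall p, exists x : 'rV[R]_3, represents (real_point x *m U) (F p)) /\
    (forall V : set M, open V ->
       open [set x : 'rV[R]_3 |
               exists2 p, V p & represents (real_point x *m U) (F p)]).

End Map.
End Surfaces.

Arguments param R M : clear implicits.

(* Main.v *)
From HB Require Import structures.
Require Import Defs.
From mathcomp Require Import all_boot all_order all_algebra all_fingroup.
From mathcomp Require Import all_classical all_reals all_analysis.
From mathcomp Require Import complex spectral ring lra zify.

(** Constancy of the phase of Theta on the normal bundle is a condition on the second
    fundamental form at each point: it forces this form to vanish unless the tangent
    plane is complex.

    Let Z be a lift of the surface to homogeneous coordinates, with |Z| = 1 at a point,
    let e_0, e_1 be its horizontal derivatives there and xi a normal vector.  The image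
    of the normal bundle under Phi has at Phi (Z, xi) two horizontal tangent vectors,
    obtained by transporting xi with constant length along the surface, and vertical
    ones ([PhiNM_horizontal], [PhiNM_vertical]).  Evaluated on them, Theta is a factor
    whose phase is that of the zero section, times
      det (c g + (s^2 / c) k k^T - i s h),
    where c = cosh |xi|, s = sinh |xi| / |xi|, g is the metric, k_j = Im <xi, e_j> is the
    Kaehler pairing and h the second fundamental form in the direction xi ([rows_phase],
    [calibrated_mix]).  The imaginary part of this determinant is therefore 0; comparing
    xi with 2 xi separates it into two equations ([austere_mix]): h has trace 0, and
    h (u, u) = 0 for u = k_1 e_0 - k_0 e_1.

    If the tangent plane is not complex, k takes all values as xi varies, and these
    equations, polarized in xi, give h = 0 for all xi ([austere_sff0]).  On an open set
    of such points the surface is totally geodesic; by the Codazzi equation the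
    curvature of complex projective space then preserves the tangent planes, and this
    makes the Kaehler form vanish on them ([codazzi], [kahler_form0]).  So near each point either
    all tangent planes are complex or all are totally real, and by connectedness one of
    the cases holds on all of M ([austere_dichotomy]).

    In the complex case an affine coordinate with nonzero differential is a local
    coordinate by the inverse function theorem, and the others are holomorphic in it;
    these coordinates form a complex atlas ([complex_points_holomorphic]).

    In the totally real case Z, e_0, e_1 span a real space L of dimension 3 on which the
    Hermitian product is real, and the derivatives of this frame are real combinations
    of it plus a common complex multiple.  So L changes only by phases.  Phases are
    eliminated by passing to the symmetric form \sum_k v_k^T v_k for an orthonormal
    basis v_k of L, which satisfies dQ = (a - conj a) Q and hence spans a line
    independent of the point ([real_form_derive], [real_form_line_const]).  An
    orthonormal basis of one L, completed to a unitary matrix, then gives homogeneous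
    coordinates for the whole surface that are real up to a factor
    ([real_coordinates]), and ratios of them are local coordinates of the surface
    ([isotropic_points_RP2]). *)

Set Implicit Arguments.
Unset Strict Implicit.
Unset Printing Implicit Defensive.

Import Order.TTheory GRing.Theory Num.Theory.
Import numFieldNormedType.Exports.

Local Open Scope classical_set_scope.
Local Open Scope ring_scope.
Local Open Scope complex_scope.

(** * Real smooth functions *)
Section RealSmooth.
Context {R : realType} {V : normedModType R}.
Implicit Types (U : set V) (f g : V -> R).

(** [smooth_on] speaks of all lists of directions at once; closure under products,
    inverses, square roots and composition is an induction on the order of
    differentiation, which this filtration makes possible. *)
Fixpoint Ck (k : nat) (U : set V) (f : V -> R) : Prop :=
  (forall x, U x -> differentiable f x) /\
  (if k is k'.+1 then forall v, Ck k' U ('D_v f) else True).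

Lemma Ck_diff k U f x : Ck k U f -> U x -> differentiable f x.
Proof. by case: k => [|k] [h _]; apply: h. Qed.

Lemma CkSE k U f : Ck k.+1 U f <->
  (forall x, U x -> differentiable f x) /\ forall v, Ck k U ('D_v f).
Proof. by []. Qed.

Lemma CkW k U f : Ck k.+1 U f -> Ck k U f.
Proof.
elim: k f => [|k IH] f [h1 h2]; first by split.
by apply/CkSE; split=> // v; apply: IH; apply: h2.
Qed.

Lemma Ck_sub k U U' f : U' `<=` U -> Ck k U f -> Ck k U' f.
Proof.
move=> sU; elim: k f => [|k IH] f [h1 h2]; (split; first by move=> x /sU; apply: h1) => //.
by move=> v; apply: IH; apply: h2.
Qed.

Lemma smooth_onP U f : smooth_on U f <-> forall k, Ck k U f.
Proof.
split=> [h k | h s].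
  elim: k f h => [|k IH] f h; (split; first by move=> x Ux; apply: (h [::])) => //.
  by move=> v; apply: IH => s x Ux; have := h (rcons s v) x Ux; rewrite foldr_rcons.
move: s f h; elim/last_ind => [|s v IH] f h x Ux; first exact: (Ck_diff (h 0%N)).
rewrite foldr_rcons; apply: IH => // k; exact: (proj2 (h k.+1) v).
Qed.

Lemma near_open_eq (T : Type) U (f g : V -> T) x :
  open U -> {in U, f =1 g} -> U x -> \near x, f x = g x.
Proof.
move=> oU e Ux; have : nbhs x U by exact: open_nbhs_nbhs.
by apply: filterS => y Uy; apply: e; rewrite inE.
Qed.

Lemma eq_derive_on (W : normedModType R) U (f g : V -> W) : open U ->
  {in U, f =1 g} -> forall v, {in U, 'D_v f =1 'D_v g}.
Proof.
move=> oU e v x; rewrite inE => Ux.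
apply: near_eq_derive; exact: (near_open_eq oU e Ux).
Qed.

(** Differentiability depends only on the germ: f - g vanishes near x, so that its
    differential there is 0. *)
Lemma eq_diff_on (W : normedModType R) U (f g : V -> W) x : open U ->
  {in U, f =1 g} -> U x -> differentiable f x -> differentiable g x.
Proof.
move=> oU e Ux df.
have gE : g = f + (g - f) by rewrite addrC subrK.
rewrite gE; apply: differentiableD => //.
have e0 : \near x, (g - f) x = (cst 0 : V -> W) x.
  have := near_open_eq oU e Ux; apply: filterS => y fy.
  by rewrite !fctE /= -fy subrr.
have e0x : (g - f) x = 0 by have := nbhs_singleton e0.
have H : (g - f) \o shift x = cst ((g - f) x) + (\0 : V -> W) +o_ 0 id.
  apply/eqaddoP => _/posnumP[eps].
  have e1 : \forall h \near 0, (g - f) (h + x) = 0.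
    by move: e0; rewrite (near_shift 0 x); apply: filterS => y /=; rewrite subr0.
  apply: filterS e1 => h eh; rewrite !fctE /= in eh e0x *.
  by rewrite eh e0x addr0 subr0 normr0 mulr_ge0.
have C : continuous (\0 : V -> W) by move=> y; apply: cvg_cst.
have E := @diff_unique _ _ _ (g - f) \0 x C H.
by apply/diff_locallyP; rewrite E.
Qed.

Lemma Ck_ext k U f g : open U -> {in U, f =1 g} -> Ck k U f -> Ck k U g.
Proof.
move=> oU; elim: k f g => [|k IH] f g e [h1 h2];
  (split; first by move=> x Ux; apply: (eq_diff_on oU e Ux); apply: h1) => //.
by move=> v; apply: (IH _ _ (eq_derive_on oU e v)); apply: h2.
Qed.

Lemma Ck_cst k U (a : R) : Ck k U (cst a).
Proof.
elim: k a => [|k IH] a; (split; first by move=> x _; apply: differentiable_cst) => // v.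
suff -> : 'D_v (cst a : V -> R) = cst 0 by apply: IH.
by apply/funext => x; rewrite derive_cst.
Qed.

(** The inductive step of all closure properties: the derivatives of f are given on
    U by a formula whose ingredients are already known to be of class k. *)
Lemma Ck_step k U f (F : V -> V -> R) : open U ->
  (forall x, U x -> differentiable f x) ->
  (forall x v, U x -> 'D_v f x = F v x) ->
  (forall v, Ck k U (F v)) -> Ck k.+1 U f.
Proof.
move=> oU df DF cF; apply/CkSE; split=> // v.
by apply: (Ck_ext oU _ (cF v)) => x; rewrite inE => Ux; rewrite DF.
Qed.

Lemma CkD k U f g : open U -> Ck k U f -> Ck k U g -> Ck k U (f + g).
Proof.
move=> oU; elim: k f g => [|k IH] f g.
  by move=> [f1 f2] [g1 g2]; split=> // x Ux; apply: differentiableD; auto.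
move=> /CkSE[f1 f2] /CkSE[g1 g2].
apply: (@Ck_step _ _ _ (fun v => 'D_v f + 'D_v g)) => //.
- by move=> x Ux; apply: differentiableD; auto.
- by move=> x v Ux; rewrite deriveD//; apply: diff_derivable; auto.
- by move=> v; apply: IH.
Qed.

Lemma CkM k U f g : open U -> Ck k U f -> Ck k U g -> Ck k U (f * g).
Proof.
move=> oU; elim: k f g => [|k IH] f g.
  by move=> [f1 f2] [g1 g2]; split=> // x Ux; apply: differentiableM; auto.
move=> hf hg; have /CkSE[f1 f2] := hf; have /CkSE[g1 g2] := hg.
apply: (@Ck_step _ _ _ (fun v => f * 'D_v g + g * 'D_v f)) => //.
- by move=> x Ux; apply: differentiableM; auto.
- by move=> x v Ux; rewrite deriveM//; apply: diff_derivable; auto.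
- by move=> v; apply: CkD => //; apply: IH => //; apply: CkW.
Qed.

Lemma CkN k U f : open U -> Ck k U f -> Ck k U (- f).
Proof.
move=> oU hf; have -> : - f = cst (-1) * f by apply/funext=> x; rewrite !fctE mulN1r.
by apply: CkM => //; apply: Ck_cst.
Qed.

Lemma CkV k U f : open U -> (forall x, U x -> f x != 0) ->
  Ck k U f -> Ck k U (fun x => (f x)^-1).
Proof.
move=> oU f0; elim: k => [|k IH].
  by move=> [f1 f2]; split=> // x Ux; apply: differentiableV; auto.
move=> hf; have /CkSE[f1 f2] := hf; have hV := IH (CkW hf).
apply: (@Ck_step _ _ _ (fun v => cst (-1) * ((fun x => (f x)^-1) * (fun x => (f x)^-1)) * 'D_v f)) => //.
- by move=> x Ux; apply: differentiableV; auto.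
- move=> x v Ux; rewrite deriveV; [|by auto|by apply: diff_derivable; auto].
  by rewrite !fctE expr2 invfM mulN1r.
- by move=> v; apply: CkM => //; apply: CkM => //; [apply: Ck_cst | apply: CkM].
Qed.

Lemma differentiable_sqrt_comp f x : differentiable f x -> 0 < f x ->
  differentiable (fun y => Num.sqrt (f y)) x.
Proof.
move=> df f0; apply: (@differentiable_comp _ _ _ _ f Num.sqrt) => //.
by apply/derivable1_diffP; have [] := is_derive1_sqrt f0.
Qed.

Lemma derive_sqrt_comp f x v : differentiable f x -> 0 < f x ->
  'D_v (fun y => Num.sqrt (f y)) x = (2 * Num.sqrt (f x))^-1 * 'D_v f x.
Proof.
move=> df f0.
have ds : differentiable (@Num.sqrt R) (f x).
  by apply/derivable1_diffP; have [] := is_derive1_sqrt f0.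
rewrite deriveE; last exact: differentiable_sqrt_comp.
rewrite (@diff_comp _ _ _ _ f Num.sqrt) //= -deriveE //.
rewrite -[X in 'D_X _ _]mulr1 [LHS]deriveE // [LHS]linearZ /= -deriveE // mulrC.
congr (_ * _); rewrite -deriveE //.
by have [_ ->] := is_derive1_sqrt f0.
Qed.

Lemma Ck_sqrt k U f : open U -> (forall x, U x -> 0 < f x) ->
  Ck k U f -> Ck k U (fun x => Num.sqrt (f x)).
Proof.
move=> oU f0; have s0 x : U x -> 2 * Num.sqrt (f x) != 0.
  by move=> /f0 fx; rewrite mulf_neq0// gt_eqF// sqrtr_gt0.
elim: k => [|k IH].
  by move=> [f1 f2]; split=> // x Ux; apply: differentiable_sqrt_comp; auto.
move=> hf; have /CkSE[f1 f2] := hf; have hV := IH (CkW hf).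
apply: (@Ck_step _ _ _ (fun v => (fun x => (2 * Num.sqrt (f x))^-1) * 'D_v f)) => //.
- by move=> x Ux; apply: differentiable_sqrt_comp; auto.
- by move=> x v Ux; rewrite derive_sqrt_comp; auto.
- move=> v; apply: CkM => //; apply: CkV => //.
  by apply: (@CkM _ _ (cst 2)) => //; apply: Ck_cst.
Qed.

Lemma Ck_linear k U (f : {linear V -> R}) : continuous f -> Ck k U f.
Proof.
move=> cf; case: k => [|k].
  by split=> // x _; apply: linear_differentiable.
split; first by move=> x _; apply: linear_differentiable.
move=> v; suff -> : 'D_v f = cst (f v) by apply: Ck_cst.
apply/funext => x; rewrite deriveE; last exact: linear_differentiable.
by rewrite diff_lin.
Qed.

End RealSmooth.

Section Composition.
Context {R : realType} {V : normedModType R}.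

Lemma rowE m (tau : V -> 'rV[R]_m) :
  tau = \sum_j (fun x => tau x 0 j *: (delta_mx 0 j : 'rV[R]_m)).
Proof.
by apply/funext => x; rewrite fct_sumE [LHS]row_sum_delta.
Qed.

Lemma differentiable_row m (tau : V -> 'rV[R]_m) x :
  (forall j, differentiable (fun x => tau x 0 j) x) -> differentiable tau x.
Proof.
move=> h; rewrite (rowE tau); apply: differentiable_sum => j.
exact: differentiableZl.
Qed.

Lemma derive_row m (tau : V -> 'rV[R]_m) x v j :
  differentiable tau x -> 'D_v (fun x => tau x 0 j) x = ('D_v tau x) 0 j.
Proof.
move=> dt; rewrite derive_mx ?mxE //; exact: diff_derivable.
Qed.

Lemma diff_delta m (f : 'rV[R]_m -> R) y (w : 'rV[R]_m) : differentiable f y ->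
  'D_w f y = \sum_j w 0 j * 'D_(delta_mx 0 j) f y.
Proof.
move=> df; rewrite deriveE // [in LHS](row_sum_delta w) raddf_sum /=.
by apply: eq_bigr => j _; rewrite linearZ /= deriveE.
Qed.

Lemma derive_comp_row m (tau : V -> 'rV[R]_m) (f : 'rV[R]_m -> R) x v :
  differentiable tau x -> differentiable f (tau x) ->
  'D_v (f \o tau) x = 'D_('D_v tau x) f (tau x).
Proof.
move=> dt df; rewrite deriveE; last exact: differentiable_comp.
by rewrite diff_comp //= -deriveE // -deriveE.
Qed.

Lemma Ck_big_sum k (U : set V) (I : Type) (r : seq I) (P : pred I) (F : I -> V -> R) :
  open U -> (forall i, Ck k U (F i)) -> Ck k U (fun x => \sum_(i <- r | P i) F i x).
Proof.
move=> oU h; elim: r => [|i r IH].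
  by under eq_fun do rewrite big_nil; apply: Ck_cst.
under eq_fun do rewrite big_cons; case: (P i) => //.
exact: (CkD oU (h i) IH).
Qed.

Lemma Ck_comp k (U : set V) m (U' : set 'rV[R]_m) (tau : V -> 'rV[R]_m) f :
  open U -> (forall x, U x -> U' (tau x)) ->
  (forall j, Ck k U (fun x => tau x 0 j)) -> Ck k U' f -> Ck k U (f \o tau).
Proof.
move=> oU UU'; elim: k f => [|k IH] f ht hf.
  split=> // x Ux; apply: differentiable_comp; last exact: (Ck_diff hf (UU' _ Ux)).
  by apply: differentiable_row => j; apply: (Ck_diff (ht j) Ux).
have /CkSE[f1 f2] := hf.
have dt x : U x -> differentiable tau x.
  by move=> Ux; apply: differentiable_row => j; apply: (Ck_diff (ht j) Ux).
apply: (@Ck_step _ _ _ _ _ (fun v x => \sum_j 'D_v (fun x => tau x 0 j) x *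
   ('D_(delta_mx 0 j) f \o tau) x)) => //.
- by move=> x Ux; apply: differentiable_comp; auto.
- move=> x v Ux; rewrite derive_comp_row; auto.
  rewrite diff_delta; auto; apply: eq_bigr => j _.
  by rewrite -derive_row //; auto.
- move=> v; apply: Ck_big_sum => // j; apply: (@CkM _ _ _ _ ('D_v (fun x => tau x 0 j))) => //.
    by have /CkSE[_] := ht j; apply.
  by apply: IH => // i; apply: CkW.
Qed.

End Composition.

Section Smooth.
Context {R : realType} {V : normedModType R}.
Variables (U : set V).
Hypothesis oU : open U.
Implicit Types (f g : V -> R).

Lemma smooth_diff f x : smooth_on U f -> U x -> differentiable f x.
Proof. by move=> /smooth_onP h; apply: (Ck_diff (h 0%N)). Qed.

Lemma smooth_derive f v : smooth_on U f -> smooth_on U ('D_v f).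
Proof.
move=> /smooth_onP h; apply/smooth_onP => k.
by have /CkSE[_] := h k.+1; apply.
Qed.

Lemma smooth_sub U' f : U' `<=` U -> smooth_on U f -> smooth_on U' f.
Proof. by move=> s /smooth_onP h; apply/smooth_onP => k; apply: Ck_sub (h k). Qed.

Lemma smooth_cst (a : R) : smooth_on U (fun _ => a).
Proof. by apply/smooth_onP => k; apply: Ck_cst. Qed.

Lemma smoothD f g : smooth_on U f -> smooth_on U g -> smooth_on U (fun x => f x + g x).
Proof. by move=> /smooth_onP h /smooth_onP h'; apply/smooth_onP => k; apply: CkD. Qed.

Lemma smoothM f g : smooth_on U f -> smooth_on U g -> smooth_on U (fun x => f x * g x).
Proof. by move=> /smooth_onP h /smooth_onP h'; apply/smooth_onP => k; apply: CkM. Qed.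

Lemma smoothN f : smooth_on U f -> smooth_on U (fun x => - f x).
Proof. by move=> /smooth_onP h; apply/smooth_onP => k; apply: CkN. Qed.

Lemma smoothB f g : smooth_on U f -> smooth_on U g -> smooth_on U (fun x => f x - g x).
Proof. by move=> hf hg; apply: smoothD => //; apply: smoothN. Qed.

Lemma smoothV f : (forall x, U x -> f x != 0) -> smooth_on U f ->
  smooth_on U (fun x => (f x)^-1).
Proof. by move=> f0 /smooth_onP h; apply/smooth_onP => k; apply: CkV. Qed.

Lemma smooth_sqrt f : (forall x, U x -> 0 < f x) -> smooth_on U f ->
  smooth_on U (fun x => Num.sqrt (f x)).
Proof. by move=> f0 /smooth_onP h; apply/smooth_onP => k; apply: Ck_sqrt. Qed.

Lemma smooth_comp m (U' : set 'rV[R]_m) (tau : V -> 'rV[R]_m) (f : 'rV[R]_m -> R) :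
  (forall x, U x -> U' (tau x)) ->
  smoothr_on U tau -> smooth_on U' f -> smooth_on U (fun x => f (tau x)).
Proof.
move=> h ht /smooth_onP hf; apply/smooth_onP => k.
by apply: (Ck_comp oU h) => // j; apply/smooth_onP: k; apply: ht.
Qed.

Lemma smoothr_diff m (tau : V -> 'rV[R]_m) x : smoothr_on U tau -> U x ->
  differentiable tau x.
Proof. by move=> h Ux; apply: differentiable_row => j; apply: smooth_diff (h j) Ux. Qed.

End Smooth.

Lemma smooth_coord (R : realType) m (U : set 'rV[R]_m) j :
  smooth_on U (fun x : 'rV[R]_m => x 0 j).
Proof.
apply/smooth_onP => k.
pose f := (fun x : 'rV[R]_m => x 0 j).
have lf : linear f by move=> a x y; rewrite /f !mxE.
pose F := GRing.isLinear.Build _ _ _ _ f lf.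
pose L : {linear 'rV[R]_m -> R} := HB.pack f F.
apply: (@Ck_linear _ _ k U L) => x.
by apply: differentiable_continuous; apply: differentiable_coord.
Qed.

Lemma smooth_id (R : realType) (U : set R) : smooth_on U (fun x : R => x).
Proof.
apply/smooth_onP => k; apply: (@Ck_linear _ _ k U idfun) => x.
exact: cvg_id.
Qed.

(** * Symmetry of second derivatives *)
Section Clairaut.
Context {R : realType} {V : normedModType R}.
Implicit Types (U : set V) (f g : V -> R).

Lemma is_derive_line f (x u : V) (s : R) : differentiable f (x + s *: u) ->
  is_derive s 1 (fun t : R => f (x + t *: u)) ('D_u f (x + s *: u)).
Proof.
move=> df.
have E : (fun t : R => x + t *: u) = cst x + (fun t : R => t *: u) by [].
have dl : differentiable (fun t : R => x + t *: u) s.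
  by rewrite E; apply: differentiableD => //; apply: differentiableZl.
have := differentiable_comp dl df; rewrite /comp => dc.
apply: DeriveDef; first exact: diff_derivable.
rewrite deriveE // (diff_comp dl df) /= deriveE //; congr ('d f _ _).
have H : is_diff s (fun t : R => x + t *: u) (fun t : R => t *: u).
  by rewrite E; apply: is_diff_eq; rewrite add0r.
by rewrite diff_val scale1r.
Qed.

Lemma mvt_line f (x u : V) (h : R) : 0 < h ->
  (forall s, 0 <= s <= h -> differentiable f (x + s *: u)) ->
  exists2 s, 0 < s < h & f (x + h *: u) - f x = h * 'D_u f (x + s *: u).
Proof.
move=> h0 df.
have H s : s \in `]0, h[ -> is_derive s 1 (fun t : R => f (x + t *: u)) ('D_u f (x + s *: u)).
  rewrite in_itv /= => /andP[s0 sh]; apply: is_derive_line; apply: df.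
  by rewrite !ltW.
have C : {within `[0, h], continuous (fun t : R => f (x + t *: u))}.
  apply: continuous_in_subspaceT => s; rewrite inE /= in_itv /= => sh.
  apply: differentiable_continuous.
  by have [/derivable1_diffP] := is_derive_line (df s sh).
have [c] := MVT h0 H C; rewrite in_itv /= => ch.
by rewrite scale0r addr0 subr0 mulrC => E; exists c.
Qed.

(** The mean value theorem, applied in the direction u to y |-> f (y + h v) - f y
    and then in the direction v, makes the second difference a value of the mixed
    derivative.  The left-hand side is symmetric in u and v. *)
Lemma second_difference U f (x u v : V) (h : R) : 0 < h -> smooth_on U f ->
  (forall s t, 0 <= s <= h -> 0 <= t <= h -> U (x + s *: u + t *: v)) ->
  exists s t, [/\ 0 <= s <= h, 0 <= t <= h &
    f (x + h *: u + h *: v) - f (x + h *: u) - f (x + h *: v) + f x =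
    h * (h * 'D_v ('D_u f) (x + s *: u + t *: v))].
Proof.
move=> h0 sf HU.
pose g := (fun y => f (y + h *: v)) - f.
have h01 : 0 <= h <= h by rewrite lexx ltW.
have h00 : 0 <= (0 : R) <= h by rewrite lexx ltW.
have dU y : U y -> differentiable f y by exact: smooth_diff.
have shift_cont y : differentiable (fun z : V => z + h *: v) y.
  have -> : (fun z : V => z + h *: v) = id + cst (h *: v) by [].
  exact: differentiableD.
have d1 y : U (y + h *: v) -> differentiable (fun y => f (y + h *: v)) y.
  by move=> Uy; apply: (@differentiable_comp _ _ _ _ (fun z : V => z + h *: v) f) => //; apply: dU.
have Dg y : U y -> U (y + h *: v) -> 'D_u g y = 'D_u f (y + h *: v) - 'D_u f y.
  move=> U1 U2; rewrite deriveB; try by apply: diff_derivable; auto.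
  congr (_ - _); rewrite deriveE; last by auto.
  rewrite (@diff_comp _ _ _ _ (fun z : V => z + h *: v) f); [|by []|by auto].
  rewrite /= deriveE; last by auto.
  congr ('d f _ _).
  have H : is_diff y (fun z : V => z + h *: v) id.
    have -> : (fun z : V => z + h *: v) = id + cst (h *: v) by [].
    by apply: is_diff_eq; rewrite addr0.
  by rewrite diff_val.
have U0 s : 0 <= s <= h -> U (x + s *: u).
  by move=> sh; have := HU s 0 sh h00; rewrite scale0r addr0.
have [s sh] : exists2 s, 0 < s < h & g (x + h *: u) - g x = h * 'D_u g (x + s *: u).
  apply: (@mvt_line g x u h h0) => s sh; apply: differentiableB; last by apply: dU; apply: U0.
  by apply: d1; apply: HU.
have sh' : 0 <= s <= h by case/andP: sh => s0 s1; rewrite !ltW.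
rewrite Dg; [|exact: U0|exact: HU].
have [t th ->] : exists2 t, 0 < t < h &
   'D_u f (x + s *: u + h *: v) - 'D_u f (x + s *: u) = h * 'D_v ('D_u f) (x + s *: u + t *: v).
  apply: (@mvt_line ('D_u f) (x + s *: u) v h h0) => t th.
  by apply: smooth_diff (smooth_derive _ sf) _; apply: HU.
move=> E; exists s, t; split => //; first by case/andP: th => s0 s1; rewrite !ltW.
rewrite -E /g !fctE; lra.
Qed.

Lemma parallelogram_small (A : set V) (x u v : V) : nbhs x A ->
  exists2 h : R, 0 < h & forall s t, 0 <= s <= h -> 0 <= t <= h -> A (x + s *: u + t *: v).
Proof.
move=> /nbhs_ballP[r /= r0 rA].
have k0 : 0 < `|u| + `|v| + 1 by rewrite ltr_wpDl // addr_ge0.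
exists (r / 2 / (`|u| + `|v| + 1)); first by rewrite !divr_gt0.
move=> s t /andP[s0 sh] /andP[t0 th]; apply: rA; rewrite -ball_normE /ball_ /=.
rewrite -addrA opprD addrA subrr sub0r normrN.
apply: le_lt_trans (ler_normD _ _) _; rewrite !normrZ !ger0_norm //.
apply: (@le_lt_trans _ _ (r / 2 / (`|u| + `|v| + 1) * (`|u| + `|v| + 1))).
  rewrite mulrDr mulrDr -addrA lerD // ?ler_wpM2r //.
  rewrite -[_ * `|v|]addr0 lerD // ?ler_wpM2r // mulr1.
  by rewrite !divr_ge0 // ltW.
by rewrite divfK ?gt_eqF // ltr_pdivrMr // mulr_natr mulr2n ltrDl.
Qed.

Lemma exch_sub (a b c d : R) : a - b - c + d = a - c - b + d.
Proof. by rewrite [a - b - c]addrAC. Qed.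

Lemma close_to_common (a b c e : R) :
  `|a - c| < e / 2 -> `|b - c| < e / 2 -> `|a - b| <= e.
Proof.
move=> ac bc; have -> : a - b = (a - c) - (b - c) by lra.
by apply: le_trans (ler_normB _ _) _; lra.
Qed.

(** Each mixed derivative takes the value of the second difference somewhere in a
    small parallelogram; by continuity at x, the two are arbitrarily close. *)
Lemma clairaut U f (x u v : V) : open U -> smooth_on U f -> U x ->
  'D_v ('D_u f) x = 'D_u ('D_v f) x.
Proof.
move=> oU sf Ux; apply/eqP; rewrite eq_sym -subr_eq0 -normr_eq0 eq_le normr_ge0 andbT.
apply/ler_addgt0Pl => e e0; rewrite addr0.
have c1 : {for x, continuous ('D_v ('D_u f))}.
  apply: differentiable_continuous.
  by apply: smooth_diff Ux; apply: smooth_derive => //; apply: smooth_derive.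
have c2 : {for x, continuous ('D_u ('D_v f))}.
  apply: differentiable_continuous.
  by apply: smooth_diff Ux; apply: smooth_derive => //; apply: smooth_derive.
have e2 : 0 < e / 2 by rewrite divr_gt0.
move/cvgrPdist_lt: c1 => /(_ _ e2) c1; move/cvgrPdist_lt: c2 => /(_ _ e2) c2.
have nU : nbhs x U by exact: open_nbhs_nbhs.
pose A1 := [set t | `|'D_v ('D_u f) x - 'D_v ('D_u f) t| < e / 2].
pose A2 := [set t | `|'D_u ('D_v f) x - 'D_u ('D_v f) t| < e / 2].
have nA : nbhs x (A1 `&` A2 `&` U) by exact: (filterI (filterI (c1 : nbhs x A1) (c2 : nbhs x A2)) nU).
have [h h0 H] := parallelogram_small u v nA.
have [s [t [sh th E1]]] := @second_difference U f x u v h h0 sf (fun s t a b => proj2 (H s t a b)).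
have H' a b : 0 <= a <= h -> 0 <= b <= h -> U (x + a *: v + b *: u).
  by move=> ah bh; rewrite addrAC; case: (H _ _ bh ah).
have [s' [t' [sh' th' E2]]] := @second_difference U f x v u h h0 sf H'.
have E : 'D_v ('D_u f) (x + s *: u + t *: v) = 'D_u ('D_v f) (x + s' *: v + t' *: u).
  have exch : x + h *: u + h *: v = x + h *: v + h *: u by rewrite addrAC.
  apply: (mulfI (lt0r_neq0 h0)); apply: (mulfI (lt0r_neq0 h0)).
  move: E1 E2; rewrite exch => E1 E2.
  exact: etrans (esym E1) (etrans (exch_sub _ _ _ _) E2).
have [[B1 _] _] := H s t sh th.
have [[_ B2] _] := H t' s' th' sh'.
rewrite /A2 /= addrAC -E in B2; rewrite /A1 /= in B1.
exact: close_to_common B2 B1.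
Qed.

End Clairaut.

(** * Calculus of complex-valued functions *)
Section ComplexParts.
Context {R : rcfType}.
Implicit Types x y : R[i].
Local Notation Re := complex.Re.
Local Notation Im := complex.Im.

Lemma complex_ext x y : Re x = Re y -> Im x = Im y -> x = y.
Proof. by case: x y => a b [c d] /= -> ->. Qed.
Lemma cReD x y : Re (x + y) = Re x + Re y. Proof. by case: x y => a b [c d]. Qed.
Lemma cImD x y : Im (x + y) = Im x + Im y. Proof. by case: x y => a b [c d]. Qed.
Lemma cReN x : Re (- x) = - Re x. Proof. by case: x. Qed.
Lemma cImN x : Im (- x) = - Im x. Proof. by case: x. Qed.
Lemma cReB x y : Re (x - y) = Re x - Re y. Proof. by rewrite cReD cReN. Qed.
Lemma cImB x y : Im (x - y) = Im x - Im y. Proof. by rewrite cImD cImN. Qed.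
Lemma cReM x y : Re (x * y) = Re x * Re y - Im x * Im y.
Proof. by case: x y => a b [c d]. Qed.
Lemma cImM x y : Im (x * y) = Re x * Im y + Im x * Re y.
Proof. by case: x y => a b [c d]. Qed.
Lemma cReJ x : Re x^*%C = Re x. Proof. by case: x. Qed.
Lemma cImJ x : Im x^*%C = - Im x. Proof. by case: x. Qed.
Lemma Re0 : Re (0 : R[i]) = 0. Proof. by []. Qed.
Lemma Im0 : Im (0 : R[i]) = 0. Proof. by []. Qed.
Lemma Re1 : Re (1 : R[i]) = 1. Proof. by []. Qed.
Lemma Im1 : Im (1 : R[i]) = 0. Proof. by []. Qed.
Lemma ReR (a : R) : Re a%:C = a. Proof. by []. Qed.
Lemma ImR (a : R) : Im a%:C = 0. Proof. by []. Qed.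
Lemma ReI : Re ('i%C : R[i]) = 0. Proof. by []. Qed.
Lemma ImI : Im ('i%C : R[i]) = 1. Proof. by []. Qed.
Lemma Re_sum n (F : 'I_n -> R[i]) : Re (\sum_j F j) = \sum_j Re (F j).
Proof. exact: (big_morph _ cReD Re0). Qed.
Definition ReImE := (cReD, cImD, cReN, cImN, cReM, cImM, cReJ, cImJ, Re0, Im0, Re1, Im1, ReR, ImR, ReI, ImI).

Lemma sqr_parts_eq0 x : (Re x ^+ 2 + Im x ^+ 2 == 0) = (x == 0).
Proof.
case: x => a b; rewrite eq_complex /= paddr_eq0 ?sqr_ge0 //.
by rewrite !sqrf_eq0.
Qed.

Lemma invc_parts x : x^-1 = (Re x ^+ 2 + Im x ^+ 2)^-1%:C * x^*%C.
Proof. by case: x => a b; apply: complex_ext; rewrite ReImE /= mul0r ?subr0 ?addr0 1?mulrC ?mulrN ?mulNr. Qed.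

Lemma conjcD x y : (x + y)^*%C = x^*%C + y^*%C. Proof. exact: rmorphD. Qed.
Lemma conjcM x y : (x * y)^*%C = x^*%C * y^*%C. Proof. exact: rmorphM. Qed.
Lemma conjcN x : (- x)^*%C = - x^*%C. Proof. exact: rmorphN. Qed.
Lemma conjcR (a : R) : (a%:C)^*%C = a%:C. Proof. by rewrite /conjc /= oppr0. Qed.

End ComplexParts.

Section ComplexCalculus.
Context {R : realType} {V : normedModType R}.
Local Notation Re := complex.Re.
Local Notation Im := complex.Im.
Implicit Types (U : set V) (f g : V -> R[i]).

Definition cdiff f x :=
  differentiable (fun y => Re (f y)) x /\ differentiable (fun y => Im (f y)) x.

Lemma Re_cderive f x v : Re (cderive f x v) = 'D_v (fun y => Re (f y)) x.
Proof. by []. Qed.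
Lemma Im_cderive f x v : Im (cderive f x v) = 'D_v (fun y => Im (f y)) x.
Proof. by []. Qed.
Lemma eq_cderive f g x v : f =1 g -> cderive f x v = cderive g x v.
Proof. by move=> /funext ->. Qed.
Definition cderE := (Re_cderive, Im_cderive).

Lemma csmooth_cdiff U f x : csmooth_on U f -> U x -> cdiff f x.
Proof. by move=> [h1 h2] Ux; split; apply: smooth_diff Ux. Qed.

Lemma cderiveD f g x v : cdiff f x -> cdiff g x ->
  cderive (fun y => f y + g y) x v = cderive f x v + cderive g x v.
Proof.
move=> [f1 f2] [g1 g2]; apply: complex_ext; rewrite ?cReD ?cImD !cderE.
  under eq_fun => y do rewrite cReD.
  by rewrite deriveD //; apply: diff_derivable.
under eq_fun => y do rewrite cImD.
by rewrite deriveD //; apply: diff_derivable.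
Qed.

Lemma cderiveM f g x v : cdiff f x -> cdiff g x ->
  cderive (fun y => f y * g y) x v = cderive f x v * g x + f x * cderive g x v.
Proof.
move=> [f1 f2] [g1 g2]; apply: complex_ext; rewrite ?cReD ?cImD ?cReM ?cImM !cderE.
  under eq_fun => y do rewrite cReM.
  rewrite deriveB ?deriveM; try (by apply: diff_derivable); try (by apply: derivableM; apply: diff_derivable).
  by rewrite /GRing.scale /=; lra.
under eq_fun => y do rewrite cImM.
rewrite deriveD ?deriveM; try (by apply: diff_derivable); try (by apply: derivableM; apply: diff_derivable).
by rewrite /GRing.scale /=; lra.
Qed.

Lemma cderive_cst (a : R[i]) x v : cderive (fun _ : V => a) x v = 0.
Proof. by rewrite /cderive !derive_cst. Qed.

Lemma cdiff_cst (a : R[i]) x : cdiff (fun _ : V => a) x.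
Proof. by split; apply: differentiable_cst. Qed.

Lemma cdiffD f g x : cdiff f x -> cdiff g x -> cdiff (fun y => f y + g y) x.
Proof.
move=> [f1 f2] [g1 g2]; split.
  by under eq_fun => y do rewrite cReD; apply: differentiableD.
by under eq_fun => y do rewrite cImD; apply: differentiableD.
Qed.

Lemma cdiffM f g x : cdiff f x -> cdiff g x -> cdiff (fun y => f y * g y) x.
Proof.
move=> [f1 f2] [g1 g2]; split.
  by under eq_fun => y do rewrite cReM; apply: differentiableB; apply: differentiableM.
by under eq_fun => y do rewrite cImM; apply: differentiableD; apply: differentiableM.
Qed.

Lemma cdiffJ f x : cdiff f x -> cdiff (fun y => (f y)^*%C) x.
Proof.
move=> [f1 f2]; split; first by under eq_fun => y do rewrite cReJ.
by under eq_fun => y do rewrite cImJ; apply: differentiableN.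
Qed.

Lemma cderiveJ f x v : cdiff f x ->
  cderive (fun y => (f y)^*%C) x v = (cderive f x v)^*%C.
Proof.
move=> [f1 f2]; apply: complex_ext; rewrite ?cReJ ?cImJ !cderE.
  by under eq_fun => y do rewrite cReJ.
under eq_fun => y do rewrite cImJ.
by rewrite deriveN //; apply: diff_derivable.
Qed.

Lemma cderiveN f x v : cdiff f x ->
  cderive (fun y => - f y) x v = - cderive f x v.
Proof.
move=> h; under eq_fun do rewrite -mulN1r.
by rewrite cderiveM // ?cderive_cst ?mul0r ?add0r ?mulN1r //; apply: cdiff_cst.
Qed.

Lemma cdiffN f x : cdiff f x -> cdiff (fun y => - f y) x.
Proof.
move=> h; under eq_fun do rewrite -mulN1r.
by apply: cdiffM => //; apply: cdiff_cst.
Qed.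

Lemma cderiveB f g x v : cdiff f x -> cdiff g x ->
  cderive (fun y => f y - g y) x v = cderive f x v - cderive g x v.
Proof. by move=> hf hg; rewrite cderiveD ?cderiveN //; apply: cdiffN. Qed.

Lemma cdiff_sum n (f : 'I_n -> V -> R[i]) x : (forall j, cdiff (f j) x) ->
  cdiff (fun y => \sum_j f j y) x.
Proof.
elim: n f => [|n IH] f h.
  by under eq_fun do rewrite big_ord0; apply: cdiff_cst.
under eq_fun do rewrite big_ord_recl.
by apply: cdiffD => //; apply: IH.
Qed.

Lemma cderive_sum n (f : 'I_n -> V -> R[i]) x v : (forall j, cdiff (f j) x) ->
  cderive (fun y => \sum_j f j y) x v = \sum_j cderive (f j) x v.
Proof.
elim: n f => [|n IH] f h.
  by under eq_fun do rewrite big_ord0; rewrite big_ord0 cderive_cst.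
under eq_fun do rewrite big_ord_recl.
rewrite cderiveD //; last by apply: cdiff_sum => j; apply: h.
by rewrite big_ord_recl IH.
Qed.

Lemma cdiffR (g : V -> R) x : differentiable g x -> cdiff (fun y => (g y)%:C) x.
Proof. by move=> h; split => //=; apply: differentiable_cst. Qed.

Lemma cderiveR (g : V -> R) x v : cderive (fun y => (g y)%:C) x v = ('D_v g x)%:C.
Proof. by rewrite /cderive /= derive_cst. Qed.

Lemma cderive_on U f g x v : open U -> U x -> {in U, f =1 g} ->
  cderive f x v = cderive g x v.
Proof.
move=> oU Ux e; have Ux' : x \in U by rewrite inE.
congr (_ +i* _).
  by apply: (@eq_derive_on _ _ _ U) => // y Uy; rewrite e.
by apply: (@eq_derive_on _ _ _ U) => // y Uy; rewrite e.
Qed.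

Lemma cdiff_on U f g x : open U -> U x -> {in U, f =1 g} -> cdiff f x -> cdiff g x.
Proof.
move=> oU Ux e [h1 h2]; split.
  by apply: (eq_diff_on oU _ Ux h1) => y Uy; rewrite e.
by apply: (eq_diff_on oU _ Ux h2) => y Uy; rewrite e.
Qed.

Lemma cderive_dirD f x u v : cdiff f x ->
  cderive f x (u + v) = cderive f x u + cderive f x v.
Proof.
move=> [h1 h2]; rewrite /cderive !(deriveE _ h1) !(deriveE _ h2) !raddfD.
by apply: complex_ext; rewrite ReImE.
Qed.

Lemma cderive_dirZ f x (a : R) v : cdiff f x ->
  cderive f x (a *: v) = a%:C * cderive f x v.
Proof.
move=> [h1 h2]; rewrite /cderive !(deriveE _ h1) !(deriveE _ h2) !linearZ.
by apply: complex_ext; rewrite ReImE /= ?mul0r ?subr0 ?addr0.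
Qed.

Section On.
Variable U : set V.
Hypothesis oU : open U.

Lemma csmooth_sub U' f : U' `<=` U -> csmooth_on U f -> csmooth_on U' f.
Proof. by move=> s [h1 h2]; split; apply: smooth_sub s _. Qed.

Lemma csmooth_cst (a : R[i]) : csmooth_on U (fun _ => a).
Proof. by split; apply: smooth_cst. Qed.

Lemma csmoothD f g : csmooth_on U f -> csmooth_on U g -> csmooth_on U (fun x => f x + g x).
Proof.
move=> [f1 f2] [g1 g2]; split.
  by under eq_fun do rewrite cReD; apply: smoothD.
by under eq_fun do rewrite cImD; apply: smoothD.
Qed.

Lemma csmoothM f g : csmooth_on U f -> csmooth_on U g -> csmooth_on U (fun x => f x * g x).
Proof.
move=> [f1 f2] [g1 g2]; split.
  by under eq_fun do rewrite cReM; apply: smoothB => //; apply: smoothM.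
by under eq_fun do rewrite cImM; apply: smoothD => //; apply: smoothM.
Qed.

Lemma csmoothN f : csmooth_on U f -> csmooth_on U (fun x => - f x).
Proof.
by move=> h; under eq_fun do rewrite -mulN1r; apply: csmoothM => //; apply: csmooth_cst.
Qed.

Lemma csmoothB f g : csmooth_on U f -> csmooth_on U g -> csmooth_on U (fun x => f x - g x).
Proof. by move=> hf hg; apply: csmoothD => //; apply: csmoothN. Qed.

Lemma csmoothJ f : csmooth_on U f -> csmooth_on U (fun x => (f x)^*%C).
Proof.
move=> [f1 f2]; split; first by under eq_fun do rewrite cReJ.
by under eq_fun do rewrite cImJ; apply: smoothN.
Qed.

Lemma csmoothR (g : V -> R) : smooth_on U g -> csmooth_on U (fun x => (g x)%:C).
Proof. by move=> h; split => //; apply: smooth_cst. Qed.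

Lemma csmooth_sum n (f : 'I_n -> V -> R[i]) : (forall j, csmooth_on U (f j)) ->
  csmooth_on U (fun y => \sum_j f j y).
Proof.
elim: n f => [|n IH] f h.
  by under eq_fun do rewrite big_ord0; apply: csmooth_cst.
under eq_fun do rewrite big_ord_recl.
by apply: csmoothD => //; apply: IH.
Qed.

Lemma csmoothV f : (forall x, U x -> f x != 0) -> csmooth_on U f ->
  csmooth_on U (fun x => (f x)^-1).
Proof.
move=> f0 hf; have [f1 f2] := hf.
under eq_fun do rewrite invc_parts.
apply: csmoothM; last exact: csmoothJ.
apply: csmoothR; apply: smoothV => //; first by move=> x Ux; rewrite sqr_parts_eq0 f0.
under eq_fun do rewrite !expr2.
by apply: smoothD => //; apply: smoothM.
Qed.

Lemma csmooth_derive f v : csmooth_on U f -> csmooth_on U (fun x => cderive f x v).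
Proof. by move=> [h1 h2]; split; apply: smooth_derive. Qed.

Lemma cclairaut f x u v : csmooth_on U f -> U x ->
  cderive (fun y => cderive f y u) x v = cderive (fun y => cderive f y v) x u.
Proof.
move=> [h1 h2] Ux; apply: complex_ext.
  exact: (clairaut u v oU h1 Ux).
exact: (clairaut u v oU h2 Ux).
Qed.

Lemma csmooth_comp m (U' : set 'rV[R]_m) (tau : V -> 'rV[R]_m) (f : 'rV[R]_m -> R[i]) :
  (forall x, U x -> U' (tau x)) ->
  smoothr_on U tau -> csmooth_on U' f -> csmooth_on U (fun x => f (tau x)).
Proof. by move=> h ht [h1 h2]; split; [apply: (smooth_comp oU h ht h1)|apply: (smooth_comp oU h ht h2)]. Qed.

End On.

Lemma cderive_comp m (tau : V -> 'rV[R]_m) (f : 'rV[R]_m -> R[i]) x v :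
  differentiable tau x -> differentiable (fun y => Re (f y)) (tau x) ->
  differentiable (fun y => Im (f y)) (tau x) ->
  cderive (fun y => f (tau y)) x v = cderive f (tau x) ('D_v tau x).
Proof.
move=> dt d1 d2; rewrite /cderive; congr (_ +i* _).
  exact: (derive_comp_row v dt d1).
exact: (derive_comp_row v dt d2).
Qed.

End ComplexCalculus.

(** * The inverse function theorem *)
Section CkMatrix.
Context {R : realType} {V : normedModType R}.
Variables (U : set V).
Hypothesis oU : open U.

Lemma Ck_big_prod k (I : Type) (r : seq I) (P : pred I) (F : I -> V -> R) :
  (forall i, Ck k U (F i)) -> Ck k U (fun x => \prod_(i <- r | P i) F i x).
Proof.
move=> h; elim: r => [|i r IH].
  by under eq_fun do rewrite big_nil; apply: Ck_cst.
under eq_fun do rewrite big_cons; case: (P i) => //.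
exact: (CkM oU (h i) IH).
Qed.

Lemma Ck_det k m (B : V -> 'M[R]_m) : (forall a b, Ck k U (fun x => B x a b)) ->
  Ck k U (fun x => \det (B x)).
Proof.
move=> h; apply: Ck_big_sum => // s.
apply: (@CkM _ _ _ _ (cst _)) => //; first exact: Ck_cst.
exact: Ck_big_prod.
Qed.

(** By the formula for the inverse in terms of cofactors. *)
Lemma Ck_invmx k m (B : V -> 'M[R]_m) a b : (forall a b, Ck k U (fun x => B x a b)) ->
  (forall x, U x -> B x \in unitmx) -> Ck k U (fun x => invmx (B x) a b).
Proof.
move=> h u.
apply: (@Ck_ext _ _ _ _ (fun x => (\det (B x))^-1 * cofactor (B x) b a)) => //.
  by move=> x; rewrite inE => Ux; rewrite /invmx u // !mxE.
apply: CkM => //.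
  apply: CkV => //; last exact: Ck_det.
  by move=> x /u; rewrite unitmxE unitfE.
apply: (@CkM _ _ _ _ (cst _)) => //; first exact: Ck_cst.
by apply: Ck_det => i j; under eq_fun do rewrite !mxE; apply: h.
Qed.

End CkMatrix.

Lemma near_dist (R : realType) (V : normedModType R) (f : V -> R) x (e : R) :
  {for x, continuous f} -> 0 < e -> nbhs x [set y | `|f x - f y| < e].
Proof. by move=> /cvgrPdist_lt c e0; exact: (c e e0). Qed.

Lemma nbhs_shift0 (R : realType) (V : normedModType R) (A : set V) (x : V) :
  nbhs x A -> nbhs (0 : V) [set z | A (z + x)].
Proof.
move=> hA; have : \forall z \near x, A z by exact: hA.
by rewrite (near_shift 0 x); apply: filterS => z /=; rewrite subr0.
Qed.

Lemma diff_eps (R : realType) (V W : normedModType R) (f : V -> W)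
    (df : {linear V -> W}) x : continuous df ->
  (forall e : R, 0 < e -> \forall h \near 0, `|f (h + x) - (f x + df h)| <= e * `|h|) ->
  differentiable f x /\ 'd f x = df :> (V -> W).
Proof.
move=> cdf H.
have H1 : f \o shift x = cst (f x) + df +o_ 0 id.
  by apply/eqaddoP => e e0; apply: filterS (H e e0) => h; rewrite !fctE.
have E : 'd f x = df :> (V -> W) := diff_unique cdf H1.
by split=> //; apply/diff_locallyP; rewrite E.
Qed.

Section InverseFunction.
Context {R : realType} {m : nat}.
Implicit Types (f : 'rV[R]_m -> 'rV[R]_m) (U : set 'rV[R]_m).

Lemma norm_coord (v : 'rV[R]_m) j : `|v 0 j| <= `|v|.
Proof.
rewrite [leRHS]/Num.norm /= mx_normrE.
exact: (le_bigmax_cond 0 (fun ij : 'I_1 * 'I_m => `|v ij.1 ij.2|) (j := (0, j))).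
Qed.

Lemma norm_row_le (v : 'rV[R]_m) (c : R) : 0 <= c -> (forall j, `|v 0 j| <= c) -> `|v| <= c.
Proof.
move=> c0 h; rewrite [leLHS]/Num.norm /= mx_normrE.
by apply: bigmax_le => // -[i j] _ /=; rewrite ord1.
Qed.

Lemma smoothr_affine U (b : 'rV[R]_m) (B : 'M[R]_m) : open U ->
  smoothr_on U (fun y => (y - b) *m B).
Proof.
move=> oU j; under eq_fun do rewrite mxE.
apply/smooth_onP => k; apply: Ck_big_sum => // i.
apply: (@CkM _ _ _ _ (fun y : 'rV[R]_m => (y - b) 0 i) (cst _)) => //; last exact: Ck_cst.
under eq_fun do rewrite !mxE.
by move: k; apply/smooth_onP; apply: smoothB => //; [apply: smooth_coord|apply: smooth_cst].
Qed.

Lemma mulmxr_lipschitz (B : 'M[R]_m) : exists2 c : R, 0 < c & forall v : 'rV[R]_m, `|v *m B| <= c * `|v|.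
Proof.
have C : continuous (mulmxr B : {linear 'rV[R]_m -> 'rV[R]_m}).
  move=> x; apply: differentiable_continuous.
  have := smoothr_diff (@smoothr_affine setT 0 B openT) (I : setT x).
  by under eq_fun do rewrite subr0.
by have [c c0 hc] := linear_lipschitz C; exists c.
Qed.

Definition jac f x : 'M[R]_m := \matrix_(i, j) 'D_(delta_mx 0 i) (fun y => f y 0 j) x.

Lemma derive_jac f x v : differentiable f x -> 'D_v f x = v *m jac f x.
Proof.
move=> df; apply/rowP => j; rewrite -derive_row // !mxE diff_delta.
  by apply: eq_bigr => i _; rewrite mxE.
exact: (differentiable_comp df (differentiable_coord _ _ _)).
Qed.

Section Near.
Variables (U : set 'rV[R]_m) (f : 'rV[R]_m -> 'rV[R]_m) (x0 : 'rV[R]_m).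
Hypotheses (oU : open U) (Ux0 : U x0) (sf : smoothr_on U f) (uJ : jac f x0 \in unitmx).
(* Solving f x = y amounts to finding a fixed point of x |-> h x + y A, and h has
   zero differential at x0. *)
Let A := invmx (jac f x0).
Let h x := x - f x *m A.

Let sh : smoothr_on U h.
Proof.
move=> j; under eq_fun do rewrite /h !mxE.
apply: smoothB => //; first exact: smooth_coord.
apply/smooth_onP => k; apply: Ck_big_sum => // i.
apply: (@CkM _ _ _ _ (fun y => f y 0 i) (cst _)) => //; last exact: Ck_cst.
by move: k; apply/smooth_onP.
Qed.

Let dh0 i j : 'D_(delta_mx 0 i) (fun x => h x 0 j) x0 = 0.
Proof.
have dc k : derivable (fun x => f x 0 k) x0 (delta_mx 0 i).
  by apply: diff_derivable; apply: smooth_diff (sf k) Ux0.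
have -> : (fun x => h x 0 j) = (fun x : 'rV[R]_m => x 0 j) - \sum_k (fun x => f x 0 k * A k j).
  by apply/funext => x; rewrite /h !fctE fct_sumE !mxE.
have dcA k : derivable (fun x => f x 0 k * A k j) x0 (delta_mx 0 i).
  by apply: (@derivableM _ _ (fun x => f x 0 k) (cst (A k j))).
rewrite deriveB; [|by apply: diff_derivable; apply: differentiable_coord|exact: derivable_sum].
rewrite derive_sum // (@derive_row _ _ _ id) // derive_id.
have := mulmxV uJ => /matrixP/(_ i j); rewrite mxE => E.
rewrite mxE eqxx /= -[(j == i)]/(j == i) [X in X - _](_ : _ = (1%:M : 'M[R]_m) i j); last first.
  by rewrite mxE eq_sym.
rewrite -E; apply/eqP; rewrite subr_eq0; apply/eqP; apply: eq_bigr => k _.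
rewrite (@deriveM _ _ (fun x => f x 0 k) (cst (A k j))) // derive_cst scaler0 add0r mxE.
by rewrite /GRing.scale /= mulrC.
Qed.

(** The differential of h is small near x0; apply the mean value theorem. *)
Lemma near_half : exists2 r : R, 0 < r & (forall x, `|x - x0| <= r -> U x) /\
  (forall x, `|x - x0| <= r -> jac f x \in unitmx) /\
  forall x y, `|x - x0| <= r -> `|y - x0| <= r -> `|h x - h y| <= 2^-1 * `|x - y|.
Proof.
(* Each of the m partial derivatives of h contributes at most e to its Lipschitz constant. *)
pose e : R := (2 * (m%:R + 1))^-1.
have m1 : 0 < m%:R + 1 :> R by rewrite ltr_wpDl.
have e0 : 0 < e by rewrite invr_gt0 mulr_gt0.
have Nu : nbhs x0 [set x | jac f x \in unitmx].
  pose d x := \det (jac f x).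
  have c : {for x0, continuous d}.
    apply: differentiable_continuous; apply: (Ck_diff _ Ux0).
    apply: (@Ck_det _ _ _ _ 0) => // a b; under eq_fun do rewrite mxE.
    have /smooth_onP := @smooth_derive _ _ _ _ (delta_mx 0 a) (sf b); exact.
  have d0 : 0 < `|d x0| by rewrite normr_gt0 /d -unitfE -unitmxE.
  apply: filterS (near_dist c d0) => x /= dx.
  rewrite unitmxE unitfE -/(d x); apply: contraTneq dx => ->.
  by rewrite subr0 ltxx.
have N : \forall x \near x0, (jac f x \in unitmx /\ U x) /\ forall ij : 'I_m * 'I_m, `|'D_(delta_mx 0 ij.1) (fun x => h x 0 ij.2) x| < e.
  apply: filterI; first by apply: filterI => //; exact: open_nbhs_nbhs.
  apply: (@filter_forall _ _ (fun ij : 'I_m * 'I_m => [set x | `|'D_(delta_mx 0 ij.1) (fun x => h x 0 ij.2) x| < e]) (nbhs x0)) => -[i j] /=.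
  have c : {for x0, continuous ('D_(delta_mx 0 i) (fun x => h x 0 j))}.
    apply: differentiable_continuous.
    by apply: smooth_diff Ux0; apply: smooth_derive => //; apply: sh.
  apply: filterS (near_dist c e0) => x /=.
  by rewrite dh0 sub0r normrN.
have [r /= r0 rN] := (nbhs_ballP _ _).1 N.
have inb x : `|x - x0| <= r / 2 -> ball x0 r x.
  move=> xr; rewrite -ball_normE /ball_ /= distrC; apply: le_lt_trans xr _.
  by rewrite ltr_pdivrMr // mulr_natr mulr2n ltrDl.
exists (r / 2); first by rewrite divr_gt0.
split=> [x /inb /rN[[]//]|].
split=> [x /inb /rN[[]//]|x y xr yr].
apply: norm_row_le => [|j]; first by rewrite mulr_ge0 // invr_ge0.
have E s : 0 <= s <= 1 -> `|y + s *: (x - y) - x0| <= r / 2.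
  move=> /andP[s0 s1].
  have -> : y + s *: (x - y) - x0 = s *: (x - x0) + (1 - s) *: (y - x0).
    by apply/rowP => i; rewrite !mxE; ring.
  apply: le_trans (ler_normD _ _) _; rewrite !normrZ ger0_norm // ger0_norm ?subr_ge0 //.
  have -> : r / 2 = s * (r / 2) + (1 - s) * (r / 2) by ring.
  by rewrite lerD // ler_wpM2l // subr_ge0.
have [s s01] : exists2 s, 0 < s < 1 & (fun x => h x 0 j) (y + 1 *: (x - y)) - (fun x => h x 0 j) y
   = 1 * 'D_(x - y) (fun x => h x 0 j) (y + s *: (x - y)).
  apply: mvt_line => // s sb; apply: smooth_diff (sh j) _.
  by have /rN[[]] := inb _ (E s sb).
rewrite scale1r mul1r [y + _]addrC subrK.
have s01' : 0 <= s <= 1 by case/andP: s01 => *; rewrite !ltW.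
have /rN[[_ Uz] Dz] := inb _ (E s s01').
move=> Dh; have -> : (h x - h y) 0 j = h x 0 j - h y 0 j.
  by move: (h x) (h y) => a b; rewrite !mxE.
rewrite Dh diff_delta; last exact: smooth_diff (sh j) Uz.
apply: le_trans (ler_norm_sum _ _ _) _.
apply: (@le_trans _ _ (\sum_(i < m) `|x - y| * e)).
  apply: ler_sum => i _; rewrite normrM ler_pM //; first exact: norm_coord.
  by have := Dz (i, j); apply: ltW.
rewrite sumr_const card_ord -mulrnAr mulrC ler_wpM2r // -mulr_natr /e invfM -mulrA.
rewrite ler_piMr ?invr_ge0 // mulrC ler_pdivrMr // mul1r lerDl //.
Qed.

(** Injectivity, with a Lipschitz inverse, comes from
    (f x - f y) A = (x - y) - (h x - h y) and the contraction property of h.  For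
    surjectivity, |T x - x| with T x = h x + y A has a minimum on the closed ball,
    and this minimum is 0 because T maps the ball to itself and contracts. *)
Theorem inverse_function_aux : exists (W V : set 'rV[R]_m) (k : 'rV[R]_m -> 'rV[R]_m),
  [/\ [/\ open W, W x0, W `<=` U & open V],
      forall x, W x -> V (f x) /\ k (f x) = x,
      forall y, V y -> W (k y) /\ f (k y) = y
    & exists2 c : R, 0 < c & 
      (forall x y, W x -> W y -> `|x - y| <= c * `|f x - f y|) /\
      (forall x, W x -> jac f x \in unitmx)].
Proof.
have [r r0 [rU [ru Hh]]] := near_half.
have r20 : 0 < r / 2 by rewrite divr_gt0.
pose V := [set y : 'rV[R]_m | `|(y - f x0) *m A| < r / 2].
pose W := [set x : 'rV[R]_m | `|x - x0| < r /\ V (f x)].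
have cA : continuous (fun y : 'rV[R]_m => (y - f x0) *m A).
  move=> x; apply: differentiable_continuous.
  exact: smoothr_diff (@smoothr_affine setT (f x0) A openT) (I : setT x).
have oV : open V.
  rewrite /V -[X in open X]/((fun y : 'rV[R]_m => (y - f x0) *m A) @^-1` [set z | `|z| < r / 2]).
  apply: open_comp => [y _|]; first exact: cA.
  have -> : [set z : 'rV[R]_m | `|z| < r / 2] = ball 0 (r / 2).
    by rewrite -ball_normE; apply/seteqP; split => z; rewrite /ball_ /= sub0r normrN.
  exact: ball_open.
have oW : open W.
  rewrite openE => x [xr Vx]; apply: filterI.
    have -> : (fun x1 : 'rV[R]_m => is_true (`|x1 - x0| < r)) = ball x0 r.
      by rewrite -ball_normE; apply/seteqP; split => z; rewrite /ball_ /= distrC.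
    apply: open_nbhs_nbhs; split; first exact: ball_open.
    by rewrite -ball_normE /ball_ /= distrC.
  have cf : {for x, continuous f}.
    by apply: differentiable_continuous; apply: smoothr_diff sf _; apply: rU; apply: ltW.
  by apply: cf; apply: open_nbhs_nbhs.
have fA x y : (f x - f y) *m A = (x - y) - (h x - h y).
  by rewrite /h mulmxBl opprB; apply/rowP => i; rewrite !mxE; lra.
have low x y : `|x - x0| <= r -> `|y - x0| <= r -> `|x - y| <= 2 * `|(f x - f y) *m A|.
  move=> xr yr; rewrite fA.
  have H1 := Hh _ _ xr yr.
  have := ler_normD ((x - y) - (h x - h y)) (h x - h y); rewrite subrK => H2.
  by lra.
have W_r x : W x -> `|x - x0| <= r by move=> [xr _]; apply: ltW.
have fixp y : V y -> exists x, W x /\ f x = y.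
  move=> Vy.
  pose T x := h x + y *m A.
  have TB x : `|x - x0| <= r -> `|T x - x0| < r.
    move=> xr.
    have -> : T x - x0 = (h x - h x0) + (y - f x0) *m A.
      by rewrite /T /h mulmxBl; apply/rowP => i; rewrite !mxE; lra.
    apply: le_lt_trans (ler_normD _ _) _.
    have x0r : `|x0 - x0| <= r by rewrite subrr normr0 ltW.
    have := Hh _ _ xr x0r; move: (Vy : `|(y - f x0) *m A| < r / 2) => {}Vy H.
    lra.
  pose B := [set x : 'rV[R]_m | `|x - x0| <= r].
  have B0 : B !=set0 by exists x0; rewrite /B /= subrr normr0 ltW.
  have cB : compact B.
    apply: bounded_closed_compact.
      exists (`|x0| + r); split; first by rewrite num_real.
      move=> M HM x; rewrite /B /= => xr; apply: ltW; apply: le_lt_trans HM.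
      by have := ler_normD (x - x0) x0; rewrite subrK => H; lra.
    have -> : B = closed_ball x0 r.
      rewrite closed_ballE //; apply/seteqP; split => z;
      by rewrite /B /closed_ball_ /= distrC.
    exact: closed_ball_closed.
  have cT : {within B, continuous (fun x => `|T x - x|)}.
    apply: continuous_in_subspaceT => x; rewrite inE => Bx.
    have dh : differentiable h x by apply: smoothr_diff sh _; apply: rU.
    have dT : differentiable (fun x => T x - x) x.
      by apply: differentiableB => //; apply: differentiableD.
    apply: (@continuous_comp _ _ _ (fun x => T x - x) (fun z => `|z|)); last exact: norm_continuous.
    exact: differentiable_continuous.
  have [x Bx minx] := EVT_min_rV B0 cB cT.
  rewrite inE in Bx.
  have fx : T x = x.
    apply/eqP; rewrite -subr_eq0 -normr_eq0 eq_le normr_ge0 andbT leNgt; apply/negP => pos.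
    have BT : `|T x - x0| <= r by apply: ltW; apply: TB.
    have := minx (T x); rewrite inE => /(_ BT).
    have -> : T (T x) - T x = h (T x) - h x by rewrite /T; apply/rowP => i; rewrite !mxE; lra.
    have := Hh _ _ BT Bx; move: pos.
    by set a := `|_|; set b := `|_ - h x|; lra.
  have fxy : f x = y.
    have E : (f x - y) *m A = 0.
      have := fx; rewrite /T /h mulmxBl => /rowP E.
      by apply/rowP => i; have := E i; rewrite !mxE; lra.
    by apply/eqP; rewrite -subr_eq0 -(mulmxKV uJ (f x - y)) -/A E mul0mx.
  exists x; split => //; split; last by rewrite fxy.
  by rewrite -fx; apply: TB.
pose k y := xget x0 [set x | W x /\ f x = y].
have kP y : V y -> W (k y) /\ f (k y) = y.
  by move=> /fixp[x Hx]; rewrite /k; case: xgetP => [z -> //|/(_ x)].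
exists W, V, k; split => //.
- split => // [|x [xr _]]; last by apply: rU; apply: ltW.
  by split; rewrite ?subrr ?normr0 // /V /= subrr mul0mx normr0.
- move=> x Wx; have Vx : V (f x) by case: Wx.
  split => //; have [Wk fk] := kP _ Vx.
  have := low _ _ (W_r _ Wk) (W_r _ Wx).
  rewrite fk subrr mul0mx normr0 mulr0 normr_le0 subr_eq0.
  by move/eqP.
have [c c0 Hc] := mulmxr_lipschitz A.
exists (2 * c); first by rewrite mulr_gt0.
split=> [x y /W_r xr /W_r yr|x /W_r]; last exact: ru.
by apply: le_trans (low _ _ xr yr) _; rewrite -mulrA ler_wpM2l.
Qed.

(** By the Lipschitz bound the inverse k is differentiable with the inverse
    differential.  The formula for its derivatives involves only k and derivatives of
    f, so that it raises the class of k by one. *)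
Theorem inverse_function : exists (W V : set 'rV[R]_m) (k : 'rV[R]_m -> 'rV[R]_m),
  [/\ [/\ open W, W x0, W `<=` U & open V],
      forall x, W x -> V (f x) /\ k (f x) = x,
      forall y, V y -> W (k y) /\ f (k y) = y
    & smoothr_on V k].
Proof.
have [W [V [k [[oW Wx0 WU oV] Wf Vk [c c0 [low ru]]]]]] := inverse_function_aux.
exists W, V, k; split => //.
have kd y : V y -> differentiable k y /\ forall v, 'D_v k y = v *m invmx (jac f (k y)).
  move=> Vy; have [Wx fx] := Vk _ Vy; set x := k y in Wx fx *.
  set J := jac f x; set L := mulmxr (invmx J) : {linear 'rV[R]_m -> 'rV[R]_m}.
  have [cJ cJ0 HJ] := mulmxr_lipschitz (invmx J).
  have cL : continuous L.
    move=> z; apply: differentiable_continuous.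
    have := smoothr_diff (@smoothr_affine setT 0 (invmx J) openT) (I : setT z).
    by under eq_fun do rewrite subr0.
  have df : differentiable f x by apply: smoothr_diff sf _; apply: WU.
  have H (e : R) : 0 < e -> nbhs (0 : 'rV[R]_m) [set h | `|k (h + y) - (k y + L h)| <= e * `|h|].
    move=> e0.
    have e'0 : 0 < e / (cJ * c) by rewrite divr_gt0 // mulr_gt0.
    have := (diff_locallyP _ _).1 df => -[_ /eqaddoP /(_ _ e'0) /nbhs_ballP[rho /= rho0 Hr]].
    have N1 : nbhs (0 : 'rV[R]_m) [set z | `|z| < rho / c].
      have : nbhs (0 : 'rV[R]_m) (ball (0 : 'rV[R]_m) (rho / c)) by apply: nbhsx_ballx; rewrite divr_gt0.
      by apply: filterS => z; rewrite -ball_normE /ball_ /= sub0r normrN.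
    have N2 : nbhs (0 : 'rV[R]_m) [set z | V (z + y)].
      by apply: nbhs_shift0; apply: open_nbhs_nbhs.
    apply: filterS2 N1 N2 => z hr Vh; rewrite /=.
    have [Wx' fx'] := Vk _ Vh; set x' := k (z + y) in Wx' fx' *.
    have lowx := low _ _ Wx' Wx; rewrite fx fx' addrK in lowx.
    have := Hr (x' - x); rewrite -ball_normE /ball_ /= sub0r normrN => /(_ _).
    have xr : `|x' - x| < rho.
      by apply: le_lt_trans lowx _; rewrite mulrC -ltr_pdivlMr.
    move=> /(_ xr); rewrite !fctE /= subrK fx fx' -deriveE // derive_jac // -/J => Hd.
    have -> : x' - (x + z *m invmx J) = - ((z + y - (y + (x' - x) *m J)) *m invmx J).
      have -> : z + y - (y + (x' - x) *m J) = z - (x' - x) *m J by rewrite opprD addrA addrK.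
      rewrite mulmxBl mulmxK ?ru // opprB.
      by apply/rowP => i; rewrite !mxE; lra.
    rewrite normrN; apply: le_trans (HJ _) _.
    apply: (@le_trans _ _ (cJ * (e / (cJ * c) * (c * `|z|)))).
      apply: ler_wpM2l; first exact: ltW.
      by apply: le_trans Hd _; apply: ler_wpM2l => //; apply: ltW.
    rewrite le_eqVlt; apply/orP; left; apply/eqP.
    by field; rewrite !gt_eqF.
  have [dk E] := diff_eps cL H.
  by split=> // v; rewrite deriveE // E.
move=> j; apply/smooth_onP => n; elim: n j => [|n IH] j.
  split=> // y Vy; have [dk _] := kd _ Vy.
  exact: (differentiable_comp dk (differentiable_coord _ _ _)).
apply: (@Ck_step _ _ _ _ _ (fun v y : 'rV[R]_m => \sum_(i < m) v 0 i * invmx (jac f (k y)) i j)) => //.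
- move=> y Vy; have [dk _] := kd _ Vy.
  exact: (differentiable_comp dk (differentiable_coord _ _ _)).
- by move=> y v Vy; have [dk Dk] := kd _ Vy; rewrite derive_row // Dk mxE.
- move=> v; apply: Ck_big_sum => // i; apply: (@CkM _ _ _ _ (cst _)) => //; first exact: Ck_cst.
  apply: Ck_invmx => // [a b|y Vy]; last by apply: ru; case: (Vk _ Vy).
  under eq_fun do rewrite mxE.
  apply: (@Ck_comp _ _ n _ _ U k ('D_(delta_mx 0 a) (fun z => f z 0 b))) => //.
  + by move=> y Vy; apply: WU; case: (Vk _ Vy).
  + by have /smooth_onP := @smooth_derive _ _ _ _ (delta_mx 0 a) (sf b); exact.
Qed.

End Near.
End InverseFunction.

(** * The holomorphic volume form in homogeneous coordinates *)

(** The sign is left unspecified here and below: the form is only used through the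
    vanishing of the imaginary part of a multiple of it. *)
Lemma det_mxsub_inj (K : comNzRingType) p q (e e' : 'I_p -> 'I_q) :
  p = q -> injective e -> injective e' ->
  exists s : nat, forall T : 'M[K]_q, \det (mxsub e e' T) = (-1) ^+ s * \det T.
Proof.
move=> E; case: q / E e e' => e e' ie ie'.
exists ((perm ie : bool) + (perm ie' : bool))%N => T.
have -> : mxsub e e' T = row_perm (perm ie) (col_perm (perm ie') T).
  by apply/matrixP => a b; rewrite !mxE !permE.
by rewrite row_permE col_permE !det_mulmx !det_perm odd_permV exprD [\det T * _]mulrC mulrA.
Qed.

Lemma mulmx_cast (K : nzRingType) a b N p (E : N = p) (A : 'M[K]_(a, p)) (B : 'M[K]_(p, b)) :
  A *m B = colsub (cast_ord E) A *m rowsub (cast_ord E) B.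
Proof.
case: p / E A B => A B; congr (_ *m _); apply/matrixP => i j; rewrite !mxE; congr (_ _ _);
by apply: val_inj.
Qed.

Lemma split_l m n (a : 'I_m) : fintype.split (lshift n a) = inl a.
Proof. exact: (unsplitK (inl a)). Qed.
Lemma split_r m n (a : 'I_n) : fintype.split (rshift m a) = inr a.
Proof. exact: (unsplitK (inr a)). Qed.

Section AffineChart.
Variables (K : fieldType) (n : nat) (i : 'I_n.+1) (z : 'rV[K]_n.+1).
Hypothesis zi : z 0 i != 0.

Definition chart_mx : 'M[K]_(n.+1, n) :=
  \matrix_(r, a) (((r == lift i a)%:R * z 0 i - z 0 (lift i a) * (r == i)%:R) / z 0 i ^+ 2).

(** The differential of the affine chart z_i != 0, completed to a square matrix by
    the functional dz_i / z_i. *)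
Definition chart_full : 'M[K]_(n.+1, 1 + n) :=
  row_mx (\col_r ((r == i)%:R / z 0 i)) chart_mx.

Definition chart_ord (c : 'I_(1 + n)) : 'I_n.+1 :=
  match fintype.split c with inl _ => i | inr a => lift i a end.

Lemma chart_ord_inj : injective chart_ord.
Proof.
move=> c c'; rewrite /chart_ord.
case: (split_ordP c) => a ->; case: (split_ordP c') => a' ->.
- by rewrite !ord1.
- by move/eqP; rewrite (negPf (neq_lift _ _)).
- by move/eqP; rewrite eq_sym (negPf (neq_lift _ _)).
- by move/lift_inj ->.
Qed.

Lemma sum_delta_l (m : nat) (F : 'I_m -> K) k : \sum_r F r * (r == k)%:R = F k.
Proof.
rewrite (bigD1 k) //= eqxx mulr1 big1 ?addr0 // => r /negPf ->.
by rewrite mulr0.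
Qed.

(** Affine coordinates are homogeneous of degree 0, so that their differentials kill
    the radial vector z. *)
Lemma mul_chart_full : z *m chart_full = row_mx 1%:M 0.
Proof.
rewrite /chart_full mul_mx_row; congr row_mx.
  apply/matrixP => a b; rewrite !ord1 !mxE.
  under eq_bigr do rewrite mxE mulrA mulrAC.
  by rewrite sum_delta_l divff.
apply/matrixP => a b; rewrite !ord1 !mxE.
under eq_bigr do rewrite mxE mulrA mulrBr.
rewrite -mulr_suml sumrB.
under eq_bigr do rewrite mulrA mulrAC.
under [X in _ - X]eq_bigr do rewrite mulrA.
by rewrite !sum_delta_l [X in X - _]mulrC subrr mul0r.
Qed.

Lemma det_chart_full :
  exists s : nat, \det (chart_full : 'M[K]_n.+1) = (-1) ^+ s * z 0 i ^- n.+1.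
Proof.
have [s Hs] := @det_mxsub_inj K _ _ id chart_ord (erefl n.+1) (@inj_id _) chart_ord_inj.
exists s.
pose U : 'M[K]_(1 + n) := block_mx 1%:M (\row_a (- (z 0 (lift i a) / z 0 i))) 0 1%:M.
have E : chart_full = (z 0 i)^-1 *: (mxsub id chart_ord 1%:M *m U) :> 'M[K]_(n.+1, 1 + n).
  rewrite -[mxsub _ _ _]hsubmxK mul_row_block !mulmx0 !mulmx1 addr0 scale_row_mx.
  congr row_mx; apply/matrixP => r a; rewrite !mxE.
    by rewrite /chart_ord split_l mulrC.
  rewrite big_ord1 !mxE /chart_ord split_l split_r.
  by field.
have -> : \det (chart_full : 'M[K]_n.+1) = \det ((z 0 i)^-1 *: (mxsub id chart_ord 1%:M *m U) : 'M[K]_n.+1).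
  by rewrite E.
rewrite detZ (det_mulmx (mxsub id chart_ord 1%:M : 'M[K]_n.+1) U) Hs det1 mulr1.
rewrite /U (@det_ublock _ 1 n) !det1 !mulr1 exprVn mulrC.
by [].
Qed.

End AffineChart.

Section Homogeneous.
Context {R : realType} {n : nat}.
Local Notation C := R[i].
Local Notation N := ((1 + 1) + (n + n))%N.

Lemma size_eq : (n.+1 + n.+1 = (1 + 1) + (n + n))%N. Proof. lia. Qed.

Lemma daffineE (i : 'I_n.+1) (z dz : 'rV[C]_n.+1) :
  daffine i z dz = dz *m chart_mx i z.
Proof.
apply/rowP => a; rewrite !mxE; apply/esym.
under eq_bigr do rewrite mxE mulrA mulrBr.
rewrite -mulr_suml sumrB.
under eq_bigr do rewrite mulrA mulrAC.
under [X in _ - X]eq_bigr do rewrite mulrA.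
by rewrite !sum_delta_l [z 0 (lift i a) * _]mulrC.
Qed.

(** Adding the two radial directions to 2n tangent vectors gives a square matrix,
    whose determinant does not refer to affine charts. *)
Definition rows_mx (z w : 'rV[C]_n.+1) (X : 'I_(n + n) -> 'rV[C]_(n.+1 + n.+1)) :
   'M[C]_(N, n.+1 + n.+1) :=
  col_mx (col_mx (row_mx z 0) (row_mx 0 w)) (\matrix_k X k).

Definition rows_sq z w X : 'M[C]_N := colsub (cast_ord (esym size_eq)) (rows_mx z w X).

(** The reordering that brings the two radial columns to the front. *)
Definition chart_cols (c : 'I_N) : 'I_((1 + n) + (1 + n)) :=
  match fintype.split c with
  | inl d => match fintype.split d with
             | inl t => lshift _ (lshift n t) | inr t => rshift _ (lshift n t) end
  | inr d => match fintype.split d with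
             | inl a => lshift _ (rshift 1 a) | inr a => rshift _ (rshift 1 a) end
  end.

Lemma chart_cols_inj : injective chart_cols.
Proof.
move=> c c' /(congr1 val); rewrite /chart_cols => H; apply: val_inj; move: H.
case: (split_ordP c) => d ->; case: (split_ordP c') => d' ->;
case: (split_ordP d) => t ->; case: (split_ordP d') => t' -> /=;
have := ltn_ord t; have := ltn_ord t'; lia.
Qed.

Lemma cc_ll t : chart_cols (lshift _ (lshift 1 t)) = lshift _ (lshift n t).
Proof. by rewrite /chart_cols !split_l. Qed.
Lemma cc_lr t : chart_cols (lshift _ (rshift 1 t)) = rshift _ (lshift n t).
Proof. by rewrite /chart_cols split_l split_r. Qed.
Lemma cc_rl t : chart_cols (rshift _ (lshift n t)) = lshift _ (rshift 1 t).
Proof. by rewrite /chart_cols split_r split_l. Qed.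
Lemma cc_rr t : chart_cols (rshift _ (rshift n t)) = rshift _ (rshift 1 t).
Proof. by rewrite /chart_cols !split_r. Qed.

(** Multiplication by the matrices of the two charts makes the radial rows unit
    vectors and leaves, as complementary minor, the determinant that defines Theta.
    The determinants z_i^-(n+1) and w_j^-(n+1) of the charts turn the affine factor
    of Theta into a power of z.w. *)
Lemma Theta_rows (i j : 'I_n.+1) (p : 'rV[C]_(n.+1 + n.+1)) X :
  let z := lsubmx p in let w := rsubmx p in
  z 0 i != 0 -> w 0 j != 0 ->
  exists s : nat, Theta i j p X = (-1) ^+ s * bilin z w ^- n.+1 * \det (rows_sq z w X).
Proof.
move=> z w zi wj.
have [s1 H1] := det_chart_full zi; have [s2 H2] := det_chart_full wj.
pose B : 'M[C]_((1 + n) + (1 + n)) := block_mx (chart_full i z) 0 0 (chart_full j w).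
have [s3 H3] := @det_mxsub_inj C _ _ (cast_ord (esym size_eq)) chart_cols (esym size_eq) (@cast_ord_inj _ _ _) chart_cols_inj.
exists (i + j + s1 + s2 + s3)%N.
pose Q := colsub chart_cols B.
pose D := \matrix_(k < n + n) row_mx (daffine i z (lsubmx (X k))) (daffine j w (rsubmx (X k))).
have zB : row_mx z 0 *m B = row_mx (row_mx 1%:M 0) 0.
  by rewrite mul_row_block !mul0mx !mulmx0 !addr0 mul_chart_full.
have wB : row_mx 0 w *m B = row_mx 0 (row_mx 1%:M 0).
  by rewrite mul_row_block !mul0mx !mulmx0 !add0r mul_chart_full.
have RB : rows_mx z w X *m B = col_mx (col_mx (row_mx (row_mx 1%:M 0) 0) (row_mx 0 (row_mx 1%:M 0)))
     (\matrix_k (X k *m B)).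
  rewrite /rows_mx !mul_col_mx zB wB; congr col_mx.
  by apply/row_matrixP => k; rewrite row_mul !rowK.
have RQ : rows_mx z w X *m Q = colsub chart_cols (rows_mx z w X *m B).
  exact: mulmx_colsub.
have E : rows_mx z w X *m Q =
   block_mx 1%:M 0 (dlsubmx (rows_mx z w X *m Q)) D.
  rewrite -[LHS]submxK RQ; congr block_mx; apply/matrixP => a b;
    rewrite 3!mxE RB [RHS]mxE.
  - rewrite col_mxEu; case: (split_ordP a) => a1 ->; case: (split_ordP b) => b1 ->;
    by rewrite ?col_mxEu ?col_mxEd ?cc_ll ?cc_lr ?row_mxEl ?row_mxEr ?row_mxEl !mxE !ord1.
  - rewrite col_mxEu; case: (split_ordP a) => a1 ->; case: (split_ordP b) => b1 ->;
    by rewrite ?col_mxEu ?col_mxEd ?cc_rl ?cc_rr ?row_mxEl ?row_mxEr ?row_mxEr !mxE.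
  - rewrite col_mxEd mxE; case: (split_ordP b) => b1 ->;
    rewrite ?cc_rl ?cc_rr -[X a]hsubmxK mul_row_block !mulmx0 addr0 add0r /chart_full !mul_mx_row.
      by rewrite !row_mxEl !row_mxEr daffineE row_mxKl.
    by rewrite !row_mxEr daffineE row_mxKr.
have : \det (rows_mx z w X *m Q) = \det D by rewrite E det_lblock det1 mul1r.
rewrite (mulmx_cast (esym size_eq)) det_mulmx -/(rows_sq z w X).
have -> : rowsub (cast_ord (esym size_eq)) Q = mxsub (cast_ord (esym size_eq)) chart_cols B.
  by apply/matrixP => a b; rewrite !mxE.
rewrite H3 /B (@det_lblock _ (1 + n) (1 + n)) H1 H2 => HD.
rewrite /Theta -/z -/w -/D -HD.
have -> : \sum_k z 0 k / z 0 i * (w 0 k / w 0 j) = bilin z w / (z 0 i * w 0 j).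
  rewrite /bilin mulr_suml; apply: eq_bigr => k _; rewrite invfM; ring.
rewrite !exprD; move: (\det (rows_sq z w X)) => d.
rewrite expr_div_n invf_div exprMn.
set a := z 0 i ^+ n.+1; set b := w 0 j ^+ n.+1; set c := bilin z w ^+ n.+1.
have a0 : a != 0 by rewrite expf_neq0. have b0 : b != 0 by rewrite expf_neq0.
set e1 := (-1) ^+ s1; set e2 := (-1) ^+ s2; set e3 := (-1) ^+ s3; set ei := (-1) ^+ i; set ej := (-1) ^+ j.
have -> : ei * ej * (a * b / c) * (d * (e3 * ((e1 / a) * (e2 / b)))) =
  ei * ej * e1 * e2 * e3 / c * d * (a / a) * (b / b) by ring.
by rewrite !divff // !mulr1.
Qed.

End Homogeneous.

(** * The Hermitian product *)
Section Hermitian.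
Context {R : realType} {m : nat}.
Local Notation C := R[i].
Local Notation Re := complex.Re.
Local Notation Im := complex.Im.
Implicit Types (x y : 'rV[C]_m) (a : C).

Lemma hdotDl x x' y : hdot (x + x') y = hdot x y + hdot x' y.
Proof. by rewrite /hdot -big_split; apply: eq_bigr => j _; rewrite mxE mulrDl. Qed.
Lemma hdotDr x y y' : hdot x (y + y') = hdot x y + hdot x y'.
Proof. by rewrite /hdot -big_split; apply: eq_bigr => j _; rewrite mxE conjcD mulrDr. Qed.
Lemma hdotZl a x y : hdot (a *: x) y = a * hdot x y.
Proof. by rewrite /hdot mulr_sumr; apply: eq_bigr => j _; rewrite mxE mulrA. Qed.
Lemma hdotZr a x y : hdot x (a *: y) = a^*%C * hdot x y.
Proof. by rewrite /hdot mulr_sumr; apply: eq_bigr => j _; rewrite mxE conjcM mulrCA. Qed.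
Lemma hdotNl x y : hdot (- x) y = - hdot x y.
Proof. by rewrite -scaleN1r hdotZl mulN1r. Qed.
Lemma hdotNr x y : hdot x (- y) = - hdot x y.
Proof. by rewrite -scaleN1r hdotZr conjcN rmorph1 mulN1r. Qed.
Lemma hdotBl x x' y : hdot (x - x') y = hdot x y - hdot x' y.
Proof. by rewrite hdotDl hdotNl. Qed.
Lemma hdotBr x y y' : hdot x (y - y') = hdot x y - hdot x y'.
Proof. by rewrite hdotDr hdotNr. Qed.
Lemma hdot0l y : hdot 0 y = 0.
Proof. by rewrite -(scale0r 0) hdotZl mul0r. Qed.
Lemma hdot0r x : hdot x 0 = 0.
Proof. by rewrite -(scale0r 0) hdotZr conjc0 mul0r. Qed.
Lemma hdotC x y : hdot y x = (hdot x y)^*%C.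
Proof.
rewrite /hdot (big_morph _ (@conjcD R) (@conjc0 R)); apply: eq_bigr => j _.
by rewrite conjcM conjcK mulrC.
Qed.

Definition hdotE := (hdotDl, hdotDr, hdotNl, hdotNr, hdotZl, hdotZr, hdot0l, hdot0r).

Lemma Re_hdotC x y : Re (hdot y x) = Re (hdot x y).
Proof. by rewrite hdotC cReJ. Qed.
Lemma Im_hdotC x y : Im (hdot y x) = - Im (hdot x y).
Proof. by rewrite hdotC cImJ. Qed.

Lemma Im_hdotxx x : Im (hdot x x) = 0.
Proof. by have := Im_hdotC x x; lra. Qed.

Lemma Re_hdotxx x : Re (hdot x x) = \sum_j (Re (x 0 j) ^+ 2 + Im (x 0 j) ^+ 2).
Proof. by rewrite /hdot Re_sum; apply: eq_bigr => j _; rewrite !ReImE; ring. Qed.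

Lemma hdotxx_ge0 x : 0 <= Re (hdot x x).
Proof. by rewrite Re_hdotxx; apply: sumr_ge0 => j _; rewrite addr_ge0 ?sqr_ge0. Qed.

Lemma hdotxx_eq0 x : (Re (hdot x x) == 0) = (x == 0).
Proof.
apply/eqP/eqP => [|->]; last by rewrite hdot0l.
rewrite Re_hdotxx => /eqP; rewrite psumr_eq0 => [/allP H|j _]; last by rewrite addr_ge0 ?sqr_ge0.
apply/rowP => j; rewrite mxE; apply/eqP; rewrite -sqr_parts_eq0.
by have /H := mem_index_enum j.
Qed.

Lemma hdotxx_gt0 x : x != 0 -> 0 < Re (hdot x x).
Proof. by move=> x0; rewrite lt_def hdotxx_eq0 x0 hdotxx_ge0. Qed.

Lemma hdotxx_real x : hdot x x = (Re (hdot x x))%:C.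
Proof. by apply: complex_ext; rewrite ?ReR // ImR Im_hdotxx. Qed.

Lemma hdotxx_neq0 x : x != 0 -> hdot x x != 0.
Proof. by move=> x0; rewrite hdotxx_real fmorph_eq0 hdotxx_eq0. Qed.

Lemma hnorm_sqr x : hnorm x ^+ 2 = Re (hdot x x).
Proof. by rewrite /hnorm sqr_sqrtr // hdotxx_ge0. Qed.

Lemma hnorm_gt0 x : x != 0 -> 0 < hnorm x.
Proof. by move=> x0; rewrite /hnorm sqrtr_gt0 hdotxx_gt0. Qed.

Lemma hnorm_ge0 x : 0 <= hnorm x.
Proof. exact: sqrtr_ge0. Qed.

End Hermitian.

Section Realification.
Context {R : realType} {n : nat}.
Local Notation C := R[i].
Local Notation Re := complex.Re.
Local Notation Im := complex.Im.

Definition rv (x : 'rV[C]_n) : 'rV[R]_(n + n) := row_mx (\row_j Re (x 0 j)) (\row_j Im (x 0 j)).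
Definition cv (v : 'rV[R]_(n + n)) : 'rV[C]_n := \row_j (lsubmx v 0 j +i* rsubmx v 0 j).

Lemma cvK : cancel cv rv.
Proof.
move=> v; rewrite /rv -[RHS]hsubmxK; congr row_mx; apply/rowP => j; by rewrite !mxE /=.
Qed.

Lemma rv_dot (x y : 'rV[C]_n) : (rv x *m (rv y)^T) 0 0 = Re (hdot x y).
Proof.
rewrite /rv tr_row_mx mul_row_col !mxE -big_split /hdot Re_sum.
by apply: eq_bigr => j _; rewrite !mxE cReM cReJ cImJ mulrN opprK.
Qed.

Lemma gram_unit p q (B : 'M[R]_(p, q)) : row_free B -> B *m B^T \in unitmx.
Proof.
move=> fB; rewrite -row_free_unit; apply: inj_row_free => v.
rewrite mulmxA => vB.
have H : (v *m B) *m (v *m B)^T = 0 by rewrite trmx_mul mulmxA vB mul0mx.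
have vB0 : v *m B = 0.
  apply/rowP => j; move: (v *m B) H => w /(congr1 (fun M : 'M[R]_1 => M 0 0)); rewrite !mxE => /eqP.
  rewrite psumr_eq0 => [/allP /(_ j (mem_index_enum _))|k _]; rewrite mxE -expr2 ?sqr_ge0 //.
  by rewrite sqrf_eq0 => /eqP.
by apply/eqP; rewrite -(mulmx_free_eq0 _ fB) vB0.
Qed.
End Realification.

Lemma row_free_cast (F : fieldType) a b p (E : a = b) (B : 'M[F]_(b, p)) :
  row_free B -> row_free (rowsub (cast_ord E) B).
Proof.
case: b / E B => B fB; suff -> : rowsub (cast_ord (erefl a)) B = B by [].
by apply/matrixP => i j; rewrite mxE; congr (B _ _); apply: val_inj.
Qed.

(** Normal vectors form the real orthogonal complement of zeta, i zeta, e_0 and e_1,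
    which are independent; it has dimension 2 (m + 2) - 4. *)
Lemma normal_basis (R : realType) (m : nat) (zeta : 'rV[R[i]]_m.+2) (e : 'I_2 -> 'rV[R[i]]_m.+2) :
  zeta != 0 -> (forall j, hdot (e j) zeta = 0) ->
  \det (\matrix_(j, l) complex.Re (hdot (e j) (e l))) != 0 ->
  exists eta : 'I_(m + m) -> 'rV[R[i]]_m.+2,
  [/\ forall k, hdot (eta k) zeta = 0, forall k j, complex.Re (hdot (eta k) (e j)) = 0
   & \det (\matrix_(k, l) complex.Re (hdot (eta k) (eta l))) != 0].
Proof.
move=> z0 ez g0.
have dotE p q (a : 'I_p -> 'rV[R[i]]_m.+2) (b : 'I_q -> 'rV[R[i]]_m.+2) :
   (\matrix_j rv (a j)) *m (\matrix_j rv (b j))^T = \matrix_(j, l) complex.Re (hdot (a j) (b l)).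
  apply/matrixP => j l; rewrite [RHS]mxE -rv_dot [LHS]mxE [RHS]mxE.
  by apply: eq_bigr => k _; rewrite !mxE.
have Z0 := hdotxx_gt0 z0; have Zi := Im_hdotxx zeta; set N := complex.Re _ in Z0.
pose zv (j : 'I_2) := if j == 0 then zeta else 'i%C *: zeta.
pose a (k : 'I_(2 + 2)) := match fintype.split k with inl j => zv j | inr j => e j end.
pose A := \matrix_k rv (a k).
have AA : A *m A^T \in unitmx.
  rewrite dotE.
  have -> : \matrix_(j, l) complex.Re (hdot (a j) (a l)) =
    block_mx N%:M 0 0 (\matrix_(j, l) complex.Re (hdot (e j) (e l))).
    rewrite -[LHS]submxK; congr block_mx; apply/matrixP => j l; rewrite !mxE /a ?split_l ?split_r /zv.
    - case: j => -[|[|//]] hj; case: l => -[|[|//]] hl /=; rewrite ?hdotE ?ReImE ?Zi /N /=; ring.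
    - by case: ifP => _; rewrite hdotC ?hdotE ez ?mulr0 conjc0.
    - by case: ifP => _; rewrite ?hdotE ez ?mulr0.
    - by [].
  by rewrite unitmxE det_lblock det_scalar unitfE mulf_neq0 // expf_neq0 // gt_eqF.
have rA : \rank A = 4%N.
  have : row_free A by apply/row_freeP; exists (A^T *m invmx (A *m A^T)); rewrite mulmxA mulmxV.
  by move/eqP.
pose K := kermx A^T.
have rK : \rank K = (m + m)%N by rewrite mxrank_ker mxrank_tr rA; lia.
pose B := row_base K.
pose eta (k : 'I_(m + m)) := cv (row (cast_ord (esym rK) k) B).
have etaE : \matrix_k rv (eta k) = rowsub (cast_ord (esym rK)) B.
  by apply/row_matrixP => k; rewrite rowK cvK row_rowsub.
have BA k j : complex.Re (hdot (eta k) (a j)) = 0.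
  have BK : B *m A^T = 0.
    apply/eqP; rewrite -sub_kermx -/K; by rewrite eq_row_base.
  rewrite -rv_dot cvK.
  have /matrixP/(_ (cast_ord (esym rK) k) j) := BK; rewrite mxE [RHS]mxE => H.
  by rewrite mxE -[RHS]H; apply: eq_bigr => i _; rewrite !mxE.
exists eta; split.
- move=> k; apply: complex_ext.
    have := BA k (lshift 2 0); rewrite /a split_l /zv /= => ->; by [].
  have := BA k (lshift 2 1); rewrite /a split_l /zv /= hdotE !ReImE => H.
  by move: H; rewrite mul0r sub0r mulN1r opprK.
- by move=> k j; have := BA k (rshift 2 j); rewrite /a split_r.
- rewrite -dotE etaE.
  have : row_free (rowsub (cast_ord (esym rK)) B).
    apply: row_free_cast; exact: row_base_free.
  by move/gram_unit; rewrite unitmxE unitfE.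
Qed.

(** * The phase of the volume form on the normal bundle *)
Section RowsDet.
Context {R : realType} {n : nat}.
Local Notation C := R[i].
Implicit Types (x y A B : 'rV[C]_n.+1).

Definition cvec x : 'rV[C]_n.+1 := map_mx conjc x.

Lemma mul_cvec_tr A y : A *m (cvec y)^T = (hdot A y)%:M.
Proof.
apply/matrixP => i j; rewrite !ord1 !mxE eqxx mulr1n.
by apply: eq_bigr => k _; rewrite !mxE.
Qed.

Lemma cvec_mul_tr B y : cvec B *m y^T = (hdot y B)%:M.
Proof.
apply/matrixP => i j; rewrite !ord1 !mxE eqxx mulr1n.
by apply: eq_bigr => k _; rewrite !mxE mulrC.
Qed.

(** Multiplying a row (A, conj B) by these columns gives its Hermitian products with
    zeta and with the u_l.  The determinant of this matrix does not involve the
    normal vector xi, so that it cancels when two normal vectors are compared. *)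
Definition dual_cols zeta (u : 'I_(n + n) -> 'rV[C]_n.+1) : 'M[C]_(n.+1 + n.+1, (1 + 1) + (n + n)) :=
  row_mx (row_mx (col_mx (cvec zeta)^T 0) (col_mx 0 zeta^T))
         (col_mx (\matrix_l cvec (u l))^T (\matrix_l u l)^T).

Lemma mul_dual_cols zeta u A B :
  row_mx A (cvec B) *m dual_cols zeta u =
  row_mx (row_mx (hdot A zeta)%:M (hdot zeta B)%:M) (\row_l (hdot A (u l) + hdot (u l) B)).
Proof.
rewrite /dual_cols !mul_mx_row !mul_row_col !mulmx0 addr0 add0r mul_cvec_tr cvec_mul_tr.
congr row_mx; apply/rowP => l; rewrite !mxE; congr (_ + _).
  by apply: eq_bigr => k _; rewrite !mxE.
by apply: eq_bigr => k _; rewrite !mxE mulrC.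
Qed.

Definition dual_det zeta u : C :=
  \det (rowsub (cast_ord (esym (@size_eq n))) (dual_cols zeta u)).

(** The two radial rows become c times unit vectors plus a tail T; subtracting the
    tail from the other columns leaves a block triangular matrix. *)
Lemma det_rows_dual (zeta xi : 'rV[C]_n.+1) u (c s : C) (A B : 'I_(n + n) -> 'rV[C]_n.+1) :
  c != 0 -> (c^*)%C = c -> (s^*)%C = s ->
  hdot zeta zeta = 1 -> hdot xi zeta = 0 -> (forall l, hdot (u l) zeta = 0) ->
  \det (rows_sq (c *: zeta + ('i%C * s) *: xi) (cvec (c *: zeta - ('i%C * s) *: xi))
     (fun k => row_mx (A k) (cvec (B k)))) * dual_det zeta u =
  c ^+ 2 * \det (\matrix_(k, l) (hdot (A k) (u l) + hdot (u l) (B k)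
    - 'i%C * s / c * (hdot (A k) zeta * hdot xi (u l) + hdot zeta (B k) * hdot (u l) xi))).
Proof.
move=> c0 cc sc zz xz uz.
have zx : hdot zeta xi = 0 by rewrite hdotC xz conjc0.
have zu l : hdot zeta (u l) = 0 by rewrite hdotC uz conjc0.
have iC : ('i%C : C)^*%C = - 'i%C by apply: complex_ext; rewrite !ReImE ?oppr0.
pose T : 'M[C]_(1 + 1, n + n) := col_mx (\row_l ('i%C * s / c * hdot xi (u l)))
     (\row_l ('i%C * s / c * hdot (u l) xi)).
set M' := (X in c ^+ 2 * \det X).
set z := c *: zeta + _; set w0 := c *: zeta - _.
have c0v : cvec 0 = 0 :> 'rV[C]_n.+1 by apply/rowP => j; rewrite !mxE conjc0.
pose L := \matrix_k row_mx (hdot (A k) zeta)%:M (hdot zeta (B k))%:M : 'M[C]_(n + n, 1 + 1).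
pose D : 'M[C]_(n + n) := \matrix_(k, l) (hdot (A k) (u l) + hdot (u l) (B k)).
have E : rows_mx z (cvec w0) (fun k => row_mx (A k) (cvec (B k))) *m dual_cols zeta u =
   block_mx c%:M (c *: T) L D.
  have z0E : row_mx z 0 = row_mx z (cvec 0) by rewrite c0v.
  rewrite /rows_mx !mul_col_mx z0E !mul_dual_cols block_mxEv; congr col_mx.
    rewrite scalar_mx_block [block_mx c%:M _ _ _]block_mxEv /T scale_col_mx -block_mxEh block_mxEv.
    have h1 : hdot z zeta = c by rewrite /z !hdotE zz xz mulr1 mulr0 addr0.
    have h2 : hdot zeta w0 = c by rewrite /w0 !hdotE zz zx cc mulr1 mulr0 subr0.
    have s0 : 0%:M = 0 :> 'M[C]_1 by apply/matrixP => a b; rewrite !mxE mul0rn.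
    rewrite h1 h2 hdot0r hdot0l s0; congr col_mx; congr row_mx.
      by apply/rowP => l; rewrite !mxE /z hdot0r addr0 !hdotE zu mulr0 add0r; field.
    apply/rowP => l; rewrite !mxE /w0 hdot0l add0r !hdotE uz mulr0 add0r conjcM sc iC.
    by field.
  apply/row_matrixP => k; rewrite row_mul rowK mul_dual_cols row_row_mx !rowK; congr row_mx.
  by apply/rowP => l; rewrite !mxE.
rewrite /dual_det /rows_sq -det_mulmx -mulmx_cast E.
have -> : M' = D - L *m T.
  apply/matrixP => k l; rewrite !mxE big_split_ord !big_ord1 /= !mxE split_l split_r.
  by rewrite !mxE /= !mulr1n; ring.
have -> : \det (block_mx c%:M (c *: T) L D) = \det (block_mx c%:M (c *: T) L D *m block_mx 1%:M (- T) 0 1%:M).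
  by rewrite det_mulmx det_ublock !det1 !mulr1.
rewrite mulmx_block !mulmx0 !mulmx1 !addr0 mul_scalar_mx scalerN addNr.
by rewrite det_lblock det_scalar mulmxN addrC; congr (_ * \det _).
Qed.

End RowsDet.

Section PhaseOfRows.
Context {R : realType} {m : nat}.
Local Notation C := R[i].
Local Notation Re := complex.Re.
Local Notation Im := complex.Im.
Local Notation vec := 'rV[C]_m.+2.

Lemma split_size : (m.+1 + m.+1 = 2 + (m + m))%N. Proof. lia. Qed.

(** Bases of tangent spaces of the normal bundle of a surface consist of two
    horizontal and 2m vertical vectors; 2 + 2m is twice the dimension n = m + 1. *)
Definition glue (T : Type) (a : 'I_2 -> T) (b : 'I_(m + m) -> T) (l : 'I_(m.+1 + m.+1)) : T :=
  match fintype.split (cast_ord split_size l) with inl j => a j | inr k => b k end.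

Lemma det_glue (D : 'M[C]_(m.+1 + m.+1)) (D1 : 'M[C]_2) (D2 : 'M[C]_(m + m)) :
  (forall k l, D k l = glue (fun j => glue (fun i => D1 j i) (fun _ => D k l) l)
                          (fun j => glue (fun _ => 0) (fun i => D2 j i) l) k) ->
  \det D = \det D1 * \det D2.
Proof.
move=> H.
have <- : \det (mxsub (cast_ord (esym split_size)) (cast_ord (esym split_size)) D) = \det D.
  move: D {H} => D; case: _ / split_size D => D; congr (\det _).
  by apply/matrixP => i j; rewrite mxE; congr (D _ _); apply: val_inj.
rewrite -(det_ublock _ (ursubmx (mxsub (cast_ord (esym split_size)) (cast_ord (esym split_size)) D))).
congr (\det _); rewrite -[LHS]submxK; congr block_mx; apply/matrixP => i j; rewrite !mxE H /glue;
by rewrite !cast_ordKV ?split_l ?split_r ?mxE.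
Qed.

Lemma two_complex : 2 = (2 : R)%:C :> C. Proof. by rewrite rmorph_nat. Qed.
Lemma conj_i : ('i%C)^*%C = - 'i%C :> C.
Proof. by apply: complex_ext => //=; rewrite oppr0. Qed.
Lemma imag_sqr : 'i%C * 'i%C = -1 :> C.
Proof. by apply: complex_ext; rewrite ?cReM ?cImM /= ?mulr0 ?mulr1 ?add0r ?addr0 ?mul0r ?sub0r ?oppr0. Qed.
Lemma addcJ (x : C) : x + x^*%C = 2 * (Re x)%:C.
Proof.
rewrite two_complex; case: x => a b; apply: complex_ext; rewrite ?cReM ?cImM ?cReD ?cImD /=; ring.
Qed.

(** This and the next two lemmas are the three kinds of entries in [det_rows_dual]. *)
Lemma entry_horizontal (c s : R) (p q x y : C) : c != 0 -> Re x = 0 -> Re y = 0 ->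
  c%:C * p + 'i%C * s%:C * q +
  ((c%:C)^*%C * p^*%C - ('i%C * s%:C)^*%C * q^*%C) -
  'i%C * s%:C / c%:C *
  ((c%:C * 0 + 'i%C * s%:C * - x) * y +
   ((c%:C)^*%C * 0 - ('i%C * s%:C)^*%C * - x^*%C) * y^*%C) =
  2 * ((c * Re p + s ^+ 2 / c * (Im x * Im y))%:C + 'i%C * (s * Re q)%:C).
Proof.
move=> c0 x0 y0; rewrite conjcM !conjcR conj_i.
have cc0 : c%:C != 0 :> C by rewrite fmorph_eq0.
transitivity (c%:C * (p + p^*%C) + 'i%C * s%:C * (q + q^*%C) +
   'i%C * 'i%C * (s%:C * s%:C / c%:C) * (x * y + x^*%C * y^*%C)); first by field.
rewrite !addcJ imag_sqr -conjcM addcJ cReM x0 y0 mul0r sub0r.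
by rewrite !(rmorphD, rmorphM, rmorphN, rmorphXn, fmorphV) /=; field.
Qed.

Lemma entry_mixed (c s r : R) (p x : C) : c != 0 -> Re p = 0 ->
  'i%C * p + r%:C * (c%:C * 0 + 'i%C * s%:C * x) +
  (- ('i^*%C * p^*%C) + r%:C^*%C * (c%:C^*%C * 0 - ('i%C * s%:C)^*%C * x^*%C)) -
  'i%C * s%:C / c%:C *
  (('i%C * 0 + r%:C * (c%:C * 1 + 'i%C * s%:C * 0)) * x +
   (- ('i^*%C * 0) + r%:C^*%C * (c%:C^*%C * 1 - ('i%C * s%:C)^*%C * 0)) * x^*%C) = 0.
Proof.
move=> c0 p0; rewrite conjcM !conjcR conj_i.
have cc0 : c%:C != 0 :> C by rewrite fmorph_eq0.
transitivity ('i%C * (p + p^*%C)); first by field.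
by rewrite addcJ p0 mulr0 mulr0.
Qed.

Lemma entry_vertical (c s r : R) (p x : C) : c != 0 ->
  'i%C * p + r%:C * (c%:C * 0 + 'i%C * s%:C * x) +
  (- ('i^*%C * p^*%C) + r%:C^*%C * (c%:C^*%C * 0 - ('i%C * s%:C)^*%C * x^*%C)) -
  'i%C * s%:C / c%:C *
  (('i%C * 0 + r%:C * (c%:C * 1 + 'i%C * s%:C * 0)) * x +
   (- ('i^*%C * 0) + r%:C^*%C * (c%:C^*%C * 1 - ('i%C * s%:C)^*%C * 0)) * x^*%C) =
  2 * 'i%C * (Re p)%:C.
Proof.
move=> c0; rewrite conjcM !conjcR conj_i.
have cc0 : c%:C != 0 :> C by rewrite fmorph_eq0.
transitivity ('i%C * (p + p^*%C)); first by field.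
by rewrite addcJ; ring.
Qed.

(** In the basis dual to the tangent and the normal vectors the matrix is block
    triangular.  The vertical block is 2i times a real Gram matrix independent of xi,
    so that all the information is in the phase of the 2 x 2 horizontal block. *)
Lemma rows_phase (zeta xi : vec) (e b : 'I_2 -> vec) (eta : 'I_(m + m) -> vec) (c s : R) (r : 'I_(m + m) -> R) :
  c != 0 -> hdot zeta zeta = 1 -> hdot xi zeta = 0 ->
  (forall j, hdot (e j) zeta = 0) -> (forall k, hdot (eta k) zeta = 0) ->
  (forall k j, Re (hdot (eta k) (e j)) = 0) ->
  (forall j, hdot (b j) zeta = - hdot xi (e j)) ->
  (forall j, Re (hdot xi (e j)) = 0) ->
  let z := c%:C *: zeta + ('i%C * s%:C) *: xi in
  let w := c%:C *: zeta - ('i%C * s%:C) *: xi in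
  \det (rows_sq z (cvec w) (glue
     (fun j => row_mx (c%:C *: e j + ('i%C * s%:C) *: b j) (cvec (c%:C *: e j - ('i%C * s%:C) *: b j)))
     (fun k => row_mx ('i%C *: eta k + (r k)%:C *: z) (cvec (- ('i%C *: eta k) + (r k)%:C *: w)))))
  * dual_det zeta (glue e eta) =
  c%:C ^+ 2 * (\det (\matrix_(j, l) (2 * ((c * Re (hdot (e j) (e l)) + s ^+ 2 / c * (Im (hdot xi (e j)) * Im (hdot xi (e l))))%:C +
         'i%C * (s * Re (hdot (b j) (e l)))%:C)))
   * \det (\matrix_(k, l) (2 * 'i%C * (Re (hdot (eta k) (eta l)))%:C))).
Proof.
move=> c0 zz xz ez hz he bz xe z w.
pose A := glue (fun j => c%:C *: e j + ('i%C * s%:C) *: b j) (fun k => 'i%C *: eta k + (r k)%:C *: z).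
pose B := glue (fun j => c%:C *: e j - ('i%C * s%:C) *: b j) (fun k => - ('i%C *: eta k) + (r k)%:C *: w).
set X := glue _ _.
have -> : rows_sq z (cvec w) X = rows_sq z (cvec w) (fun k => row_mx (A k) (cvec (B k))).
  congr (rows_sq _ _ _); apply/funext => k; rewrite /X /A /B /glue.
  by case: (fintype.split _).
rewrite det_rows_dual //; [|by rewrite fmorph_eq0|exact: conjcR|exact: conjcR|]; last first.
  by move=> l; rewrite /glue; case: (fintype.split _).
congr (_ * _); apply: det_glue => k l; rewrite mxE /A /B /glue.
have zx : hdot zeta xi = 0 by rewrite hdotC xz conjc0.
have zh k0 : hdot zeta (eta k0) = 0 by rewrite hdotC hz conjc0.
have ze k0 : hdot zeta (e k0) = 0 by rewrite hdotC ez conjc0.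
have zb k0 : hdot zeta (b k0) = - (hdot xi (e k0))^*%C by rewrite hdotC bz conjcN.
case: (fintype.split _) => k'; case: (fintype.split _) => l' //; rewrite ?mxE.
- rewrite !hdotE ez bz ze zb [hdot (e l') (e k')]hdotC [hdot (e l') (b k')]hdotC [hdot (e l') xi]hdotC.
  exact: entry_horizontal.
- rewrite /z /w !hdotE hz ze ez zz zx xz zh [hdot (e l') (eta k')]hdotC [hdot (e l') xi]hdotC.
  exact: entry_mixed.
- rewrite /z /w !hdotE !hz zz zx xz !zh [hdot (eta l') (eta k')]hdotC [hdot (eta l') xi]hdotC.
  exact: entry_vertical.
Qed.

End PhaseOfRows.

(** * Lifts to homogeneous coordinates *)
Section VectorCalculus.
Context {R : realType} {V : normedModType R} {m : nat}.
Local Notation C := R[i].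
Implicit Types (f g : V -> 'rV[C]_m) (a : V -> C).

Definition cdiffr f x := forall j, cdiff (fun y => f y 0 j) x.

Lemma csmoothr_cdiffr (U : set V) f x : csmoothr_on U f -> U x -> cdiffr f x.
Proof. by move=> h Ux j; apply: csmooth_cdiff (h j) Ux. Qed.

Lemma cdiffr_cst (w : 'rV[C]_m) x : cdiffr (fun _ => w) x.
Proof. by move=> j; apply: cdiff_cst. Qed.

Lemma cderiver_cst (w : 'rV[C]_m) x v : cderiver (fun _ : V => w) x v = 0.
Proof. by apply/rowP => j; rewrite !mxE cderive_cst. Qed.

Lemma cdiffrD f g x : cdiffr f x -> cdiffr g x -> cdiffr (fun y => f y + g y) x.
Proof. by move=> hf hg j; under eq_fun do rewrite mxE; apply: cdiffD. Qed.

Lemma cderiverD f g x v : cdiffr f x -> cdiffr g x ->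
  cderiver (fun y => f y + g y) x v = cderiver f x v + cderiver g x v.
Proof.
move=> hf hg; apply/rowP => j; rewrite !mxE; under eq_fun do rewrite mxE.
exact: cderiveD.
Qed.

Lemma cdiffrN f x : cdiffr f x -> cdiffr (fun y => - f y) x.
Proof. by move=> hf j; under eq_fun do rewrite mxE; apply: cdiffN. Qed.

Lemma cderiverN f x v : cdiffr f x -> cderiver (fun y => - f y) x v = - cderiver f x v.
Proof.
move=> hf; apply/rowP => j; rewrite !mxE; under eq_fun do rewrite mxE.
exact: cderiveN.
Qed.

Lemma cdiffrB f g x : cdiffr f x -> cdiffr g x -> cdiffr (fun y => f y - g y) x.
Proof. by move=> hf hg; apply: cdiffrD => //; apply: cdiffrN. Qed.

Lemma cderiverB f g x v : cdiffr f x -> cdiffr g x ->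
  cderiver (fun y => f y - g y) x v = cderiver f x v - cderiver g x v.
Proof. by move=> hf hg; rewrite cderiverD ?cderiverN //; apply: cdiffrN. Qed.

Lemma cdiffrZ a f x : cdiff a x -> cdiffr f x -> cdiffr (fun y => a y *: f y) x.
Proof. by move=> ha hf j; under eq_fun do rewrite mxE; apply: cdiffM. Qed.

Lemma cderiverZ a f x v : cdiff a x -> cdiffr f x ->
  cderiver (fun y => a y *: f y) x v = cderive a x v *: f x + a x *: cderiver f x v.
Proof.
move=> ha hf; apply/rowP => j; rewrite !mxE; under eq_fun do rewrite mxE.
exact: cderiveM.
Qed.

Lemma cderive_hdot f g x v : cdiffr f x -> cdiffr g x ->
  cderive (fun y => hdot (f y) (g y)) x v =
  hdot (cderiver f x v) (g x) + hdot (f x) (cderiver g x v).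
Proof.
move=> hf hg; rewrite cderive_sum; last by move=> j; apply: cdiffM => //; exact: cdiffJ.
rewrite -big_split; apply: eq_bigr => j _.
by rewrite cderiveM ?cderiveJ ?mxE //; apply: cdiffJ.
Qed.

Lemma cderiver_on (U : set V) f g x v : open U -> U x -> {in U, f =1 g} ->
  cderiver f x v = cderiver g x v.
Proof.
move=> oU Ux e; apply/rowP => j; rewrite !mxE.
by apply: (cderive_on _ oU Ux) => y Uy; rewrite e.
Qed.

Lemma cderiver_dirD f x u v : cdiffr f x ->
  cderiver f x (u + v) = cderiver f x u + cderiver f x v.
Proof. by move=> h; apply/rowP => j; rewrite !mxE cderive_dirD. Qed.

Lemma cderiver_dirZ f x (k : R) v : cdiffr f x ->
  cderiver f x (k *: v) = k%:C *: cderiver f x v.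
Proof. by move=> h; apply/rowP => j; rewrite !mxE cderive_dirZ. Qed.

Section On.
Variables (U : set V).
Hypothesis oU : open U.

Lemma csmoothr_sub U' f : U' `<=` U -> csmoothr_on U f -> csmoothr_on U' f.
Proof. by move=> s h j; apply: csmooth_sub s (h j). Qed.

Lemma csmoothr_cst (w : 'rV[C]_m) : csmoothr_on U (fun _ => w).
Proof. by move=> j; apply: csmooth_cst. Qed.

Lemma csmoothrD f g : csmoothr_on U f -> csmoothr_on U g -> csmoothr_on U (fun x => f x + g x).
Proof. by move=> hf hg j; under eq_fun do rewrite mxE; apply: csmoothD. Qed.

Lemma csmoothrN f : csmoothr_on U f -> csmoothr_on U (fun x => - f x).
Proof. by move=> hf j; under eq_fun do rewrite mxE; apply: csmoothN. Qed.

Lemma csmoothrB f g : csmoothr_on U f -> csmoothr_on U g -> csmoothr_on U (fun x => f x - g x).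
Proof. by move=> hf hg; apply: csmoothrD => //; apply: csmoothrN. Qed.

Lemma csmoothrZ a f : csmooth_on U a -> csmoothr_on U f -> csmoothr_on U (fun x => a x *: f x).
Proof. by move=> hf hg j; under eq_fun do rewrite mxE; apply: csmoothM. Qed.

Lemma csmooth_hdot f g : csmoothr_on U f -> csmoothr_on U g ->
  csmooth_on U (fun x => hdot (f x) (g x)).
Proof.
by move=> hf hg; apply: csmooth_sum => // j; apply: csmoothM => //; apply: csmoothJ.
Qed.

Lemma csmoothr_deriver f v : csmoothr_on U f -> csmoothr_on U (fun x => cderiver f x v).
Proof. by move=> hf j; under eq_fun do rewrite mxE; apply: csmooth_derive. Qed.

Lemma csmooth_Re (a : V -> C) : csmooth_on U a -> smooth_on U (fun x => complex.Re (a x)).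
Proof. by case. Qed.
Lemma csmooth_Im (a : V -> C) : csmooth_on U a -> smooth_on U (fun x => complex.Im (a x)).
Proof. by case. Qed.

Lemma csmoothr_comp p (U' : set 'rV[R]_p) (tau : V -> 'rV[R]_p) (f : 'rV[R]_p -> 'rV[C]_m) :
  (forall x, U x -> U' (tau x)) ->
  smoothr_on U tau -> csmoothr_on U' f -> csmoothr_on U (fun x => f (tau x)).
Proof. by move=> h ht hf j; apply: (csmooth_comp oU h ht (hf j)). Qed.

End On.

Lemma cderiver_comp p (tau : V -> 'rV[R]_p) (f : 'rV[R]_p -> 'rV[C]_m) x v :
  differentiable tau x -> (forall j, cdiff (fun y => f y 0 j) (tau x)) ->
  cderiver (fun y => f (tau y)) x v = cderiver f (tau x) ('D_v tau x).
Proof.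
move=> dt h; apply/rowP => j; rewrite !mxE.
by have [d1 d2] := h j; apply: cderive_comp.
Qed.

End VectorCalculus.

Lemma cclairautr (R : realType) (n : nat) (W : set 'rV[R]_2) (V : 'rV[R]_2 -> 'rV[R[i]]_n) x u v :
  open W -> csmoothr_on W V -> W x ->
  cderiver (fun y => cderiver V y u) x v = cderiver (fun y => cderiver V y v) x u.
Proof.
move=> oW sV Wx; apply/rowP => k; rewrite [LHS]mxE [RHS]mxE.
under eq_fun do rewrite mxE. under [in RHS]eq_fun do rewrite mxE.
exact: (cclairaut oW _ _ (sV k) Wx).
Qed.

Lemma csmooth_nz (R : realType) (V : normedModType R) (U : set V) (a : V -> R[i]) :
  open U -> csmooth_on U a -> open (U `&` [set x | a x != 0]).
Proof.
move=> oU ha; rewrite openE => x [Ux ax]; apply: filterI; first exact: open_nbhs_nbhs.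
pose q y := complex.Re (a y) ^+ 2 + complex.Im (a y) ^+ 2.
have sq : smooth_on U q.
  rewrite /q; under eq_fun do rewrite !expr2.
  by apply: smoothD => //; apply: smoothM => //; case: ha.
have c : {for x, continuous q} by apply: differentiable_continuous; apply: smooth_diff sq Ux.
have q0 : q x != 0 by rewrite /q sqr_parts_eq0.
have e0 : 0 < `|q x| by rewrite normr_gt0.
move/cvgrPdist_lt: c => /(_ _ e0); apply: filterS => y /= hy.
rewrite -sqr_parts_eq0 -/(q y); apply: contraTneq hy => ->.
by rewrite subr0 ltxx.
Qed.

(* Conversion tests must not expand these sums. *)
Opaque hdot.

Section RealScalars.
Context {R : realType} {n : nat}.
Local Notation C := R[i].
Local Notation Re := complex.Re.
Implicit Types (x y : 'rV[C]_n) (a : R).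

Lemma lin_comb0 a b (p q : R) : p = 0 -> q = 0 -> a * p + b * q = 0.
Proof. by move=> -> ->; rewrite !mulr0 addr0. Qed.

Lemma scaler_swap (k l : C) x : k *: (l *: x) = l *: (k *: x).
Proof. by rewrite !scalerA mulrC. Qed.

Lemma Re_realM a (c : C) : Re (a%:C * c) = a * Re c.
Proof. by rewrite cReM /= mul0r subr0. Qed.

Lemma Im_realM a (c : C) : complex.Im (a%:C * c) = a * complex.Im c.
Proof. by rewrite cImM /= mul0r addr0. Qed.

Lemma Re_hdotZr a x y : Re (hdot x (a%:C *: y)) = a * Re (hdot x y).
Proof. by rewrite hdotZr conjcR Re_realM. Qed.

Lemma Re_hdotZl a x y : Re (hdot (a%:C *: x) y) = a * Re (hdot x y).
Proof. by rewrite hdotZl Re_realM. Qed.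

Lemma Im_hdotZl a x y : complex.Im (hdot (a%:C *: x) y) = a * complex.Im (hdot x y).
Proof. by rewrite hdotZl Im_realM. Qed.

Lemma Im_hdotZr a x y : complex.Im (hdot x (a%:C *: y)) = a * complex.Im (hdot x y).
Proof. by rewrite hdotZr conjcR Im_realM. Qed.

Lemma Re_hdot_comb (k : C) (a b : R) x y w :
  Re (hdot w (k *: (a%:C *: x + b%:C *: y))) = a * Re (hdot w (k *: x)) + b * Re (hdot w (k *: y)).
Proof.
rewrite scalerDr (scaler_swap k a%:C) (scaler_swap k b%:C) hdotDr cReD.
by rewrite (Re_hdotZr a) (Re_hdotZr b).
Qed.
End RealScalars.

Section Horizontal.
Context {R : realType} {n : nat}.
Local Notation C := R[i].
Local Notation Re := complex.Re.
Local Notation vec := 'rV[C]_n.+1.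
Implicit Types (Z : 'rV[R]_2 -> vec) (x v : 'rV[R]_2).

(** The connection form of the tautological line bundle in the trivialization Z. *)
Definition conn Z v x : C := hdot (cderiver Z x v) (Z x) / hdot (Z x) (Z x).
(** The tangent vector to the surface in the direction v, seen at the lift Z x. *)
Definition Hf Z v x : vec := horizontal (Z x) (cderiver Z x v).

Lemma HfE Z v x : Hf Z v x = cderiver Z x v - conn Z v x *: Z x.
Proof. by []. Qed.

Lemma horizontal_orth (zeta eta : vec) : zeta != 0 -> hdot (horizontal zeta eta) zeta = 0.
Proof.
by move=> z0; rewrite /horizontal hdotBl hdotZl divfK ?subrr // hdotxx_neq0.
Qed.

Lemma horizontalD (zeta eta eta' : vec) :
  horizontal zeta (eta + eta') = horizontal zeta eta + horizontal zeta eta'.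
Proof.
rewrite /horizontal hdotDl mulrDl scalerDl opprD addrACA //.
Qed.

Lemma horizontalZ (zeta eta : vec) (k : C) : horizontal zeta (k *: eta) = k *: horizontal zeta eta.
Proof. by rewrite /horizontal hdotZl scalerBr scalerA mulrA. Qed.

Lemma horizontal_self (zeta : vec) (k : C) : zeta != 0 -> horizontal zeta (k *: zeta) = 0.
Proof.
by move=> z0; rewrite horizontalZ /horizontal divff ?hdotxx_neq0 // scale1r subrr scaler0.
Qed.

Lemma horizontal_scale (zeta eta : vec) (k : C) : k != 0 -> horizontal (k *: zeta) eta = horizontal zeta eta.
Proof.
move=> k0; rewrite /horizontal !hdotE scalerA; congr (_ - _ *: _).
have k1 : k^*%C != 0 by rewrite conjc_eq0.
rewrite !invfM; set a := hdot eta zeta; set b := (hdot zeta zeta)^-1.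
have -> : k^*%C * a * (k^-1 * (k^*%C^-1 * b)) * k = a * b * (k / k) * (k^*%C / k^*%C) by ring.
by rewrite !divff // !mulr1.
Qed.

Lemma HfD Z u v x : cdiffr Z x -> Hf Z (u + v) x = Hf Z u x + Hf Z v x.
Proof. by move=> h; rewrite /Hf cderiver_dirD // horizontalD. Qed.

Lemma HfZ Z (k : R) v x : cdiffr Z x -> Hf Z (k *: v) x = k%:C *: Hf Z v x.
Proof. by move=> h; rewrite /Hf cderiver_dirZ // horizontalZ. Qed.

Lemma Hf_row Z v x : cdiffr Z x ->
  Hf Z v x = (v 0 0)%:C *: Hf Z (delta_mx 0 0) x + (v 0 1)%:C *: Hf Z (delta_mx 0 1) x.
Proof.
move=> h; rewrite [in LHS](row_sum_delta v) big_ord_recl big_ord1 HfD // !HfZ //.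
have -> : lift ord0 ord0 = 1 :> 'I_2 by apply: val_inj.
by have -> : ord0 = 0 :> 'I_2 by apply: val_inj.
Qed.

Section Smoothness.
Variables (W : set 'rV[R]_2) (Z : 'rV[R]_2 -> vec).
Hypotheses (oW : open W) (sZ : csmoothr_on W Z) (Z0 : forall x, W x -> Z x != 0).

Lemma csmooth_conn v : csmooth_on W (conn Z v).
Proof.
apply: csmoothM => //; first by apply: csmooth_hdot => //; apply: csmoothr_deriver.
apply: csmoothV => //; last exact: csmooth_hdot.
by move=> x Wx; rewrite hdotxx_neq0 // Z0.
Qed.

Lemma csmoothr_Hf v : csmoothr_on W (Hf Z v).
Proof.
rewrite /Hf /horizontal; apply: csmoothrB => //; first exact: csmoothr_deriver.
by apply: csmoothrZ => //; apply: csmooth_conn.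
Qed.
End Smoothness.

Lemma represents_neq0 (zeta : vec) (L : CP R n) : represents zeta L -> zeta != 0.
Proof.
case: L => L /= dL; rewrite /represents /= => E; apply/eqP => z0.
by move: dL; rewrite E z0 dim_vline eqxx.
Qed.

Lemma represents_scale (zeta zeta' : vec) (L : CP R n) :
  represents zeta L -> represents zeta' L -> exists2 k : C, k != 0 & zeta' = k *: zeta.
Proof.
move=> h h'; have z0' := represents_neq0 h'.
have : zeta' \in <[zeta]>%VS by rewrite -h h' memv_line.
move/vlineP => [k E]; exists k => //.
by apply: contraNneq z0' => k0; rewrite E k0 scale0r.
Qed.

Lemma representsZ (zeta : vec) (k : C) (L : CP R n) : k != 0 ->
  represents zeta L -> represents (k *: zeta) L.
Proof.
move=> k0 h; rewrite /represents h; apply/eqP; rewrite eqEsubv.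
apply/andP; split; rewrite -memvE; apply/vlineP.
  by exists k^-1; rewrite scalerA mulVf // scale1r.
by exists k.
Qed.

(** Under a change of parameters and of lifts, the derivative of the scalar factor
    contributes only a multiple of Z, which the horizontal projection removes. *)
Lemma Hf_change (U W : set 'rV[R]_2) Z' Z (tau : 'rV[R]_2 -> 'rV[R]_2) x :
  open U -> U x -> open W -> csmoothr_on U Z' -> csmoothr_on W Z -> smoothr_on U tau ->
  (forall y, U y -> W (tau y)) -> (forall y, U y -> Z (tau y) != 0) ->
  (forall y, U y -> exists2 k : C, k != 0 & Z' y = k *: Z (tau y)) ->
  exists k : C, [/\ k != 0, Z' x = k *: Z (tau x) &
    forall v, Hf Z' v x = k *: Hf Z ('D_v tau x) (tau x)].
Proof.
move=> oU Ux oW sZ' sZ st UW Zt0 prop.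
pose k y := hdot (Z' y) (Z (tau y)) / hdot (Z (tau y)) (Z (tau y)).
have sZt : csmoothr_on U (fun y => Z (tau y)) by apply: csmoothr_comp UW st sZ.
have kE y : U y -> k y != 0 /\ Z' y = k y *: Z (tau y).
  move=> Uy; have [c c0 E] := prop y Uy.
  have <- : c = k y by rewrite /k E hdotZl mulfK // hdotxx_neq0 // Zt0.
  by [].
have sk : csmooth_on U k.
  apply: csmoothM => //; first exact: csmooth_hdot.
  apply: csmoothV => //; last exact: csmooth_hdot.
  by move=> y Uy; rewrite hdotxx_neq0 // Zt0.
have [k0 Zx] := kE x Ux; exists (k x); split=> // v.
have -> : Hf Z' v x = horizontal (Z' x) (cderiver (fun y => k y *: Z (tau y)) x v).
  by rewrite /Hf (cderiver_on _ oU Ux (g := fun y => k y *: Z (tau y))) // => y; rewrite inE => /kE[].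
rewrite cderiverZ; [|exact: csmooth_cdiff sk Ux|exact: csmoothr_cdiffr sZt Ux].
rewrite cderiver_comp; [|exact: smoothr_diff st Ux|by move=> j; apply: csmooth_cdiff (sZ j) (UW _ Ux)].
rewrite Zx horizontal_scale // horizontalD horizontal_self ?Zt0 // add0r.
by rewrite horizontalZ.
Qed.

End Horizontal.

Opaque Hf conn.

Section Normals.
Context {R : realType} {M : topologicalType} {n : nat}.
Variable F : M -> CP R n.
Local Notation C := R[i].
Local Notation Re := complex.Re.
Local Notation vec := 'rV[C]_n.+1.

Lemma lifts_neq0 (P : param R M) W (Z : 'rV[R]_2 -> vec) x : lifts F P W Z -> W x -> Z x != 0.
Proof. by move=> [_ _ h] /h /represents_neq0. Qed.

Lemma lifts_prop (P Q : param R M) W W' (Z Z' : 'rV[R]_2 -> vec) x y :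
  lifts F P W Z -> lifts F Q W' Z' -> W x -> W' y -> P x = Q y ->
  exists2 k : C, k != 0 & Z' y = k *: Z x.
Proof.
move=> [_ _ h] [_ _ h'] Wx Wy E; apply: represents_scale (h' _ Wy).
by rewrite -E; apply: h.
Qed.

Lemma smoothr_id (U : set 'rV[R]_2) : smoothr_on U (fun x => x).
Proof. by move=> j; apply: smooth_coord. Qed.

Lemma tangent_vector_Hf (P : param R M) W (Z : 'rV[R]_2 -> vec) x zeta eta :
  lifts F P W Z -> csmoothr_on W Z -> W x -> tangent_vector F P x zeta eta ->
  exists (k : C) v, [/\ k != 0, zeta = k *: Z x & eta = k *: Hf Z v x].
Proof.
move=> lZ sZ Wx [W' [Z' [v [Wx' lZ' sZ' Zx ->]]]].
have oW : open W by case: lZ. have oW' : open W' by case: lZ'.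
have oU : open (W `&` W') by apply: openI.
have [k [k0 kE HE]] := @Hf_change _ _ (W `&` W') W Z' Z (fun x => x) x oU (conj Wx Wx') oW
  (csmoothr_sub (@subIsetr _ _ _) sZ') sZ (@smoothr_id _) (fun y h => h.1)
  (fun y h => lifts_neq0 lZ h.1) (fun y h => lifts_prop lZ lZ' h.1 h.2 erefl).
exists k, v; split => //; first by rewrite -Zx.
by have := HE v; rewrite -Zx derive_id.
Qed.

Lemma normal_vectorP (P : param R M) W (Z : 'rV[R]_2 -> vec) x (k : C) (xi : vec) :
  lifts F P W Z -> csmoothr_on W Z -> W x -> k != 0 -> hdot xi (Z x) = 0 ->
  (forall j, Re (hdot xi (k *: Hf Z (delta_mx 0 j) x)) = 0) ->
  normal_vector F P x (k *: Z x) xi.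
Proof.
move=> lZ sZ Wx k0 xz xH; split.
- by apply: representsZ => //; case: lZ => _ _; apply.
- by rewrite hdotZr xz mulr0.
move=> eta /(tangent_vector_Hf lZ sZ Wx) [k' [v [k0' kE ->]]].
have <- : k = k'.
  have /eqP := kE; rewrite -subr_eq0 -scalerBl scaler_eq0 (negPf (lifts_neq0 lZ Wx)) orbF.
  by rewrite subr_eq0 => /eqP.
rewrite /FubiniStudy Hf_row; last exact: csmoothr_cdiffr sZ Wx.
rewrite (Re_hdot_comb k (v 0 0) (v 0 1)).
by rewrite (lin_comb0 _ _ (xH 0) (xH 1)) mul0r.
Qed.

End Normals.

Lemma ord2_cases (l : 'I_2) : l = 0 \/ l = 1.
Proof. by case: l => -[|[|//]] i; [left|right]; apply: val_inj. Qed.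

(** * Tangent vectors of the normal bundle *)
Section NormalProjection.
Context {R : realType} {n : nat}.
Local Notation C := R[i].
Local Notation Re := complex.Re.
Implicit Types xi z h : 'rV[C]_n.

(** Orthogonal projection to the normal space: z is removed by the Hermitian
    product, h0 and h1 by inverting their real Gram matrix. *)
Definition proj_normal xi z h0 h1 : 'rV[C]_n :=
  let a := Re (hdot h0 h0) in let b := Re (hdot h0 h1) in let c := Re (hdot h1 h1) in
  let p := Re (hdot xi h0) in let q := Re (hdot xi h1) in
  let d := a * c - b ^+ 2 in
  xi - (hdot xi z / hdot z z) *: z - ((c * p - b * q) / d)%:C *: h0 - ((a * q - b * p) / d)%:C *: h1.

Lemma proj_normal_orth xi z h0 h1 : z != 0 -> hdot h0 z = 0 -> hdot h1 z = 0 ->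
  hdot (proj_normal xi z h0 h1) z = 0.
Proof.
move=> z0 e0 e1; rewrite /proj_normal !hdotBl !hdotZl e0 e1 !mulr0 !subr0.
by rewrite divfK ?subrr // hdotxx_neq0.
Qed.

Lemma proj_normal_normal xi z h0 h1 : hdot h0 z = 0 -> hdot h1 z = 0 ->
  Re (hdot h0 h0) * Re (hdot h1 h1) - Re (hdot h0 h1) ^+ 2 != 0 ->
  Re (hdot (proj_normal xi z h0 h1) h0) = 0 /\ Re (hdot (proj_normal xi z h0 h1) h1) = 0.
Proof.
move=> e0 e1; rewrite /proj_normal !hdotBl !hdotZl [hdot z h0]hdotC [hdot z h1]hdotC e0 e1 conjc0.
rewrite !mulr0 !subr0 !cReB !Re_realM [hdot h1 h0]hdotC cReJ.
move: (Re _) (Re _) (Re _) (Re _) (Re _) => p a b c q d0.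
by split; field.
Qed.

Lemma proj_normal_id xi z h0 h1 : hdot xi z = 0 -> Re (hdot xi h0) = 0 -> Re (hdot xi h1) = 0 ->
  proj_normal xi z h0 h1 = xi.
Proof.
by move=> e0 e1 e2; rewrite /proj_normal e0 e1 e2 !mulr0 subrr !mul0r !scale0r !subr0.
Qed.

Lemma smooth_proj_normal (V : normedModType R) (U : set V) xi (Z H0 H1 : V -> 'rV[C]_n) :
  open U -> csmoothr_on U Z -> csmoothr_on U H0 -> csmoothr_on U H1 ->
  (forall x, U x -> Z x != 0) ->
  (forall x, U x -> Re (hdot (H0 x) (H0 x)) * Re (hdot (H1 x) (H1 x)) - Re (hdot (H0 x) (H1 x)) ^+ 2 != 0) ->
  csmoothr_on U (fun x => proj_normal xi (Z x) (H0 x) (H1 x)).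
Proof.
move=> oU sZ s0 s1 Z0 d0.
have sx := csmoothr_cst U xi.
have sR f g : csmoothr_on U f -> csmoothr_on U g -> smooth_on U (fun x => Re (hdot (f x) (g x))).
  by move=> hf hg; exact: (csmooth_Re (csmooth_hdot oU hf hg)).
have sd : smooth_on U (fun x => (Re (hdot (H0 x) (H0 x)) * Re (hdot (H1 x) (H1 x)) - Re (hdot (H0 x) (H1 x)) ^+ 2)^-1).
  apply: smoothV => //; under eq_fun do rewrite expr2.
  by apply: smoothB => //; apply: smoothM => //; apply: sR.
rewrite /proj_normal; apply: csmoothrB => //; last first.
  apply: csmoothrZ => //; apply: csmoothR; apply: smoothM => //.
  by apply: smoothB => //; apply: smoothM => //; apply: sR.
apply: csmoothrB => //; last first.
  apply: csmoothrZ => //; apply: csmoothR; apply: smoothM => //.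
  by apply: smoothB => //; apply: smoothM => //; apply: sR.
apply: csmoothrB => //; apply: csmoothrZ => //.
apply: csmoothM => //; first exact: csmooth_hdot.
apply: csmoothV => //; last exact: csmooth_hdot.
by move=> x Ux; rewrite hdotxx_neq0 // Z0.
Qed.

End NormalProjection.

Section PhiCurves.
Context {R : realType} {n : nat}.
Local Notation C := R[i].
Local Notation vec := 'rV[C]_n.+1.

Lemma Re_hdot_scale (k : C) (x y : vec) :
  complex.Re (hdot (k *: x) (k *: y)) = (complex.Re k ^+ 2 + complex.Im k ^+ 2) * complex.Re (hdot x y).
Proof. by rewrite hdotZl hdotZr mulrA cReM cReM cImM cReJ cImJ; ring. Qed.

Lemma Re_hdot_line (t : R) (x y : vec) : complex.Re (hdot y x) = 0 ->
  complex.Re (hdot (x + t%:C *: y) (x + t%:C *: y)) =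
  complex.Re (hdot x x) + t * t * complex.Re (hdot y y).
Proof.
move=> e; rewrite hdotDl cReD hdotDr cReD (hdotDr (t%:C *: y) x) cReD.
rewrite (Re_hdotZr t x y) (Re_hdotZl t y x) (Re_hdotZl t y (t%:C *: y)) (Re_hdotZr t y y) e.
by rewrite [complex.Re (hdot x y)]Re_hdotC e !mulr0 addr0 add0r mulrA.
Qed.

Lemma cdiff_embed (t : R) : cdiff (fun t : R => t%:C) t.
Proof.
have cs : csmooth_on (setT : set R) (fun t : R => t%:C) by apply: csmoothR; apply: smooth_id.
exact: csmooth_cdiff cs (I : setT t).
Qed.

Lemma cderiverZc (V : normedModType R) (k : C) (f : V -> vec) x v : cdiffr f x ->
  cderiver (fun y => k *: f y) x v = k *: cderiver f x v.
Proof.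
move=> h; rewrite (cderiverZ v (cdiff_cst k x) h) cderive_cst scale0r add0r.
by [].
Qed.

(** The second fundamental form appears with the opposite sign when the derivative
    is moved from the tangent fields to the normal field. *)
Lemma shape_sign (k p q r : C) : complex.Re p = 0 -> complex.Re q + complex.Re r = 0 ->
  complex.Re (- k * p + q) = - complex.Re (r - k^*%C * p).
Proof.
case: k p q r => k1 k2 [p1 p2] [q1 q2] [r1 r2] /= -> E.
by rewrite !mulr0; lra.
Qed.

Lemma cderiver_arc (m : R -> R) (x y : vec) : differentiable m 0 ->
  cderiver (fun t : R => (m t)%:C *: (x + t%:C *: y)) (0 : R) 1 = ('D_1 m 0)%:C *: x + (m 0)%:C *: y.
Proof.
move=> dm; have cm := cdiffR dm; have ce := cdiff_embed (0 : R).
have cx := cdiffr_cst x (0 : R); have cy := cdiffr_cst y (0 : R).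
have cty := cdiffrZ ce cy; have cxy := cdiffrD cx cty.
rewrite (cderiverZ (1 : R) cm cxy) (cderiverD (1 : R) cx cty) (cderiverZ (1 : R) ce cy) cderiver_cst cderiver_cst.
rewrite cderiveR cderiveR derive_id scale0r addr0 scaler0 addr0 add0r.
by rewrite scale1r.
Qed.

Lemma derive_line (V : normedModType R) (x u : V) (s : R) : 'D_1 (fun t : R => x + t *: u) s = u.
Proof.
have H : is_diff s (fun t : R => x + t *: u) (fun t : R => t *: u).
  have -> : (fun t : R => x + t *: u) = cst x + (fun t : R => t *: u) by [].
  by apply: is_diff_eq; rewrite add0r.
by rewrite deriveE // diff_val scale1r.
Qed.

(** The norm of b enters Phi only through its ratio to that of a; on curves with a
    constant ratio Phi is real linear in (a, b). *)
Lemma Phi_ratio (a b : vec) (mu : R) : a != 0 -> hnorm b = mu * hnorm a ->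
  Phi a b = row_mx ((cosh mu)%:C *: a + ('i%C * (sinhc mu)%:C) *: b)
                   (cvec ((cosh mu)%:C *: a - ('i%C * (sinhc mu)%:C) *: b)).
Proof.
move=> a0 E; rewrite /Phi E mulfK ?gt_eqF ?hnorm_gt0 //; congr row_mx.
apply/rowP => j; rewrite !mxE conjcD conjcN !conjcM !conjcR conj_i.
by rewrite mulNr mulNr opprK.
Qed.

Lemma cderiver_row_mx (V : normedModType R) (f g : V -> vec) x v :
  cderiver (fun t => row_mx (f t) (g t)) x v = row_mx (cderiver f x v) (cderiver g x v).
Proof.
apply/rowP => j; rewrite mxE; case: (split_ordP j) => k ->.
  by rewrite row_mxEl mxE; apply: eq_cderive => y; rewrite row_mxEl.
by rewrite row_mxEr mxE; apply: eq_cderive => y; rewrite row_mxEr.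
Qed.

Lemma cderiver_cvec (V : normedModType R) (f : V -> vec) x v : cdiffr f x ->
  cderiver (fun t => cvec (f t)) x v = cvec (cderiver f x v).
Proof.
move=> h; apply/rowP => j; rewrite !mxE -cderiveJ //.
by apply: eq_cderive => y; rewrite mxE.
Qed.
End PhiCurves.

Section Hyperbolic.
Context {R : realType} {n : nat}.
Local Notation C := R[i].
Local Notation vec := 'rV[C]_n.+1.

Definition sinh (x : R) : R := (expR x - expR (- x)) / 2.

Lemma cosh_abs (t h : R) : cosh (`|t| * h) = cosh (t * h).
Proof. by rewrite /cosh; case: (ger0P t) => // _; rewrite mulNr opprK addrC. Qed.

Lemma sinhc_abs (t h : R) : sinhc (`|t| * h) = sinhc (t * h).
Proof.
rewrite /sinhc; case: (ger0P t) => // _; rewrite mulNr oppr_eq0 opprK.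
by case: eqP => // _; rewrite invrN; ring.
Qed.

Lemma cosh_gt0 (x : R) : 0 < cosh x.
Proof. by rewrite /cosh divr_gt0 // addr_gt0 // expR_gt0. Qed.

Lemma sinhc_gt0 (x : R) : 0 < x -> 0 < sinhc x.
Proof.
move=> x0; rewrite /sinhc gt_eqF // !divr_gt0 // subr_gt0 ltr_expR.
by rewrite -subr_gt0 opprK addr_gt0.
Qed.

Lemma cosh_sinhc (x : R) : cosh x ^+ 2 - (sinhc x * x) ^+ 2 = 1.
Proof.
rewrite /sinhc; case: eqVneq => [->|x0].
  by rewrite mulr0 expr0n /= subr0 /cosh oppr0 expR0 -mulr2n divff // expr1n.
rewrite divfK // /cosh; have : expR x * expR (- x) = 1 by rewrite -expRD subrr expR0.
move: (expR x) (expR (- x)) => e f ef.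
have -> : ((e + f) / 2) ^+ 2 - ((e - f) / 2) ^+ 2 = e * f by field.
by [].
Qed.

Lemma vertical_coeff (c s t0 mu : R) : c != 0 -> s != 0 -> c ^+ 2 - (s * mu) ^+ 2 = 1 ->
  c * t0 * c + - (s * (s^-1 * t0)) = mu * (c * t0) * (s * mu) / c * s.
Proof.
move=> c0 s0 E; have -> : mu * (c * t0) * (s * mu) / c * s = t0 * (s * mu) ^+ 2 by field.
have -> : s * (s^-1 * t0) = t0 by field.
have -> : (s * mu) ^+ 2 = c ^+ 2 - 1 by rewrite -E; ring.
by ring.
Qed.

Lemma vertical_vec (c s t0 mu : R) (eta xi : vec) :
  c != 0 -> s != 0 -> c ^+ 2 - (s * mu) ^+ 2 = 1 ->
  'i%C *: ((c * t0 * c)%:C *: xi + s%:C *: ((s^-1)%:C *: (eta - t0%:C *: xi))) =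
  'i%C *: eta + (mu * (c * t0) * (s * mu) / c)%:C *: (('i%C * s%:C) *: xi).
Proof.
move=> c0 s0 E; have := vertical_coeff t0 c0 s0 E.
rewrite [s * _]mulrA (mulfV s0) mul1r => /eqP; rewrite subr_eq => /eqP ->.
have S : s%:C * (s^-1)%:C = 1 by rewrite -(rmorphM (real_complex R)) /= mulfV.
rewrite (scalerA s%:C) S scale1r rmorphD rmorphM /=.
by apply/rowP => j; rewrite !mxE; ring.
Qed.

Lemma vertical_row (p q c : R) (ie z sx : vec) : p = q * c ->
  row_mx (ie + q%:C *: (c%:C *: z + sx)) (cvec (- ie + q%:C *: (c%:C *: z - sx))) =
  row_mx (p%:C *: z + (ie + q%:C *: sx)) (cvec (p%:C *: z - (ie + q%:C *: sx))).
Proof.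
move=> ->; rewrite rmorphM -scalerA scalerDr scalerBr opprD; congr row_mx; first exact: addrCA.
by congr cvec; rewrite addrCA.
Qed.

Lemma sinhcE (x : R) : x != 0 -> sinhc x = sinh x / x.
Proof. by rewrite /sinhc => /negPf ->. Qed.

Lemma derive_expR_affine (a b t : R) :
  differentiable (fun t => expR (a + b * t)) t /\ 'D_1 (fun t => expR (a + b * t)) t = b * expR (a + b * t).
Proof.
have H : is_derive t 1 (fun t => expR (a + b * t)) (b * expR (a + b * t)).
  have da : is_derive t 1 (fun t => a + b * t) b.
    have -> : (fun t => a + b * t) = (fun t => a + t *: b).
      by apply/funext => u; rewrite /GRing.scale /= mulrC.
    apply: DeriveDef; last exact: derive_line.
    by apply: diff_derivable.
  have de := is_derive_expR (a + b * t).
  have := @is_derive1_comp R expR (fun t => a + b * t) t _ _ de da.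
  by rewrite [_ * b]mulrC.
by split; [apply/derivable1_diffP|rewrite derive_val].
Qed.

Lemma derive_cosh_affine (a b t : R) :
  differentiable (fun t => cosh (a + b * t)) t /\ 'D_1 (fun t => cosh (a + b * t)) t = b * sinh (a + b * t).
Proof.
have [d1 D1] := derive_expR_affine a b t; have [d2 D2] := derive_expR_affine (- a) (- b) t.
have E : (fun t => cosh (a + b * t)) = 2^-1 *: ((fun t => expR (a + b * t)) + (fun t => expR (- a + - b * t))).
  by apply/funext => u; rewrite /cosh opprD -mulNr !fctE mulrC.
rewrite E; split; first by apply: differentiableZ; apply: differentiableD.
rewrite deriveZ; last by apply: derivableD; apply: diff_derivable.
rewrite deriveD; [|exact: diff_derivable|exact: diff_derivable].
by rewrite D1 D2 /sinh opprD -mulNr /GRing.scale /=; ring.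
Qed.

Lemma derive_sinh_affine (a b t : R) :
  differentiable (fun t => sinh (a + b * t)) t /\ 'D_1 (fun t => sinh (a + b * t)) t = b * cosh (a + b * t).
Proof.
have [d1 D1] := derive_expR_affine a b t; have [d2 D2] := derive_expR_affine (- a) (- b) t.
have E : (fun t => sinh (a + b * t)) = 2^-1 *: ((fun t => expR (a + b * t)) - (fun t => expR (- a + - b * t))).
  by apply/funext => u; rewrite /sinh opprD -mulNr !fctE mulrC.
rewrite E; split; first by apply: differentiableZ; apply: differentiableB.
rewrite deriveZ; last by apply: derivableB; apply: diff_derivable.
rewrite deriveB; [|exact: diff_derivable|exact: diff_derivable].
rewrite D1 D2 /cosh /GRing.scale /=.
have -> : - (a + b * t) = - a + - b * t by ring.
by ring.
Qed.

Lemma cderiver_polar (f g : R -> R) (beta : R -> vec) (zeta : vec) (t : R) :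
  differentiable f t -> differentiable g t -> cdiffr beta t ->
  cderiver (fun t => row_mx ((f t)%:C *: zeta + ('i%C * (g t)%:C) *: beta t)
     (cvec ((f t)%:C *: zeta - ('i%C * (g t)%:C) *: beta t))) t 1 =
  row_mx (('D_1 f t)%:C *: zeta + ('i%C : C) *: (('D_1 g t)%:C *: beta t + (g t)%:C *: cderiver beta t 1))
   (cvec (('D_1 f t)%:C *: zeta - ('i%C : C) *: (('D_1 g t)%:C *: beta t + (g t)%:C *: cderiver beta t 1))).
Proof.
move=> df dg db; set w := 'i%C *: (_ + _).
have cf := cdiffR df; have cg := cdiffR dg; have cz := cdiffr_cst zeta t.
have ci := cdiff_cst ('i%C : C) t.
have c1 : cdiffr (fun t => (f t)%:C *: zeta) t by exact: cdiffrZ.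
have c2 : cdiffr (fun t => ('i%C * (g t)%:C) *: beta t) t by apply: cdiffrZ => //; apply: cdiffM.
have D1 : cderiver (fun t => (f t)%:C *: zeta) t 1 = ('D_1 f t)%:C *: zeta.
  by rewrite cderiverZ // cderiver_cst scaler0 addr0 cderiveR.
have D2 : cderiver (fun t => ('i%C * (g t)%:C) *: beta t) t 1 = w.
  rewrite cderiverZ //; last exact: cdiffM.
  by rewrite cderiveM // cderive_cst mul0r add0r cderiveR /w scalerDr !scalerA.
rewrite cderiver_row_mx cderiver_cvec; last exact: cdiffrB.
by rewrite cderiverD // cderiverB // D1 D2.
Qed.

End Hyperbolic.

Section PhiNM.
Context {R : realType} {M : topologicalType} {n : nat}.
Variable F : M -> CP R n.
Local Notation C := R[i].
Local Notation Re := complex.Re.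
Local Notation Im := complex.Im.
Local Notation vec := 'rV[C]_n.+1.

Definition metric (Z : 'rV[R]_2 -> vec) (x : 'rV[R]_2) (j l : 'I_2) : R :=
  Re (hdot (Hf Z (delta_mx 0 j) x) (Hf Z (delta_mx 0 l) x)).

(** This is the determinant of the metric; F is immersed where it does not vanish. *)
Definition gram (Z : 'rV[R]_2 -> vec) x : R :=
  metric Z x 0 0 * metric Z x 1 1 - metric Z x 0 1 ^+ 2.

Lemma metricC Z x j l : metric Z x j l = metric Z x l j.
Proof. exact: Re_hdotC. Qed.

Lemma hnormZ (k : C) (y : vec) : hnorm (k *: y) = Num.sqrt (Re k ^+ 2 + Im k ^+ 2) * hnorm y.
Proof.
rewrite /hnorm -sqrtrM ?addr_ge0 ?sqr_ge0 //; congr Num.sqrt.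
by rewrite hdotZl hdotZr (hdotxx_real y) mulrA !cReM !cImM cReJ cImJ ReR ImR; ring.
Qed.

Lemma hnormZr (k : R) (y : vec) : 0 <= k -> hnorm (k%:C *: y) = k * hnorm y.
Proof. by move=> k0; rewrite hnormZ /= expr0n addr0 sqrtr_sqr ger0_norm. Qed.

Section Fields.
Variables (P : param R M) (W : set 'rV[R]_2) (Z : 'rV[R]_2 -> vec) (x0 : 'rV[R]_2).
Hypotheses (lZ : lifts F P W Z) (sZ : csmoothr_on W Z) (Wx0 : W x0).
Hypothesis zz : hdot (Z x0) (Z x0) = 1.
Hypothesis gram0 : forall x, W x -> gram Z x != 0.

Let oW : open W. Proof. by case: lZ. Qed.
Let Z0 x : W x -> Z x != 0. Proof. exact: lifts_neq0 lZ. Qed.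
Let H (l : 'I_2) x := Hf Z (delta_mx 0 l) x.
Let sH l : csmoothr_on W (H l). Proof. exact: csmoothr_Hf. Qed.

Section Projection.
Variable xi : vec.
Hypotheses (xz : hdot xi (Z x0) = 0) (xH : forall l, Re (hdot xi (H l x0)) = 0).

Definition nproj x : vec := proj_normal xi (Z x) (H 0 x) (H 1 x).

Lemma smooth_nproj : csmoothr_on W nproj.
Proof. by apply: smooth_proj_normal => // x Wx; apply: gram0. Qed.

Lemma H_orth l x : W x -> hdot (H l x) (Z x) = 0.
Proof. by move=> Wx; apply: horizontal_orth; apply: Z0. Qed.

Lemma nproj_orth x : W x -> hdot (nproj x) (Z x) = 0.
Proof. by move=> Wx; apply: proj_normal_orth; [apply: Z0|apply: H_orth|apply: H_orth]. Qed.

Lemma nproj_normal l x : W x -> Re (hdot (nproj x) (H l x)) = 0.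
Proof.
move=> Wx; have [e0 e1] := proj_normal_normal xi (H_orth 0 Wx) (H_orth 1 Wx) (gram0 Wx).
by have [->|->] := ord2_cases l; [exact: e0|exact: e1].
Qed.

Lemma nproj_base : nproj x0 = xi.
Proof. exact: proj_normal_id (xH 0) (xH 1). Qed.

(** Rescaling the projection of xi to nearby normal spaces keeps |N| / |Z| constant,
    and then cosh and sinh are constant along the section N of the normal bundle. *)
Lemma normal_field : exists W2 (N : 'rV[R]_2 -> vec),
  [/\ [/\ open W2, W2 `<=` W & W2 x0], csmoothr_on W2 N, N x0 = xi
   & forall x, W2 x -> [/\ hdot (N x) (Z x) = 0, forall l, Re (hdot (N x) (H l x)) = 0
        & hnorm (N x) = hnorm xi * hnorm (Z x)]].
Proof.
have [x00|xn0] := eqVneq xi 0.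
  exists W, (fun _ : 'rV[R]_2 => 0 : vec); split; [by split|exact: csmoothr_cst|by rewrite x00|].
  move=> x Wx; split; [exact: hdot0l|by move=> l; rewrite hdot0l|].
  have -> : hnorm (0 : vec) = 0 by rewrite /hnorm hdot0l sqrtr0.
  by rewrite x00 /hnorm hdot0l sqrtr0 mul0r.
pose W2 := W `&` [set x | hdot (nproj x) (nproj x) != 0].
have snn : csmooth_on W (fun x => hdot (nproj x) (nproj x)).
  by apply: csmooth_hdot => //; apply: smooth_nproj.
have oW2 : open W2 by apply: csmooth_nz.
have W2W : W2 `<=` W by move=> x [].
have nn x : W2 x -> 0 < Re (hdot (nproj x) (nproj x)).
  by move=> [_ /= h]; apply: hdotxx_gt0; apply: contraNneq h => ->; rewrite hdot0l.
have ZZ x : W2 x -> 0 < Re (hdot (Z x) (Z x)) by move=> /W2W Wx; apply: hdotxx_gt0; apply: Z0.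
pose rho x := hnorm xi * Num.sqrt (Re (hdot (Z x) (Z x))) / Num.sqrt (Re (hdot (nproj x) (nproj x))).
have srho : smooth_on W2 rho.
  apply: smoothM => //; last first.
    apply: smoothV => //; first by move=> x /nn h; rewrite gt_eqF // sqrtr_gt0.
    apply: smooth_sqrt => //; apply: csmooth_Re; exact: csmooth_sub W2W snn.
  apply: smoothM => //; first exact: smooth_cst.
  apply: smooth_sqrt => //; apply: csmooth_Re; apply: csmooth_sub W2W _.
  exact: csmooth_hdot.
have W2x0 : W2 x0 by split => //=; rewrite nproj_base hdotxx_neq0.
exists W2, (fun x => (rho x)%:C *: nproj x); split; [exact: And3 oW2 W2W W2x0| | |].
- apply: csmoothrZ => //; first exact: csmoothR.
  exact: csmoothr_sub W2W smooth_nproj.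
- rewrite nproj_base /rho nproj_base zz sqrtr1 mulr1 -/(hnorm xi) divff ?scale1r //.
  by rewrite gt_eqF // hnorm_gt0.
move=> x W2x; have Wx := W2W _ W2x; split.
- by rewrite hdotZl nproj_orth // mulr0.
- by move=> l; rewrite (Re_hdotZl (rho x)) nproj_normal // mulr0.
rewrite hnormZr; last by rewrite /rho !mulr_ge0 ?invr_ge0 ?sqrtr_ge0 // hnorm_ge0.
by rewrite /rho -/(hnorm (nproj x)) -/(hnorm (Z x)) divfK // gt_eqF // sqrtr_gt0 nn.
Qed.

(** The second fundamental form, up to components along Z and the tangent plane. *)
Definition sff (j l : 'I_2) : vec :=
  cderiver (H l) x0 (delta_mx 0 j) - conn Z (delta_mx 0 j) x0 *: H l x0.

Lemma line_smooth (I : set R) (x v : 'rV[R]_2) : open I -> smoothr_on I (fun t : R => x + t *: v).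
Proof.
move=> oI j; under eq_fun do rewrite !mxE.
by apply: smoothD => //; [apply: smooth_cst|apply: smoothM => //; [apply: smooth_id|apply: smooth_cst]].
Qed.

(** The curve is (lam Z, lam N) along a coordinate line, with N from [normal_field];
    the factor lam, with lam' = - conn at 0, makes the derivative of lam Z the
    horizontal vector H j. *)
Lemma PhiNM_horizontal j : let c := cosh (hnorm xi) in let s := sinhc (hnorm xi) in
  exists b' : vec, [/\ PhiNM_tangent F P x0 (Z x0) xi
     (row_mx (c%:C *: H j x0 + ('i%C * s%:C) *: b') (cvec (c%:C *: H j x0 - ('i%C * s%:C) *: b'))),
   hdot b' (Z x0) = - hdot xi (H j x0) &
   forall l, Re (hdot b' (H l x0)) = - Re (hdot xi (sff j l))].
Proof.
move=> c s; set v : 'rV[R]_2 := delta_mx 0 j.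
have [W2 [N [[oW2 W2W W2x0] sN Nx0 HN]]] := normal_field.
pose k := conn Z v x0.
pose lam (t : R) : C := 1 - t%:C * k.
pose L (t : R) : 'rV[R]_2 := x0 + t *: v.
have L0 : L 0 = x0 by rewrite /L scale0r addr0.
have sLT : smoothr_on setT L by apply: line_smooth; exact: openT.
have slT : csmooth_on setT lam.
  apply: csmoothB; [exact: openT|exact: csmooth_cst|].
  apply: csmoothM; [exact: openT| |exact: csmooth_cst].
  by apply: csmoothR; apply: smooth_id.
pose I := (L @^-1` W2) `&` [set t | lam t != 0].
have oI : open I.
  apply: openI.
    apply: open_comp => // t _; apply: differentiable_continuous.
    exact: smoothr_diff sLT (Logic.I : setT t).
  by have := csmooth_nz openT slT; rewrite setTI.
have l0 : lam 0 = 1 by rewrite /lam mul0r subr0.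
have I0 : I 0 by split; rewrite /preimage /= ?L0 ?l0 // oner_neq0.
have sL : smoothr_on I L by move=> i; apply: smooth_sub (sLT i).
have sl : csmooth_on I lam by apply: csmooth_sub slT.
have IW2 t : I t -> W2 (L t) by case.
have IW t : I t -> W (L t) by move=> /IW2 /W2W.
have sZL : csmoothr_on I (fun t => Z (L t)) by apply: (csmoothr_comp oI IW sL sZ).
have sNL : csmoothr_on I (fun t => N (L t)) by apply: (csmoothr_comp oI IW2 sL sN).
pose a t := lam t *: Z (L t); pose b t := lam t *: N (L t).
have sa : csmoothr_on I a by apply: csmoothrZ.
have sb : csmoothr_on I b by apply: csmoothrZ.
have DL : 'D_1 L 0 = v.
  exact: derive_line.
have dL : differentiable L 0 by exact: smoothr_diff sL I0.
have Dl : cderive lam (0 : R) 1 = - k.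
  have ct : cdiff (fun t : R => t%:C) (0 : R).
    exact: cdiff_embed.
  have ck := cdiff_cst k (0 : R).
  rewrite /lam cderiveB; [|exact: cdiff_cst|exact: cdiffM].
  by rewrite cderive_cst sub0r cderiveM // cderive_cst mulr0 addr0 cderiveR derive_id mul1r.
have cl : cdiff lam 0 by exact: csmooth_cdiff sl I0.
have cZL : cdiffr (fun t => Z (L t)) 0 by exact: csmoothr_cdiffr sZL I0.
have cNL : cdiffr (fun t => N (L t)) 0 by exact: csmoothr_cdiffr sNL I0.
have cZ : cdiffr Z x0 by exact: csmoothr_cdiffr sZ Wx0.
have cN : cdiffr N x0 by exact: csmoothr_cdiffr sN W2x0.
have Da : cderiver a (0 : R) 1 = H j x0.
  rewrite cderiverZ // Dl L0 l0 scale1r cderiver_comp //; last by rewrite L0.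
  by rewrite DL L0 scaleNr addrC.
pose b' := - k *: xi + cderiver N x0 v.
have Db : cderiver b (0 : R) 1 = b'.
  rewrite cderiverZ // Dl L0 l0 scale1r cderiver_comp //; last by rewrite L0.
  by rewrite DL L0 Nx0.
have cH l : cdiffr (H l) x0 by exact: csmoothr_cdiffr (sH l) Wx0.
exists b'; split.
- exists I, L, a, b; split => //.
  + by split => //; rewrite /a /b L0 l0 !scale1r.
  + move=> t It; have [NZ NH _] := HN _ (IW2 _ It).
    have [_ lt0] := It.
    split; first by case: lZ => _ WP _; apply: WP; apply: IW.
    apply: (normal_vectorP lZ sZ (IW _ It) lt0).
      by rewrite hdotZl NZ mulr0.
    by move=> l; rewrite Re_hdot_scale NH mulr0.
  + have E : {in I, (fun t => Phi (a t) (b t)) =1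
       (fun t => row_mx (c%:C *: a t + ('i%C * s%:C) *: b t) (cvec (c%:C *: a t - ('i%C * s%:C) *: b t)))}.
      move=> t; rewrite inE => It; apply: Phi_ratio.
        by rewrite scaler_eq0 negb_or; case: It => /W2W Wt lt0; rewrite lt0 Z0.
      have [_ _ NN] := HN _ (IW2 _ It).
      by rewrite /a /b !hnormZ NN mulrCA.
    have ca : cdiffr a 0 by exact: csmoothr_cdiffr sa I0.
    have cb : cdiffr b 0 by exact: csmoothr_cdiffr sb I0.
    have cca := cdiffrZ (cdiff_cst c%:C 0) ca.
    have ccb := cdiffrZ (cdiff_cst ('i%C * s%:C) 0) cb.
    rewrite (cderiver_on _ oI I0 E) cderiver_row_mx cderiver_cvec; last exact: cdiffrB.
    by rewrite (cderiverD (1 : R) cca ccb) (cderiverB (1 : R) cca ccb) (cderiverZc _ _ ca) (cderiverZc _ _ cb) Da Db.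
- have E : cderive (fun y => hdot (N y) (Z y)) x0 v = 0.
    rewrite (cderive_on v oW2 W2x0 (g := fun=> 0)) ?cderive_cst // => y.
    by rewrite inE => /HN[].
  rewrite cderive_hdot // Nx0 in E.
  rewrite /b' hdotDl hdotZl xz mulr0 add0r [H j x0]HfE hdotBr hdotZr xz mulr0 subr0.
  by apply/eqP; rewrite -addr_eq0 E.
move=> l.
have E : Re (cderive (fun y => hdot (N y) (H l y)) x0 v) = 0.
  rewrite Re_cderive (eq_derive_on oW2 (g := fun=> 0)) ?derive_cst // ?inE // => y.
  by rewrite inE => /HN[_ HNl _].
rewrite cderive_hdot // Nx0 cReD in E.
rewrite /b' /sff (hdotDl (- k *: xi)) (hdotZl (- k)) (hdotBr xi (cderiver (H l) x0 v)) (hdotZr k).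
exact: shape_sign (xH l) E.
Qed.

End Projection.

Lemma base_normal xi : hdot xi (Z x0) = 0 -> (forall l, Re (hdot xi (H l x0)) = 0) ->
  normal_vector F P x0 (Z x0) xi.
Proof.
move=> xz xH; have := @normal_vectorP _ _ _ F P W Z x0 1 xi lZ sZ Wx0 (oner_neq0 _) xz.
rewrite scale1r; apply => l; rewrite scale1r; exact: xH.
Qed.

(** Along t |-> t eta the factors are cosh (t |eta|) and sinh (t |eta|) / |eta|; the
    absolute value in the norm of t eta disappears by parity. *)
Lemma PhiNM_vertical0 eta : hdot eta (Z x0) = 0 -> (forall l, Re (hdot eta (H l x0)) = 0) ->
  PhiNM_tangent F P x0 (Z x0) 0 (row_mx ('i%C *: eta) (cvec (- ('i%C *: eta)))).
Proof.
move=> ez eH.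
have st : csmooth_on (setT : set R) (fun t : R => t%:C) by apply: csmoothR; apply: smooth_id.
have sb : csmoothr_on (setT : set R) (fun t : R => t%:C *: eta).
  by apply: csmoothrZ => //; [exact: openT|exact: csmoothr_cst].
exists setT, (fun _ => x0), (fun _ => Z x0), (fun t : R => t%:C *: eta); split.
- by split => //; [exact: openT|rewrite scale0r].
- by split => //; [move=> k; apply: smooth_cst|exact: csmoothr_cst].
- move=> t _; split; first by case: lZ => _ WP _; apply: WP.
  apply: base_normal => [|l]; first by rewrite hdotZl ez mulr0.
  by rewrite (Re_hdotZl t) eH mulr0.
pose h := hnorm eta.
have z1 : hnorm (Z x0) = 1 by rewrite /hnorm zz sqrtr1.
have hE t : hnorm (t%:C *: eta) = `|t| * h by rewrite hnormZ /= expr0n addr0 sqrtr_sqr.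
pose g (t : R) := if h == 0 then t else sinh (0 + h * t) / h.
have gE t : sinhc (`|t| * h) * t = g t.
  rewrite /g add0r; case: eqVneq => [->|h0]; first by rewrite mulr0 /sinhc eqxx mul1r.
  rewrite sinhc_abs [h * t]mulrC; have [->|t0] := eqVneq t 0.
    by rewrite mulr0 mul0r /sinh oppr0 subrr !mul0r.
  by rewrite /sinhc mulf_eq0 (negPf t0) (negPf h0) /= -/(sinh (t * h)); field; rewrite t0 h0.
have E : (fun t : R => Phi (Z x0) (t%:C *: eta)) =
  (fun t : R => row_mx ((cosh (0 + h * t))%:C *: Z x0 + ('i%C * (g t)%:C) *: eta)
     (cvec ((cosh (0 + h * t))%:C *: Z x0 - ('i%C * (g t)%:C) *: eta))).
  apply/funext => t; rewrite (@Phi_ratio _ _ (Z x0) (t%:C *: eta) (`|t| * h)); last by rewrite hE z1 mulr1.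
    rewrite cosh_abs scalerA -mulrA -rmorphM /= gE add0r [h * t]mulrC.
    exact: erefl.
  by rewrite Z0.
have [dc Dc] := derive_cosh_affine 0 h 0; have [ds Ds] := derive_sinh_affine 0 h 0.
have dg : differentiable g 0.
  rewrite /g; case: eqVneq => h0; first by [].
  exact: differentiableM.
have Dg : 'D_1 g 0 = 1.
  rewrite /g; case: eqVneq => h0; first by rewrite derive_id.
  rewrite (@deriveM _ _ (fun t => sinh (0 + h * t)) (cst h^-1)); [|exact: diff_derivable|exact: derivable_cst].
  rewrite derive_cst scaler0 add0r Ds mulr0 addr0 /GRing.scale /= /cosh oppr0 expR0.
  by field.
rewrite E (cderiver_polar (Z x0) dc dg (cdiffr_cst eta 0)).
rewrite Dc Dg cderiver_cst mulr0 addr0 /sinh oppr0 subrr mul0r mulr0.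
have -> : g 0 = 0 by rewrite /g; case: eqVneq => // h0; rewrite mulr0 addr0 /sinh oppr0 subrr !mul0r.
have -> : (0 : R)%:C = 0 by [].
have -> : (1 : R)%:C = 1 by [].
by rewrite !scale0r scale1r addr0 add0r sub0r.
Qed.

(** A curve of normal vectors whose norm p t * mu is affine in t, moving at constant
    norm in the direction orthogonal to xi and radially along xi, so that cosh and
    sinh have explicit derivatives.  The remaining multiple r of the point itself
    does not affect determinants with radial rows. *)
Lemma PhiNM_vertical xi eta : hdot xi (Z x0) = 0 -> (forall l, Re (hdot xi (H l x0)) = 0) ->
  xi != 0 -> hdot eta (Z x0) = 0 -> (forall l, Re (hdot eta (H l x0)) = 0) ->
  let c := cosh (hnorm xi) in let s := sinhc (hnorm xi) in
  exists r : R, PhiNM_tangent F P x0 (Z x0) xi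
    (row_mx ('i%C *: eta + r%:C *: (c%:C *: Z x0 + ('i%C * s%:C) *: xi))
       (cvec (- ('i%C *: eta) + r%:C *: (c%:C *: Z x0 - ('i%C * s%:C) *: xi)))).
Proof.
move=> xz xH xn0 ez eH c s; set mu := hnorm xi in c s *.
have mu0 : 0 < mu by exact: hnorm_gt0.
have c0 : 0 < c by exact: cosh_gt0.
have s0 : 0 < s by exact: sinhc_gt0.
have cs : c ^+ 2 - (s * mu) ^+ 2 = 1 by exact: cosh_sinhc.
have xx : Re (hdot xi xi) = mu ^+ 2 by rewrite hnorm_sqr.
(* The component t0 xi of eta is radial and changes the norm; only the rest is scaled by s. *)
pose t0 := Re (hdot eta xi) / mu ^+ 2.
pose eta' : vec := (s^-1)%:C *: (eta - t0%:C *: xi).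
have ez' : hdot eta' (Z x0) = 0 by rewrite hdotZl hdotBl hdotZl ez xz mulr0 subr0 mulr0.
have eH' l : Re (hdot eta' (H l x0)) = 0.
  by rewrite (Re_hdotZl s^-1) hdotBl cReB (Re_hdotZl t0) eH xH mulr0 subr0 mulr0.
have ex' : Re (hdot eta' xi) = 0.
  by rewrite (Re_hdotZl s^-1) hdotBl cReB (Re_hdotZl t0) xx /t0 divfK ?subrr ?mulr0 // expf_neq0 // gt_eqF.
pose h2 := Re (hdot eta' eta').
have h20 : 0 <= h2 by rewrite /h2 -hnorm_sqr sqr_ge0.
pose q (t : R) := mu ^+ 2 + t * t * h2.
have q0 t : 0 < q t by rewrite /q ltr_pwDl ?exprn_gt0 // mulr_ge0 // -expr2 sqr_ge0.
pose m (t : R) := mu * (Num.sqrt (q t))^-1.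
have m0 t : 0 < m t by rewrite /m mulr_gt0 // invr_gt0 sqrtr_gt0.
pose u (t : R) : vec := (m t)%:C *: (xi + t%:C *: eta').
have uu t : Re (hdot (u t) (u t)) = mu ^+ 2.
  rewrite (Re_hdot_scale (m t)%:C) /= (expr0n _ 2) /= addr0.
  rewrite (Re_hdot_line t ex') -/h2 xx -/(q t) /m exprMn exprVn (sqr_sqrtr (ltW (q0 t))).
  by rewrite divfK // gt_eqF.
have u0 : u 0 = xi.
  rewrite /u scale0r addr0 /m /q !mul0r addr0 sqrtr_sqr gtr0_norm // mulfV ?scale1r //.
  by rewrite gt_eqF.
have hu t : hnorm (u t) = mu by rewrite /hnorm uu sqrtr_sqr gtr0_norm.
pose r0 := c * t0.
pose p (t : R) := 1 + r0 * t.
have sp : smooth_on setT p.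
  apply: smoothD; [exact: openT|exact: smooth_cst|].
  by apply: smoothM; [exact: openT|exact: smooth_cst|exact: smooth_id].
pose I := [set t | 0 < p t].
have oI : open I.
  apply: (@open_comp _ _ p [set y | 0 < y]); last exact: open_gt.
  by move=> t _; apply: differentiable_continuous; exact: smooth_diff sp (Logic.I : setT t).
have I0 : I 0 by rewrite /I /p /= mulr0 addr0.
have sm : smooth_on I m.
  apply: smoothM => //; first exact: smooth_cst.
  apply: smoothV => //; first by move=> t _; rewrite gt_eqF // sqrtr_gt0.
  apply: smooth_sqrt => //.
  apply: smoothD => //; first exact: smooth_cst.
  apply: smoothM => //; last exact: smooth_cst.
  by apply: smoothM => //; apply: smooth_id.
have su : csmoothr_on I u.
  apply: csmoothrZ => //; first exact: csmoothR.
  apply: csmoothrD => //; first exact: csmoothr_cst.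
  by apply: csmoothrZ => //; [apply: csmoothR; apply: smooth_id|exact: csmoothr_cst].
have cu : cdiffr u 0 by exact: csmoothr_cdiffr su I0.
have dm : differentiable m 0 by exact: smooth_diff sm I0.
have Du0 : cderiver u (0 : R) 1 = ('D_1 m 0)%:C *: xi + eta'.
  have m01 : m 0 = 1 by rewrite /m /q !mul0r addr0 sqrtr_sqr gtr0_norm // mulfV // gt_eqF.
  by rewrite (cderiver_arc xi eta' dm) m01 scale1r.
have Dm : 'D_1 m 0 = 0.
  have E : Re (cderive (fun t => hdot (u t) (u t)) (0 : R) 1) = 0.
    rewrite Re_cderive (_ : (fun t => Re (hdot (u t) (u t))) = cst (mu ^+ 2)) ?derive_cst //.
    by apply/funext => t; rewrite uu.
  move: E; rewrite cderive_hdot // u0 Du0 cReD [Re (hdot xi _)]Re_hdotC.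
  rewrite hdotDl cReD ex' (Re_hdotZl ('D_1 m 0)) xx addr0 -mulr2n => /eqP.
  by rewrite mulrn_eq0 /= mulf_eq0 sqrf_eq0 (gt_eqF mu0) orbF => /eqP.
have Du : cderiver u (0 : R) 1 = eta' by rewrite Du0 Dm scale0r add0r.
exists (mu * r0 * (s * mu) / c), I, (fun _ => x0), (fun _ => Z x0), (fun t => (p t)%:C *: u t).
split.
- by split => //; rewrite u0 /p mulr0 addr0 scale1r.
- split; [by move=> k; exact: smooth_cst|exact: csmoothr_cst|].
  by apply: csmoothrZ => //; apply: csmoothR; apply: smooth_sub sp.
- move=> t _; split; first by case: lZ => _ WP _; apply: WP.
  have uz : hdot (u t) (Z x0) = 0 by rewrite hdotZl hdotDl hdotZl xz ez' mulr0 addr0 mulr0.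
  apply: base_normal => [|l]; first by rewrite hdotZl uz mulr0.
  by rewrite (Re_hdotZl (p t)) (Re_hdotZl (m t)) hdotDl cReD (Re_hdotZl t) xH eH' mulr0 addr0 !mulr0.
have z1 : hnorm (Z x0) = 1 by rewrite /hnorm zz sqrtr1.
have E : {in I, (fun t : R => Phi (Z x0) ((p t)%:C *: u t)) =1
  (fun t : R => row_mx ((cosh (mu + mu * r0 * t))%:C *: Z x0 + ('i%C * (sinh (mu + mu * r0 * t) / mu)%:C) *: u t)
     (cvec ((cosh (mu + mu * r0 * t))%:C *: Z x0 - ('i%C * (sinh (mu + mu * r0 * t) / mu)%:C) *: u t)))}.
  move=> t; rewrite inE => It; have pt : 0 < p t by exact: It.
  rewrite (@Phi_ratio _ _ (Z x0) _ (p t * mu)); first last.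
  - by rewrite hnormZr ?ltW // hu z1 mulr1.
  - exact: Z0.
  have -> : p t * mu = mu + mu * r0 * t by rewrite /p; ring.
  have sE' : sinhc (mu + mu * r0 * t) * p t = sinh (mu + mu * r0 * t) / mu.
    have -> : mu + mu * r0 * t = p t * mu by rewrite /p; ring.
    rewrite sinhcE ?mulf_neq0 ?gt_eqF //.
    by field; rewrite !gt_eqF.
  by rewrite (scalerA _ (p t)%:C) -(mulrA 'i%C) -(rmorphM (real_complex R)) /= sE'.
have [dc Dc] := derive_cosh_affine mu (mu * r0) 0; have [ds Ds] := derive_sinh_affine mu (mu * r0) 0.
pose g (t : R) := sinh (mu + mu * r0 * t) / mu.
have dg : differentiable g 0 by exact: differentiableM.
have Dg : 'D_1 g 0 = r0 * c.
  rewrite (@deriveM _ _ (fun t => sinh (mu + mu * r0 * t)) (cst mu^-1)); [|exact: diff_derivable|exact: derivable_cst].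
  rewrite derive_cst scaler0 add0r Ds mulr0 addr0 /GRing.scale /= -/c.
  by field; rewrite gt_eqF.
have sE : sinh mu = s * mu by rewrite /s sinhcE ?gt_eqF // divfK // gt_eqF.
have g0 : g 0 = s by rewrite /g mulr0 addr0 sE mulfK // gt_eqF.
have cg := cderiver_polar (Z x0) dc dg cu.
rewrite (cderiver_on _ oI I0 E) cg Dc Dg Du g0 u0 mulr0 addr0 sE.
have key : 'i%C *: ((r0 * c)%:C *: xi + s%:C *: eta') =
   'i%C *: eta + (mu * r0 * (s * mu) / c)%:C *: (('i%C * s%:C) *: xi) :> vec.
  by apply: vertical_vec => //; exact: lt0r_neq0.
have rc : mu * r0 * (s * mu) = (mu * r0 * (s * mu) / c) * c by rewrite divfK // gt_eqF.
by rewrite key; exact: vertical_row rc.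
Qed.

End Fields.
End PhiNM.

(** * The pointwise consequence of austerity *)
Lemma det2 (K : comRingType) (A : 'M[K]_2) : \det A = A 0 0 * A 1 1 - A 0 1 * A 1 0.
Proof.
rewrite (expand_det_row _ 0) !big_ord_recl big_ord0 /= addr0 /cofactor.
have -> : lift ord0 ord0 = 1 :> 'I_2 by apply: val_inj.
rewrite !det_mx11 !mxE /= expr0 expr1 mul1r mulN1r mulrN.
by congr (A _ _ * A _ _ - A _ _ * A _ _); apply: val_inj.
Qed.

Section Polarization.
Context {R : realType}.
Implicit Types A B : 'I_2 -> 'I_2 -> R.

(** The polarization of the determinant of 2 x 2 matrices; if A is
    symmetric and invertible, mix A B = det A * tr (A^-1 B). *)
Definition mix A B : R := A 0 0 * B 1 1 + A 1 1 * B 0 0 - A 0 1 * B 1 0 - A 1 0 * B 0 1.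

Lemma Im_det2 A B :
  complex.Im (\det (\matrix_(j, l) (2 * ((A j l)%:C + 'i%C * (B j l)%:C)))) = 4 * mix A B.
Proof.
rewrite det2 !mxE /mix.
move: (A 0 0) (A 0 1) (A 1 0) (A 1 1) (B 0 0) (B 0 1) (B 1 0) (B 1 1) => a b c d e f g h.
have E (x y : R) : 2 * (x%:C + 'i%C * y%:C) = (2 * x) +i* (2 * y).
  rewrite two_complex; apply: complex_ext; rewrite ?cReM ?cImM ?cReD ?cImD ?cReM ?cImM /=; ring.
rewrite !E cImB !cImM /=; ring.
Qed.

(** The equation at xi and at 2 xi: the terms of degree 1 and 3 in xi separate, since
    (2 C - 1)^2 < 4 C^2 for C = cosh^2 mu, by the duplication formulas. *)
Lemma doubling (mu a b : R) : mu != 0 ->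
  cosh mu ^+ 2 * a + sinhc mu ^+ 2 * b = 0 ->
  cosh (2 * mu) ^+ 2 * (2 * a) + sinhc (2 * mu) ^+ 2 * (2 ^+ 3 * b) = 0 -> a = 0 /\ b = 0.
Proof.
move=> mu0; have mu20 : 2 * mu != 0 by rewrite mulf_neq0.
have s0 : sinhc mu != 0.
  rewrite sinhcE // /sinh !mulf_neq0 ?invr_eq0 // subr_eq0; apply: contra mu0 => /eqP /expR_inj.
  by move=> h; apply/eqP; lra.
have := cosh_sinhc mu.
rewrite !sinhcE // in s0 *; rewrite /cosh /sinh in s0 *.
have -> : expR (2 * mu) = expR mu ^+ 2 by rewrite mulrC expRM_natr.
have -> : expR (- (2 * mu)) = expR (- mu) ^+ 2 by rewrite -mulrN mulrC expRM_natr.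
have : expR mu * expR (- mu) = 1 by rewrite -expRD subrr expR0.
have : 0 < expR mu by exact: expR_gt0. have : 0 < expR (- mu) by exact: expR_gt0.
move: (expR mu) (expR (- mu)) s0 => e f s0 f0 e0 ef _.
set C2 := ((e + f) / 2) ^+ 2; set S := (e - f) / 2 / mu => E1.
have -> : ((e ^+ 2 + f ^+ 2) / 2) ^+ 2 = (2 * C2 - 1) ^+ 2.
  by rewrite /C2; congr (_ ^+ 2); rewrite -[X in _ - X]ef; field.
have -> : ((e ^+ 2 - f ^+ 2) / 2 / (2 * mu)) ^+ 2 = C2 * S ^+ 2.
  by rewrite /C2 /S; field.
move=> E2.
have C0 : C2 = 1 + (S * mu) ^+ 2.
  have -> : C2 = e * f + (S * mu) ^+ 2 by rewrite /C2 /S; field.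
  by rewrite ef.
have a0 : a = 0.
  have : ((2 * C2 - 1) ^+ 2 - 4 * C2 ^+ 2) * a = 0.
    apply: (mulfI (_ : (2 : R) != 0)) => //; rewrite mulr0 -[RHS]E2.
    have -> : C2 * S ^+ 2 * (2 ^+ 3 * b) = 8 * C2 * (S ^+ 2 * b) by ring.
    have -> : S ^+ 2 * b = - (C2 * a) by lra.
    by ring.
  have -> : (2 * C2 - 1) ^+ 2 - 4 * C2 ^+ 2 = - (4 * C2 - 1) by ring.
  move/eqP; rewrite mulf_eq0 oppr_eq0 => /orP[|/eqP //].
  have := sqr_ge0 (S * mu); rewrite C0 => h /eqP h'; lra.
split=> //; move: E1; rewrite a0 mulr0 add0r => /eqP.
by rewrite mulf_eq0 expf_eq0 /= (negPf s0) => /eqP.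
Qed.

Lemma Im_phase (u : R[i]) (y : R[i]) : u != 0 -> complex.Im u = 0 -> complex.Im (u * y) = 0 ->
  complex.Im y = 0.
Proof.
move=> u0 Iu; rewrite cImM Iu mul0r addr0 => /eqP; rewrite mulf_eq0 => /orP[|/eqP //] Ru.
by case/eqP: u0; apply: complex_ext => //; apply/eqP.
Qed.

Lemma mixZr A B (k : R) : mix A (fun j l => k * B j l) = k * mix A B.
Proof. by rewrite /mix; ring. Qed.

Lemma mix0 A B : (forall j l, B j l = 0) -> mix A B = 0.
Proof. by move=> B0; rewrite /mix !B0 !mulr0 !subr0 addr0. Qed.

Lemma det_real_frame A : \det (\matrix_(j, l) (2 * (A j l)%:C)) = (4 * (A 0 0 * A 1 1 - A 0 1 * A 1 0))%:C :> R[i].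
Proof. by rewrite det2 !mxE rmorphM rmorphB !rmorphM /= rmorph_nat; ring. Qed.

Lemma unit_quadric (c s h : R) : c ^+ 2 - (s * h) ^+ 2 = 1 ->
  c%:C * c%:C - 'i%C * s%:C * (- 'i%C * s%:C * (h ^+ 2)%:C) = 1 :> R[i].
Proof.
move=> E; transitivity (c ^+ 2 - (s * h) ^+ 2)%:C; last by rewrite E.
rewrite rmorphB !rmorphXn rmorphM /=.
move: c%:C s%:C h%:C => {E} c' s' h'.
have := @imag_sqr R; move: 'i%C => ii E.
transitivity (c' ^+ 2 + ii * ii * (s' * h') ^+ 2); first by ring.
by rewrite E; ring.
Qed.

Lemma sinhc_neq0 (x : R) : 0 <= x -> sinhc x != 0.
Proof.
rewrite le_eqVlt => /orP[/eqP <-|/sinhc_gt0/lt0r_neq0 //].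
by rewrite /sinhc eqxx oner_neq0.
Qed.

Lemma mix_frame (c s : R) (g b h : 'I_2 -> 'I_2 -> R) : c != 0 -> s != 0 ->
  mix (fun j l => c * g j l + s ^+ 2 / c * b j l) (fun j l => - s * h j l) = 0 ->
  c ^+ 2 * mix g h + s ^+ 2 * mix b h = 0.
Proof.
move=> c0 s0 E; apply: (mulfI (_ : - s / c != 0)); first by rewrite mulf_neq0 ?invr_eq0 ?oppr_eq0.
rewrite mulr0 -E /mix.
move: (g 0 0) (g 0 1) (g 1 0) (g 1 1) => g0 g1 g2 g3.
move: (h 0 0) (h 0 1) (h 1 0) (h 1 1) (b 0 0) (b 0 1) (b 1 0) (b 1 1) => *.
by field.
Qed.

(** Here q and r are the second fundamental form on the normal vectors on which the
    Kaehler pairing with the frame is (1, 0) and (0, 1). *)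
Lemma dual_sff0 (g0 g1 g2 q0 q1 q2 r0 r1 r2 : R) : g0 * g2 - g1 ^+ 2 != 0 ->
  g0 * q2 + g2 * q0 - g1 * q1 - g1 * q1 = 0 -> g0 * r2 + g2 * r0 - g1 * r1 - g1 * r1 = 0 ->
  q2 = 0 -> r0 = 0 ->
  (q2 + r2) + (q0 + r0) - (q1 + r1) - (q1 + r1) = 0 ->
  (q2 - r2) + (q0 - r0) + (q1 - r1) + (q1 - r1) = 0 ->
  [/\ q0 = 0, q1 = 0, r1 = 0 & r2 = 0].
Proof.
move=> d0 tq tr q20 r00 s1 s2; rewrite q20 in tq s1 s2; rewrite r00 in tr s1 s2.
have qE : q0 = 2 * r1 by lra.
have rE : r2 = 2 * q1 by lra.
have e1 : g2 * r1 = g1 * q1.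
  have -> : g2 * r1 = 2^-1 * (g0 * 0 + g2 * q0 - g1 * q1 - g1 * q1) + g1 * q1 by rewrite qE; field.
  by rewrite tq; ring.
have e2 : g0 * q1 = g1 * r1.
  have -> : g0 * q1 = 2^-1 * (g0 * r2 + g2 * 0 - g1 * r1 - g1 * r1) + g1 * r1 by rewrite rE; field.
  by rewrite tr; ring.
have q10 : q1 = 0.
  apply: (mulfI d0); rewrite mulr0 mulrBl -mulrA [g2 * q1]mulrC mulrA e2 -mulrA [r1 * g2]mulrC e1.
  by ring.
have r10 : r1 = 0.
  apply: (mulfI d0); rewrite mulr0 mulrBl -mulrA e1 q10; have := e2; rewrite q10 mulr0 => /esym e3.
  by rewrite expr2 -mulrA e3 !mulr0 subr0.
by rewrite qE rE q10 r10 mulr0.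
Qed.

Lemma four_det (a b c d : R) : c = b -> a * d - b ^+ 2 != 0 -> 4 * (a * d - b * c) != 0.
Proof. by move=> ->; rewrite -expr2 => h; rewrite mulf_neq0. Qed.

Lemma Re_sym (a b p q x y : R[i]) : x = p - (a + b) -> y = q - (b + a) -> p = q ->
  complex.Re x = complex.Re y.
Proof. by move=> -> -> ->; rewrite [a + b]addrC. Qed.

Lemma phase_factor (D D0 G K u : R[i]) (c k : R) : D0 * u = k%:C * K ->
  D * u = c%:C ^+ 2 * (G * K) -> u != 0 -> k != 0 -> D = (c ^+ 2 / k)%:C * D0 * G.
Proof.
move=> E0 E u0 k0; apply: (mulIf u0); rewrite E.
have -> : (c ^+ 2 / k)%:C * D0 * G * u = (c ^+ 2 / k)%:C * G * (D0 * u) by ring.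
rewrite E0 -rmorphXn -[in LHS](divfK k0 (c ^+ 2)) [in LHS]rmorphM /=.
by ring.
Qed.

Lemma phase_neq0 (t : R) : cos t +i* sin t != 0.
Proof.
apply/eqP => -[c0 s0]; have := cos2Dsin2 t; rewrite c0 s0 expr0n addr0 => /esym/eqP.
by rewrite oner_eq0.
Qed.

Lemma mix_cube (k : 'I_2 -> R) (h : 'I_2 -> 'I_2 -> R) :
  mix (fun j l => (2 * k j) * (2 * k l)) (fun j l => 2 * h j l) = 2 ^+ 3 * mix (fun j l => k j * k l) h.
Proof. by rewrite /mix; ring. Qed.

(** On the real vector space N of normals, k is the Kaehler pairing with the tangent
    frame and h the second fundamental form.  The equation mix (k k) h = 0 is cubic in
    the normal; its polarization, on normals for which k is prescribed, first gives
    h on the two dual normals and then, by adding these to x, h on x itself. *)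
Lemma mix_sff0 (T : Type) (comb : T -> R -> T -> T) (N : T -> Prop)
    (h : T -> 'I_2 -> 'I_2 -> R) (k : T -> 'I_2 -> R) (g : 'I_2 -> 'I_2 -> R) :
  (forall x a y, N x -> N y -> N (comb x a y)) ->
  (forall x a y j l, h (comb x a y) j l = h x j l + a * h y j l) ->
  (forall x a y j, k (comb x a y) j = k x j + a * k y j) ->
  g 0 1 = g 1 0 -> g 0 0 * g 1 1 - g 0 1 ^+ 2 != 0 ->
  (forall x, N x -> h x 0 1 = h x 1 0) ->
  (forall x, N x -> mix g (h x) = 0 /\ mix (fun j l => k x j * k x l) (h x) = 0) ->
  (forall p q, exists x, [/\ N x, k x 0 = p & k x 1 = q]) ->
  forall x j l, N x -> h x j l = 0.
Proof.
move=> NC hC kC gC d0 hs hm onto x j l.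
have [E1 [N1 k11 k12]] := onto 1 0.
have [E2 [N2 k21 k22]] := onto 0 1.
have mix1 y : N y -> g 0 0 * h y 1 1 + g 1 1 * h y 0 0 - g 0 1 * h y 0 1 - g 0 1 * h y 0 1 = 0.
  by move=> Ny; have [<- _] := hm y Ny; rewrite /mix -gC -(hs y Ny).
have mix2 y : N y -> k y 0 ^+ 2 * h y 1 1 + k y 1 ^+ 2 * h y 0 0
   - k y 0 * k y 1 * h y 0 1 - k y 0 * k y 1 * h y 0 1 = 0.
  by move=> Ny; have [_ <-] := hm y Ny; rewrite /mix -(hs y Ny); ring.
have q2 : h E1 1 1 = 0 by have := mix2 _ N1; rewrite k11 k12 !expr2; lra.
have r0 : h E2 0 0 = 0 by have := mix2 _ N2; rewrite k21 k22 !expr2; lra.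
have s1 := mix2 _ (NC E1 1 E2 N1 N2); have s2 := mix2 _ (NC E1 (-1) E2 N1 N2).
rewrite !kC !hC k11 k12 k21 k22 !expr2 in s1 s2.
have [||q0 q1 r1 r2] := dual_sff0 d0 (mix1 _ N1) (mix1 _ N2) q2 r0; [by lra|by lra|].
move=> Nx.
have shift p q : p ^+ 2 * h x 1 1 + q ^+ 2 * h x 0 0 - p * q * h x 0 1 - p * q * h x 0 1 = 0.
  have := mix2 _ (NC (comb x (p - k x 0) E1) (q - k x 1) E2 (NC _ _ _ Nx N1) N2).
  rewrite !kC !hC k11 k12 k21 k22 q0 q1 q2 r0 r1 r2.
  by move=> E; rewrite -[RHS]E; ring.
have h1 := shift 1 0; have h0 := shift 0 1; have h01 := shift 1 1.
rewrite !expr2 in h1 h0 h01.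
have [->|->] := ord2_cases j; have [->|->] := ord2_cases l; rewrite -?(hs x Nx); lra.
Qed.

End Polarization.

Section Rotation.
Context {R : realType} {n : nat}.
Local Notation Re := complex.Re.
Local Notation Im := complex.Im.
Implicit Types (x y z v : 'rV[R[i]]_n) (d a b : R).

Lemma hdot_comb0 a b x y v : hdot x v = 0 -> hdot y v = 0 -> hdot (a%:C *: x + b%:C *: y) v = 0.
Proof. by move=> hx hy; rewrite hdotDl (hdotZl a%:C x) (hdotZl b%:C y) hx hy !mulr0 addr0. Qed.

Lemma Re_hdot_comb2 a b x y v :
  Re (hdot (a%:C *: x + b%:C *: y) v) = a * Re (hdot x v) + b * Re (hdot y v).
Proof. by rewrite hdotDl cReD (Re_hdotZl a) (Re_hdotZl b). Qed.

Lemma Im_hdot_comb2 a b x y v :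
  Im (hdot (a%:C *: x + b%:C *: y) v) = a * Im (hdot x v) + b * Im (hdot y v).
Proof. by rewrite hdotDl cImD (Im_hdotZl a) (Im_hdotZl b). Qed.

Lemma rot_orth d a b x y z v : hdot x v = 0 -> hdot y v = 0 -> hdot z v = 0 ->
  hdot ('i%C *: (d%:C *: x) + (a%:C *: y - b%:C *: z)) v = 0.
Proof.
move=> hx hy hz; rewrite hdotDl hdotZl hdotZl hx hdotBl (hdotZl a%:C) hy (hdotZl b%:C) hz.
by rewrite !mulr0 subrr addr0.
Qed.

Lemma Re_rot d a b x y z v :
  Re (hdot ('i%C *: (d%:C *: x) + (a%:C *: y - b%:C *: z)) v) =
  - d * Im (hdot x v) + (a * Re (hdot y v) - b * Re (hdot z v)).
Proof.
rewrite hdotDl cReD hdotBl cReB (Re_hdotZl a) (Re_hdotZl b) (hdotZl 'i%C) (hdotZl d%:C).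
by rewrite cReM (Im_realM d) /= mul0r mul1r sub0r mulNr.
Qed.

Lemma Im_rot d a b x y z v :
  Im (hdot ('i%C *: (d%:C *: x) + (a%:C *: y - b%:C *: z)) v) =
  d * Re (hdot x v) + (a * Im (hdot y v) - b * Im (hdot z v)).
Proof.
rewrite hdotDl cImD hdotBl cImB (Im_hdotZl a) (Im_hdotZl b) (hdotZl 'i%C) (hdotZl d%:C).
by rewrite cImM (Re_realM d) /= mul0r mul1r add0r.
Qed.

Lemma det_gram (e : 'I_2 -> 'rV[R[i]]_n) : \det (\matrix_(j, l) Re (hdot (e j) (e l))) =
  Re (hdot (e 0) (e 0)) * Re (hdot (e 1) (e 1)) - Re (hdot (e 0) (e 1)) ^+ 2.
Proof. by rewrite det2 !mxE (Re_hdotC (e 0) (e 1)). Qed.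

Lemma dual_onto (F1 F2 e0 e1 z : 'rV[R[i]]_n) (g0 g1 g2 k p q : R) :
  hdot F1 z = 0 -> hdot F2 z = 0 ->
  Re (hdot F1 e0) = 0 -> Re (hdot F1 e1) = 0 -> Re (hdot F2 e0) = 0 -> Re (hdot F2 e1) = 0 ->
  Im (hdot F1 e0) = k * g0 -> Im (hdot F1 e1) = k * g1 ->
  Im (hdot F2 e0) = k * g1 -> Im (hdot F2 e1) = k * g2 -> k != 0 -> g0 * g2 - g1 ^+ 2 != 0 ->
  exists xi, [/\ hdot xi z = 0, Re (hdot xi e0) = 0, Re (hdot xi e1) = 0,
    Im (hdot xi e0) = p & Im (hdot xi e1) = q].
Proof.
move=> Z1 Z2 R10 R11 R20 R21 I10 I11 I20 I21 k0 d0.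
exists (((g2 * p - g1 * q) / ((g0 * g2 - g1 ^+ 2) * k))%:C *: F1 +
        ((g0 * q - g1 * p) / ((g0 * g2 - g1 ^+ 2) * k))%:C *: F2); split.
- exact: hdot_comb0.
- by rewrite Re_hdot_comb2 R10 R20 !mulr0 addr0.
- by rewrite Re_hdot_comb2 R11 R21 !mulr0 addr0.
- by rewrite Im_hdot_comb2 I10 I20; field; rewrite d0 k0.
by rewrite Im_hdot_comb2 I11 I21; field; rewrite d0 k0.
Qed.

(** The vectors i e0 and i e1, made orthogonal to the plane of e0 and e1, pair with e0
    and e1 through a multiple of (d - w^2) g, where d = det g.  This vanishes only if
    the plane is complex. *)
Lemma rot_onto (e0 e1 z : 'rV[R[i]]_n) (g0 g1 g2 w p q : R) :
  hdot e0 z = 0 -> hdot e1 z = 0 -> Re (hdot e0 e0) = g0 -> Re (hdot e0 e1) = g1 ->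
  Re (hdot e1 e1) = g2 -> Im (hdot e0 e1) = w -> g0 * g2 - g1 ^+ 2 != 0 ->
  w ^+ 2 != g0 * g2 - g1 ^+ 2 ->
  exists xi, [/\ hdot xi z = 0, Re (hdot xi e0) = 0, Re (hdot xi e1) = 0,
    Im (hdot xi e0) = p & Im (hdot xi e1) = q].
Proof.
move=> z0 z1 G0 G1 G2 Hw d0 dw.
have k0 : g0 * g2 - g1 ^+ 2 - w ^+ 2 != 0 by rewrite subr_eq0 eq_sym.
have G1' : Re (hdot e1 e0) = g1 by rewrite -(Re_hdotC e1 e0).
have Hw' : Im (hdot e1 e0) = - w by rewrite -Hw -(Im_hdotC e0 e1).
have I0 := Im_hdotxx e0; have I1 := Im_hdotxx e1.
have [d dE] : exists d, d = g0 * g2 - g1 ^+ 2 by exists (g0 * g2 - g1 ^+ 2).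
apply: (@dual_onto ('i%C *: (d%:C *: e0) + ((w * g0)%:C *: e1 - (w * g1)%:C *: e0))
   ('i%C *: (d%:C *: e1) + ((w * g1)%:C *: e1 - (w * g2)%:C *: e0)) e0 e1 z g0 g1 g2
   (g0 * g2 - g1 ^+ 2 - w ^+ 2) p q _ _ _ _ _ _ _ _ _ _ k0 d0).
- exact: (rot_orth _ _ _ z0 z1 z0).
- exact: (rot_orth _ _ _ z1 z1 z0).
- by rewrite Re_rot I0 G1' G0; ring.
- by rewrite Re_rot Hw G2 G1 dE; ring.
- by rewrite Re_rot Hw' G1' G0 dE; ring.
- by rewrite Re_rot I1 G2 G1; ring.
- by rewrite Im_rot G0 Hw' I0 dE; ring.
- by rewrite Im_rot G1 I1 Hw dE; ring.
- by rewrite Im_rot G1' Hw' I0 dE; ring.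
by rewrite Im_rot G2 I1 Hw dE; ring.
Qed.

Lemma hdot_sff (xi a z zj zl : 'rV[R[i]]_n) (da al aj : R[i]) : hdot xi z = 0 ->
  hdot xi (a - (da *: z + al *: zj) - aj *: (zl - al *: z)) =
  hdot xi a - (al^*%C * hdot xi zj + aj^*%C * hdot xi zl).
Proof.
move=> xz; rewrite hdotBr hdotBr hdotDr (hdotZr da) (hdotZr al) (hdotZr aj) hdotBr (hdotZr al xi z).
by rewrite xz; ring.
Qed.
End Rotation.

Section Pointwise.
Context {R : realType} {M : topologicalType} {m : nat}.
Variable F : M -> CP R m.+1.
Local Notation C := R[i].
Local Notation Re := complex.Re.
Local Notation Im := complex.Im.
Local Notation vec := 'rV[C]_m.+2.
Variables (P : param R M) (W : set 'rV[R]_2) (Z : 'rV[R]_2 -> vec) (x0 : 'rV[R]_2).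
Hypotheses (lZ : lifts F P W Z) (sZ : csmoothr_on W Z) (Wx0 : W x0).
Hypothesis zz : hdot (Z x0) (Z x0) = 1.
Hypothesis gram0 : forall x, W x -> gram Z x != 0.
Variable phi : R.
Hypothesis calib : forall xi, normal_vector F P x0 (Z x0) xi ->
  forall X : 'I_(m.+1 + m.+1) -> 'rV[C]_(m.+2 + m.+2),
       (forall k, PhiNM_tangent F P x0 (Z x0) xi (X k)) ->
       forall i j : 'I_m.+2,
         lsubmx (Phi (Z x0) xi) 0 i != 0 -> rsubmx (Phi (Z x0) xi) 0 j != 0 ->
         complex.Im ((cos phi +i* sin phi) * Theta i j (Phi (Z x0) xi) X) = 0.

Let e (l : 'I_2) : vec := Hf Z (delta_mx 0 l) x0.
Let Z0 : Z x0 != 0. Proof. exact: lifts_neq0 lZ Wx0. Qed.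
Let ez l : hdot (e l) (Z x0) = 0.
Proof. by apply: (H_orth lZ l Wx0). Qed.

Definition is_normal (xi : vec) := hdot xi (Z x0) = 0 /\ forall l, Re (hdot xi (e l)) = 0.

Definition sffn (xi : vec) (j l : 'I_2) : R := Re (hdot xi (sff Z x0 j l)).
Definition kahler (xi : vec) (j : 'I_2) : R := Im (hdot xi (e j)).

Lemma PhiNM_vertical_all xi eta : is_normal xi -> is_normal eta ->
  let c := cosh (hnorm xi) in let s := sinhc (hnorm xi) in
  exists r : R, PhiNM_tangent F P x0 (Z x0) xi
    (row_mx ('i%C *: eta + r%:C *: (c%:C *: Z x0 + ('i%C * s%:C) *: xi))
       (cvec (- ('i%C *: eta) + r%:C *: (c%:C *: Z x0 - ('i%C * s%:C) *: xi)))).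
Proof.
move=> [xz xe] [hz he]; have [->|xi0] := eqVneq xi 0.
  move=> c s; exists 0; have -> : (0 : R)%:C = 0 by [].
  by rewrite !scale0r !addr0; apply: (PhiNM_vertical0 lZ sZ Wx0 zz).
by apply: (PhiNM_vertical lZ sZ Wx0 zz).
Qed.

Lemma Phi_unit xi : is_normal xi ->
  let z := (cosh (hnorm xi))%:C *: Z x0 + ('i%C * (sinhc (hnorm xi))%:C) *: xi in
  let w := (cosh (hnorm xi))%:C *: Z x0 - ('i%C * (sinhc (hnorm xi))%:C) *: xi in
  Phi (Z x0) xi = row_mx z (cvec w) /\ bilin z (cvec w) = 1.
Proof.
move=> [xz xe] z w; have z1 : hnorm (Z x0) = 1 by rewrite /hnorm zz sqrtr1.
split; first by apply: Phi_ratio => //; rewrite z1 mulr1.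
have -> : bilin z (cvec w) = hdot z w.
  transitivity (\sum_j z 0 j * (w 0 j)^*%C); last by [].
  by apply: eq_bigr => k _; rewrite [cvec w 0 k]mxE.
have zx : hdot (Z x0) xi = 0 by rewrite hdotC xz conjc0.
rewrite /z /w hdotDl !hdotBr !hdotZl !hdotZr zz xz zx (hdotxx_real xi) -hnorm_sqr.
rewrite !conjcM !conjcR conj_i !mulr0 subr0 sub0r mulr1.
by apply: unit_quadric; exact: cosh_sinhc.
Qed.

Definition phase_mx xi : 'M[R]_2 := \matrix_(j, l)
  (cosh (hnorm xi) * Re (hdot (e j) (e l)) + sinhc (hnorm xi) ^+ 2 / cosh (hnorm xi) * (kahler xi j * kahler xi l)).

(** D is the determinant of the rows z, w and a basis of tangent vectors at
    Phi (Z x0, xi), hence Theta on this basis up to sign, because z.w = 1 there. *)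
Lemma Im_phase_det (eta : 'I_(m + m) -> vec) : (forall k, is_normal (eta k)) ->
  forall xi, is_normal xi ->
  exists D : C, Im ((cos phi +i* sin phi) * D) = 0 /\
   D * dual_det (Z x0) (glue e eta) =
  (cosh (hnorm xi))%:C ^+ 2 * (\det (\matrix_(j, l) (2 * ((phase_mx xi j l)%:C +
         'i%C * (- (sinhc (hnorm xi)) * sffn xi j l)%:C)))
   * \det (\matrix_(k, l) (2 * 'i%C * (Re (hdot (eta k) (eta l)))%:C))).
Proof.
move=> Ne xi Nx; have [xz xe] := Nx.
have /choice [b Hb] : forall j, exists b' : vec, [/\ PhiNM_tangent F P x0 (Z x0) xi
     (row_mx ((cosh (hnorm xi))%:C *: e j + ('i%C * (sinhc (hnorm xi))%:C) *: b')
       (cvec ((cosh (hnorm xi))%:C *: e j - ('i%C * (sinhc (hnorm xi))%:C) *: b'))),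
   hdot b' (Z x0) = - hdot xi (e j) &
   forall l, Re (hdot b' (e l)) = - sffn xi j l].
  by move=> j; exact: (PhiNM_horizontal lZ sZ Wx0 zz gram0 xz xe j).
have /choice [r Hr] := fun k => PhiNM_vertical_all Nx (Ne k).
have [PhiE bE] := Phi_unit Nx.
set c := cosh (hnorm xi) in Hb Hr PhiE bE *; set s := sinhc (hnorm xi) in Hb Hr PhiE bE *.
set z := c%:C *: Z x0 + ('i%C * s%:C) *: xi in Hr PhiE bE.
set w := c%:C *: Z x0 - ('i%C * s%:C) *: xi in Hr PhiE bE.
have c0 : c != 0 by rewrite gt_eqF // cosh_gt0.
pose X := glue
     (fun j => row_mx (c%:C *: e j + ('i%C * s%:C) *: b j) (cvec (c%:C *: e j - ('i%C * s%:C) *: b j)))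
     (fun k => row_mx ('i%C *: eta k + (r k)%:C *: z) (cvec (- ('i%C *: eta k) + (r k)%:C *: w))).
have HX k : PhiNM_tangent F P x0 (Z x0) xi (X k).
  by rewrite /X /glue; case: (fintype.split _) => l; [case: (Hb l)|exact: Hr].
have NV : normal_vector F P x0 (Z x0) xi by apply: (base_normal lZ sZ Wx0).
have := calib NV HX; rewrite PhiE row_mxKl row_mxKr => cal.
have nz (y : vec) : y != 0 -> exists i, y 0 i != 0.
  move=> y0; apply: contrapT => h; case/eqP: y0; apply/rowP => i; rewrite mxE.
  by apply: contrapT => /eqP h'; apply: h; exists i.
have z0 : z != 0.
  apply: contra_eq_neq bE => ->; rewrite /bilin big1 => [|j _]; last by rewrite [X in X * _]mxE mul0r.
  by rewrite eq_sym oner_neq0.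
have w0 : cvec w != 0.
  apply: contra_eq_neq bE => ->; rewrite /bilin big1 => [|j _]; last by rewrite [X in _ * X]mxE mulr0.
  by rewrite eq_sym oner_neq0.
have [i zi] := nz _ z0; have [j wj] := nz _ w0.
have TR := @Theta_rows _ _ i j (row_mx z (cvec w)) X; rewrite row_mxKl row_mxKr in TR.
have [t E] := TR zi wj.
exists (\det (rows_sq z (cvec w) X)); split.
  have := cal i j zi wj; rewrite E bE expr1n invr1 mulr1 mulrCA -signr_odd.
  by case: (odd t); rewrite ?expr0 ?expr1 ?mul1r // mulN1r cImN => /eqP; rewrite oppr_eq0 => /eqP.
have := @rows_phase _ _ (Z x0) xi e b eta c s r c0 zz xz ez (fun k => (Ne k).1) (fun k => (Ne k).2)
  (fun j => let: And3 _ h _ := Hb j in h) xe.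
rewrite -/z -/w -/X => ->; congr (_ * (\det _ * _)).
apply/matrixP => p q; rewrite !mxE; have [_ _ ->] := Hb p.
by rewrite mulrN mulNr /kahler.
Qed.

Let g j l := metric Z x0 j l.
Let gC j l : g j l = g l j. Proof. exact: metricC. Qed.
Let d0 : g 0 0 * g 1 1 - g 0 1 ^+ 2 != 0. Proof. exact: gram0 Wx0. Qed.

Lemma is_normal0 : is_normal 0.
Proof. by split=> [|l]; rewrite hdot0l. Qed.

Lemma is_normalD xi eta : is_normal xi -> is_normal eta -> is_normal (xi + eta).
Proof.
move=> [xz xe] [hz he]; split=> [|l]; first by rewrite hdotDl xz hz addr0.
by rewrite hdotDl cReD xe he addr0.
Qed.

Lemma is_normalZ (k : R) xi : is_normal xi -> is_normal (k%:C *: xi).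
Proof.
move=> [xz xe]; split=> [|l]; first by rewrite hdotZl xz mulr0.
by rewrite (Re_hdotZl k) xe mulr0.
Qed.

Lemma sffnD xi eta j l : sffn (xi + eta) j l = sffn xi j l + sffn eta j l.
Proof. by rewrite /sffn hdotDl cReD. Qed.

Lemma sffnZ (k : R) xi j l : sffn (k%:C *: xi) j l = k * sffn xi j l.
Proof. by rewrite /sffn (Re_hdotZl k). Qed.

Lemma kahlerD xi eta j : kahler (xi + eta) j = kahler xi j + kahler eta j.
Proof. by rewrite /kahler hdotDl cImD. Qed.

Lemma kahlerZ (k : R) xi j : kahler (k%:C *: xi) j = k * kahler xi j.
Proof. by rewrite /kahler (Im_hdotZl k). Qed.

(** The constant phase is read off on the zero section, where the determinant of
    [rows_phase] is that of the real metric; relative to it, the phase at xi is that of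
    the horizontal block. *)
Lemma calibrated_mix xi : is_normal xi ->
  cosh (hnorm xi) ^+ 2 * mix g (sffn xi) +
  sinhc (hnorm xi) ^+ 2 * mix (fun j l => kahler xi j * kahler xi l) (sffn xi) = 0.
Proof.
move=> Nx.
have gm : \det (\matrix_(j, l) Re (hdot (e j) (e l))) != 0.
  by rewrite det_gram; exact: d0.
have [eta [hz he G0]] := normal_basis Z0 ez gm.
have Ne k : is_normal (eta k) by split.
have [D0 [I0 E0]] := Im_phase_det Ne is_normal0.
have [D [I1 E1]] := Im_phase_det Ne Nx.
set K := \det (\matrix_(k, l) (2 * 'i%C * _)) in E0 E1.
have K0 : K != 0.
  have -> : K = \det ((2 * 'i%C) *: map_mx (real_complex R) (\matrix_(k, l) Re (hdot (eta k) (eta l)))).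
    by congr (\det _); apply/matrixP => k l; rewrite !mxE.
  rewrite detZ det_map_mx mulf_neq0 ?fmorph_eq0 // expf_neq0 // mulf_neq0 ?pnatr_eq0 //.
  apply/eqP => i0; have := @imag_sqr R; rewrite i0 mul0r => /esym/eqP.
  by rewrite oppr_eq0 oner_eq0.
set c := cosh (hnorm xi) in E1 *; set s := sinhc (hnorm xi) in E1 *.
have c0 : c != 0 by rewrite gt_eqF // cosh_gt0.
have s0 : s != 0 by apply: sinhc_neq0; exact: hnorm_ge0.
set G := \det (\matrix_(j, l) (2 * ((phase_mx xi j l)%:C + _))) in E1.
pose G1 : R := 4 * (g 0 0 * g 1 1 - g 0 1 * g 1 0).
have G10 : G1 != 0 by exact: four_det (gC 1 0) d0.
have hn0 : hnorm (0 : vec) = 0 by rewrite /hnorm hdot0l sqrtr0.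
have c1 : cosh (0 : R) = 1 by rewrite /cosh oppr0 expR0 -mulr2n divff.
have E0' : D0 * dual_det (Z x0) (glue e eta) = G1%:C * K.
  rewrite E0 hn0 c1 expr1n mul1r -det_real_frame; congr (\det _ * _).
  have k0 j : kahler 0 j = 0 by rewrite /kahler hdot0l.
  have h0 j l : sffn 0 j l = 0 by rewrite /sffn hdot0l.
  have f0 j l : phase_mx 0 j l = g j l by rewrite mxE hn0 c1 k0 mul0r mulr0 addr0 mul1r.
  apply/matrixP => j l; rewrite mxE [RHS]mxE f0 h0 mulr0.
  by rewrite (_ : (0 : R)%:C = 0) // mulr0 addr0.
set dd := dual_det _ _ in E0' E1.
have dd0 : dd != 0.
  apply/eqP => h; move: E0'; rewrite h mulr0 => /esym/eqP.
  by rewrite mulf_eq0 (negPf K0) orbF fmorph_eq0 (negPf G10).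
have D00 : D0 != 0.
  apply/eqP => h; move: E0'; rewrite h mul0r => /esym/eqP.
  by rewrite mulf_eq0 (negPf K0) orbF fmorph_eq0 (negPf G10).
have DE : D = (c ^+ 2 / G1)%:C * D0 * G by exact: phase_factor E0' E1 dd0 G10.
have ph0 := phase_neq0 phi.
have IG : Im G = 0.
  apply: (@Im_phase _ ((c ^+ 2 / G1)%:C * ((cos phi +i* sin phi) * D0))).
  - by rewrite !mulf_neq0 // fmorph_eq0 mulf_neq0 ?invr_eq0 // expf_neq0.
  - by rewrite Im_realM I0 mulr0.
  - by rewrite -I1 DE; congr (Im _); ring.
apply: mix_frame => //; apply: (mulfI (_ : (4 : R) != 0)); first by rewrite pnatr_eq0.
rewrite mulr0 -[RHS]IG -Im_det2; congr (Im (\det _)).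
by apply/matrixP => j l; rewrite !mxE.
Qed.

(** The second fundamental form is trace free in each normal direction, and it
    vanishes on the tangent vector that has pairing 0 with xi. *)
Lemma austere_mix xi : is_normal xi -> mix g (sffn xi) = 0 /\
  mix (fun j l => kahler xi j * kahler xi l) (sffn xi) = 0.
Proof.
move=> Nx; have [x0'|xn0] := eqVneq xi 0.
  have z j l : sffn xi j l = 0 by rewrite x0' /sffn hdot0l.
  by rewrite !(@mix0 _ _ (sffn xi)).
apply: (@doubling _ (hnorm xi)); [|exact: calibrated_mix|].
  by rewrite gt_eqF // hnorm_gt0.
have := calibrated_mix (is_normalZ 2 Nx); rewrite hnormZr //.
have -> : sffn (2%:C *: xi) = (fun j l => 2 * sffn xi j l).
  by apply/funext => j; apply/funext => l; apply: sffnZ.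
have -> : kahler (2%:C *: xi) = (fun j => 2 * kahler xi j).
  by apply/funext => j; apply: kahlerZ.
by rewrite mixZr mix_cube.
Qed.

(** By the symmetry of second derivatives. *)
Lemma sff_sym xi : is_normal xi -> sffn xi 0 1 = sffn xi 1 0.
Proof.
move=> [xz _]; have oW : open W by case: lZ.
have Z0' y : W y -> Z y != 0 by exact: lifts_neq0 lZ.
have cZ : cdiffr Z x0 by exact: csmoothr_cdiffr sZ Wx0.
have sD v := csmoothr_deriver v sZ; have sa v := csmooth_conn oW sZ Z0' v.
have cD v : cdiffr (fun y => cderiver Z y v) x0 by exact: csmoothr_cdiffr (sD v) Wx0.
have ca v : cdiff (conn Z v) x0 by exact: csmooth_cdiff (sa v) Wx0.
suff E j l : hdot xi (sff Z x0 j l) =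
    hdot xi (cderiver (fun y => cderiver Z y (delta_mx 0 l)) x0 (delta_mx 0 j)) -
    ((conn Z (delta_mx 0 l) x0)^*%C * hdot xi (cderiver Z x0 (delta_mx 0 j)) +
     (conn Z (delta_mx 0 j) x0)^*%C * hdot xi (cderiver Z x0 (delta_mx 0 l))).
  have cl : cderiver (fun y => cderiver Z y (delta_mx 0 1)) x0 (delta_mx 0 0) =
            cderiver (fun y => cderiver Z y (delta_mx 0 0)) x0 (delta_mx 0 1).
    exact: (cclairautr (delta_mx 0 1) (delta_mx 0 0) oW sZ Wx0).
  exact: Re_sym (E 0 1) (E 1 0) (congr1 (hdot xi) cl).
have cH : cdiffr (fun y => cderiver Z y (delta_mx 0 l) - conn Z (delta_mx 0 l) y *: Z y) x0.
  by apply: cdiffrB => //; exact: cdiffrZ.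
rewrite /sff (cderiverB _ (cD _) (cdiffrZ (ca _) cZ)) (cderiverZ _ (ca _) cZ) HfE.
exact: hdot_sff.
Qed.

Hypothesis not_complex : Im (hdot (e 0) (e 1)) ^+ 2 != g 0 0 * g 1 1 - g 0 1 ^+ 2.

Lemma kahler_onto (p q : R) : exists xi, [/\ is_normal xi, kahler xi 0 = p & kahler xi 1 = q].
Proof.
have [xi [xz h0 h1 k0 k1]] := rot_onto p q (ez 0) (ez 1) erefl erefl erefl erefl d0 not_complex.
exists xi; split; [split; [exact: xz|]|exact: k0|exact: k1].
by move=> l; have [->|->] := ord2_cases l; [exact: h0|exact: h1].
Qed.

(** The Kaehler pairing takes all values, so that [mix_sff0] applies. *)
Lemma austere_sff0 xi j l : is_normal xi -> sffn xi j l = 0.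
Proof.
apply: (@mix_sff0 _ _ (fun x a y => x + a%:C *: y) is_normal sffn kahler g _ _ _ (gC 0 1) d0 sff_sym austere_mix kahler_onto).
- by move=> x a y Nx Ny; apply: is_normalD => //; apply: is_normalZ.
- by move=> x a y j' l'; rewrite sffnD sffnZ.
- by move=> x a y j'; rewrite kahlerD kahlerZ.
Qed.

End Pointwise.

(** * Totally geodesic points and the Codazzi equation *)
Section Covariant.
Context {R : realType} {n : nat}.
Local Notation C := R[i].
Local Notation Re := complex.Re.
Local Notation Im := complex.Im.
Local Notation vec := 'rV[C]_n.+1.
Implicit Types (Z V U : 'rV[R]_2 -> vec) (x u v : 'rV[R]_2).

(** Covariant derivative of a field of vectors which scales like the lift Z. *)
Definition cov Z v V x : vec := cderiver V x v - conn Z v x *: V x.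

Lemma cov_hdot_alg (a : C) (dV dU V U : vec) :
  hdot dV U + hdot V dU = hdot (dV - a *: V) U + hdot V (dU - a *: U) + (a + a^*%C) * hdot V U.
Proof. by rewrite hdotBl (hdotZl a V) hdotBr (hdotZr a V); ring. Qed.

Lemma cov_hdot Z V U v x : cdiffr V x -> cdiffr U x ->
  cderive (fun y => hdot (V y) (U y)) x v =
  hdot (cov Z v V x) (U x) + hdot (V x) (cov Z v U x) + (conn Z v x + (conn Z v x)^*%C) * hdot (V x) (U x).
Proof. by move=> dV dU; rewrite cderive_hdot //; exact: cov_hdot_alg. Qed.

Lemma cov_comm_alg (a V du dv : vec) (d1 d2 au av : C) :
  (a - (d1 *: V + av *: du) - au *: (dv - av *: V)) -
  (a - (d2 *: V + au *: dv) - av *: (du - au *: V)) = - (d1 - d2) *: V.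
Proof. by apply/rowP => j; rewrite !mxE; ring. Qed.

Lemma hdot_curv (X Y z : vec) (k a b : C) : X - Y = - k *: z ->
  hdot X z = - a -> hdot Y z = - b -> k * hdot z z = a - b.
Proof.
move=> E hX hY; have : hdot (X - Y) z = - k * hdot z z by rewrite E hdotZl.
rewrite hdotBl hX hY mulNr => h; apply: oppr_inj; rewrite -h.
by rewrite opprB opprK addrC.
Qed.

Section OnOpen.
Variables (W : set 'rV[R]_2) (Z : 'rV[R]_2 -> vec).
Hypotheses (oW : open W) (sZ : csmoothr_on W Z) (Z0 : forall x, W x -> Z x != 0).

Let H v := Hf Z v.

Lemma csmoothr_cov V v : csmoothr_on W V -> csmoothr_on W (cov Z v V).
Proof.
move=> sV; apply: csmoothrB; [exact: oW|exact: csmoothr_deriver|].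
by apply: csmoothrZ; [exact: oW|exact: csmooth_conn|].
Qed.

Definition curv u v x : C := cderive (conn Z v) x u - cderive (conn Z u) x v.

Lemma cov_comm V u v x : csmoothr_on W V -> W x ->
  cov Z u (cov Z v V) x - cov Z v (cov Z u V) x = - curv u v x *: V x.
Proof.
move=> sV Wx; have cV := csmoothr_cdiffr sV Wx.
have cD w : cdiffr (fun y => cderiver V y w) x.
  exact: csmoothr_cdiffr (csmoothr_deriver w sV) Wx.
have ca w : cdiff (conn Z w) x by exact: csmooth_cdiff (csmooth_conn oW sZ Z0 w) Wx.
have E w w' : cov Z w (cov Z w' V) x = cderiver (fun y => cderiver V y w') x w
    - (cderive (conn Z w') x w *: V x + conn Z w' x *: cderiver V x w)
    - conn Z w x *: (cderiver V x w' - conn Z w' x *: V x).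
  by rewrite [LHS]/cov (cderiverB _ (cD _) (cdiffrZ (ca _) cV)) (cderiverZ _ (ca _) cV).
rewrite (E u v) (E v u) (cclairautr v u oW sV Wx).
exact: cov_comm_alg.
Qed.

Lemma cov_orth (W' : set 'rV[R]_2) V v x : open W' -> W' x -> W' `<=` W ->
  csmoothr_on W' V -> (forall y, W' y -> hdot (V y) (Z y) = 0) ->
  hdot (cov Z v V x) (Z x) = - hdot (V x) (H v x).
Proof.
move=> oW' W'x sW sV VZ; have Wx := sW _ W'x.
have := cov_hdot Z v (csmoothr_cdiffr sV W'x) (csmoothr_cdiffr sZ Wx).
rewrite (cderive_on v oW' W'x (g := fun=> 0)) ?cderive_cst; last first.
  by move=> y; rewrite inE; exact: VZ.
rewrite (VZ _ W'x) mulr0 addr0 => /eqP; rewrite eq_sym addr_eq0 => /eqP.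
by [].
Qed.

(** The curvature of the tautological bundle is a multiple of the Kaehler form. *)
Lemma curv_hdot u v x : W x ->
  curv u v x * hdot (Z x) (Z x) = hdot (H v x) (H u x) - hdot (H u x) (H v x).
Proof.
move=> Wx; have := cov_comm u v sZ Wx.
have E w : cov Z w Z = H w by apply/funext => y.
have sH w : csmoothr_on W (H w) by exact: csmoothr_Hf.
have HZ w y : W y -> hdot (H w y) (Z y) = 0 by move=> Wy; apply: horizontal_orth; apply: Z0.
rewrite (E u) (E v) => h.
have h1 := cov_orth u oW Wx (@subset_refl _ _) (sH v) (HZ v).
have h2 := cov_orth v oW Wx (@subset_refl _ _) (sH u) (HZ u).
exact: hdot_curv h h1 h2.
Qed.

End OnOpen.

Lemma codazzi_alg (p K x y g : C) : K = p^*%C - p -> Re x = 0 -> Re y = 0 -> Im g = 0 ->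
  Re (- K * x^*%C) = - Re (x^*%C * p) + Re (y^*%C * g) -> Im p * Im x = 0.
Proof.
case: p K x y g => p1 p2 [k1 k2] [x1 x2] [y1 y2] [g1 g2] [-> ->] /= -> -> -> E; lra.
Qed.

Lemma scale_cov (k a : C) (x y : vec) : k *: x - a *: (k *: y) = k *: (x - a *: y).
Proof. by rewrite scalerBr scaler_swap. Qed.

Lemma mul_eq0_1 (a b : R) : a * b = 0 -> b = 1 -> a = 0.
Proof. by move=> E b1; rewrite b1 mulr1 in E. Qed.

Lemma sub_shift (a b c d k : R) : a + c = 0 -> b + d = 0 -> a - b = k -> k = - c + d.
Proof. by lra. Qed.

End Covariant.

Section Codazzi.
Context {R : realType} {M : topologicalType} {n : nat}.
Variable F : M -> CP R n.
Local Notation C := R[i].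
Local Notation Re := complex.Re.
Local Notation Im := complex.Im.
Local Notation vec := 'rV[C]_n.+1.
Variables (P : param R M) (W : set 'rV[R]_2) (Z : 'rV[R]_2 -> vec) (x0 : 'rV[R]_2).
Hypotheses (lZ : lifts F P W Z) (sZ : csmoothr_on W Z) (Wx0 : W x0).
Hypothesis zz : hdot (Z x0) (Z x0) = 1.
Hypothesis gram0 : forall x, W x -> gram Z x != 0.
Let H (l : 'I_2) x := Hf Z (delta_mx 0 l) x.
Hypothesis flat : forall y xi j l, W y -> hdot xi (Z y) = 0 ->
  (forall k, Re (hdot xi (H k y)) = 0) -> Re (hdot xi (cov Z (delta_mx 0 j) (H l) y)) = 0.

Let oW : open W. Proof. by case: lZ. Qed.
Let Z0 x : W x -> Z x != 0. Proof. exact: lifts_neq0 lZ. Qed.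

(** Extend xi to a normal field N and differentiate <cov_1 H_0, N> = 0 in direction 0
    and <cov_0 H_0, N> = 0 in direction 1.  As the second fundamental form vanishes,
    only the curvature term cov_comm and the components along Z survive. *)
Lemma codazzi xi : hdot xi (Z x0) = 0 -> (forall k, Re (hdot xi (H k x0)) = 0) ->
  Im (hdot (H 0 x0) (H 1 x0)) * Im (hdot xi (H 0 x0)) = 0.
Proof.
move=> xz xH.
have [W2 [N [[oW2 W2W W2x0] sN Nx0 HN]]] := normal_field lZ sZ Wx0 zz gram0 xz xH.
pose u : 'rV[R]_2 := delta_mx 0 0; pose v : 'rV[R]_2 := delta_mx 0 1.
have sH l : csmoothr_on W (H l) by exact: csmoothr_Hf.
have sC j l : csmoothr_on W (cov Z (delta_mx 0 j) (H l)) by exact: csmoothr_cov.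
have cN : cdiffr N x0 by exact: csmoothr_cdiffr sN W2x0.
have HZ l y : W y -> hdot (H l y) (Z y) = 0 by move=> Wy; apply: horizontal_orth; apply: Z0.
have NZ y : W2 y -> hdot (N y) (Z y) = 0 by case/HN.
have cNZ j : hdot (cov Z (delta_mx 0 j) N x0) (Z x0) = - hdot xi (H j x0).
  by rewrite (cov_orth sZ _ oW2 W2x0 W2W sN NZ) Nx0.
have cHZ j l : hdot (cov Z (delta_mx 0 j) (H l) x0) (Z x0) = - hdot (H l x0) (H j x0).
  exact: (cov_orth sZ _ oW Wx0 (@subset_refl _ _) (sH l) (HZ l)).
have leib (V : 'rV[R]_2 -> vec) j : csmoothr_on W V ->
    (forall y, W2 y -> Re (hdot (V y) (N y)) = 0) ->
    Re (hdot (cov Z (delta_mx 0 j) V x0) xi) + Re (hdot (V x0) (cov Z (delta_mx 0 j) N x0)) = 0.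
  move=> sV VN; have := cov_hdot Z (delta_mx 0 j) (csmoothr_cdiffr sV Wx0) cN.
  move=> /(congr1 (fun c : C => Re c)); rewrite Re_cderive (eq_derive_on oW2 (g := fun=> 0)) ?derive_cst ?inE //; last first.
    by move=> y; rewrite inE; exact: VN.
  rewrite !cReD addcJ -mulrA two_complex Re_realM Re_realM (VN _ W2x0) !mulr0 addr0 Nx0.
  by move=> ->.
(* Up to its component along Z, the derivative of N is again normal: its tangential
   part is given by the second fundamental form. *)
have etaN j : let eta := cov Z (delta_mx 0 j) N x0 + hdot xi (H j x0) *: Z x0 in
    hdot eta (Z x0) = 0 /\ forall k, Re (hdot eta (H k x0)) = 0.
  move=> eta; split; first by rewrite hdotDl cNZ hdotZl zz mulr1 addrC subrr.
  move=> k; rewrite hdotDl (hdotZl (hdot xi (H j x0))) (hdotC (H k x0) (Z x0)) HZ // conjc0 mulr0 addr0.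
  have := leib (H k) j (sH k); rewrite [Re (hdot (cov _ _ _ _) xi)]Re_hdotC flat // add0r.
  rewrite [Re (hdot (H k x0) _)]Re_hdotC; apply=> y W2y.
  by rewrite Re_hdotC; case: (HN _ W2y) => _ -> _.
have cross i j l : Re (hdot (cov Z (delta_mx 0 i) (H l) x0) (cov Z (delta_mx 0 j) N x0)) =
   Re ((hdot xi (H j x0))^*%C * hdot (H l x0) (H i x0)).
  have [ez eH] := etaN j; set eta := _ + _ in ez eH.
  have -> : cov Z (delta_mx 0 j) N x0 = eta - hdot xi (H j x0) *: Z x0 by rewrite addrK.
  rewrite hdotBr cReB (hdotZr (hdot xi (H j x0))) cHZ mulrN cReN opprK.
  by rewrite [Re (hdot _ eta)]Re_hdotC flat // add0r.
have flatN j l y : W2 y -> Re (hdot (cov Z (delta_mx 0 j) (H l) y) (N y)) = 0.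
  move=> W2y; rewrite Re_hdotC; have [h1 h2 _] := HN _ W2y.
  exact: flat (W2W _ W2y) h1 h2.
have E1 := leib _ 0 (sC 1 0) (flatN 1 0).
have E2 := leib _ 1 (sC 0 0) (flatN 0 0).
rewrite cross in E1; rewrite cross in E2.
have := cov_comm oW sZ Z0 u v (sH 0) Wx0 => /(congr1 (fun X => Re (hdot X xi))).
have K := curv_hdot oW sZ Z0 u v Wx0; rewrite zz mulr1 in K.
rewrite hdotBl cReB (hdotZl (- curv Z u v x0)) [hdot (H 0 x0) xi]hdotC => E.
have K' : curv Z u v x0 = (hdot (H 0 x0) (H 1 x0))^*%C - hdot (H 0 x0) (H 1 x0).
  by rewrite K -hdotC.
apply: (codazzi_alg K' (xH 0) (xH 1) (Im_hdotxx (H 0 x0))).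
exact: sub_shift E1 E2 E.
Qed.

End Codazzi.

Local Transparent conn Hf.

Section Rescale.
Context {R : realType} {n : nat}.
Local Notation C := R[i].
Local Notation Re := complex.Re.
Local Notation Im := complex.Im.
Local Notation vec := 'rV[C]_n.+1.
Variables (W : set 'rV[R]_2) (Z : 'rV[R]_2 -> vec) (k : C).
Hypotheses (oW : open W) (sZ : csmoothr_on W Z) (Z0 : forall x, W x -> Z x != 0) (k0 : k != 0).

Definition scaled (y : 'rV[R]_2) : vec := k *: Z y.

Lemma smooth_scaled : csmoothr_on W scaled.
Proof. by apply: csmoothrZ => //; apply: csmooth_cst. Qed.

Lemma conn_scaled v x : W x -> conn scaled v x = conn Z v x.
Proof.
move=> Wx; have cZ := csmoothr_cdiffr sZ Wx.
rewrite /conn /scaled (cderiverZc k v cZ) !(hdotZl k) !(hdotZr k).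
have kk0 : k^*%C != 0 by rewrite conjc_eq0.
by rewrite -mulf_div divff // mul1r -mulf_div divff // mul1r.
Qed.

Lemma Hf_scaled v x : W x -> Hf scaled v x = k *: Hf Z v x.
Proof.
move=> Wx; have cZ := csmoothr_cdiffr sZ Wx.
rewrite !HfE conn_scaled // /scaled (cderiverZc k v cZ).
by rewrite scalerBr scaler_swap.
Qed.
End Rescale.

Local Opaque conn Hf.

Section Dichotomy.
Context {R : realType} {M : topologicalType} {n : nat}.
Variable F : M -> CP R n.
Local Notation C := R[i].
Local Notation Re := complex.Re.
Local Notation Im := complex.Im.
Local Notation vec := 'rV[C]_n.+1.

Implicit Types (Z : 'rV[R]_2 -> vec) (W : set 'rV[R]_2) (P : param R M).

Definition kahler_form (Z : 'rV[R]_2 -> vec) x : R := Im (hdot (Hf Z (delta_mx 0 0) x) (Hf Z (delta_mx 0 1) x)).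

Lemma metric_scaled W Z (k : R) x j l : csmoothr_on W Z -> k != 0 -> W x ->
  metric (scaled Z k%:C) x j l = k ^+ 2 * metric Z x j l.
Proof.
move=> sZ k0 Wx; have kC0 : k%:C != 0 :> C by rewrite fmorph_eq0.
rewrite /metric !(Hf_scaled sZ kC0 _ Wx) Re_hdotZl Re_hdotZr mulrA.
by [].
Qed.

Lemma gram_scaled W Z (k : R) x : csmoothr_on W Z -> k != 0 -> W x ->
  gram (scaled Z k%:C) x = k ^+ 4 * gram Z x.
Proof.
move=> sZ k0 Wx; rewrite /gram !(metric_scaled _ _ sZ k0 Wx).
by move: (metric _ _ _ _) (metric _ _ _ _) (metric _ _ _ _) => a b c; ring.
Qed.

Lemma kahler_form_scaled W Z (k : R) x : csmoothr_on W Z -> k != 0 -> W x ->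
  kahler_form (scaled Z k%:C) x = k ^+ 2 * kahler_form Z x.
Proof.
move=> sZ k0 Wx; have kC0 : k%:C != 0 :> C by rewrite fmorph_eq0.
rewrite /kahler_form !(Hf_scaled sZ kC0 _ Wx) Im_hdotZl Im_hdotZr mulrA.
by [].
Qed.

Lemma lifts_scaled P W Z (k : C) : lifts F P W Z -> k != 0 -> lifts F P W (scaled Z k).
Proof. by move=> [oW WP rZ] k0; split=> // x /rZ; apply: representsZ. Qed.

Lemma unit_scaled Z x : Z x != 0 -> let k := (hnorm (Z x))^-1 in
  k != 0 /\ hdot (scaled Z k%:C x) (scaled Z k%:C x) = 1.
Proof.
move=> Zx k; have h0 := hnorm_gt0 Zx; have k0 : k != 0 by rewrite invr_eq0 gt_eqF.
split=> //; rewrite /scaled (hdotZl k%:C) (hdotZr k%:C) conjcR hdotxx_real -hnorm_sqr.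
rewrite -!(rmorphM (real_complex R)) /= /k.
have -> : (hnorm (Z x))^-1 * ((hnorm (Z x))^-1 * hnorm (Z x) ^+ 2) = 1.
  by field; rewrite gt_eqF.
by [].
Qed.

Definition frame P W Z (x : 'rV[R]_2) :=
  [/\ W x, lifts F P W Z, csmoothr_on W Z & forall y, W y -> gram Z y != 0].

Lemma smooth_metric W Z j l : open W -> csmoothr_on W Z -> (forall x, W x -> Z x != 0) ->
  smooth_on W (fun x => metric Z x j l).
Proof.
move=> oW sZ Z0; apply: csmooth_Re; apply: csmooth_hdot => //; exact: csmoothr_Hf.
Qed.

Lemma smooth_kahler_form W Z : open W -> csmoothr_on W Z -> (forall x, W x -> Z x != 0) ->
  smooth_on W (kahler_form Z).
Proof.
move=> oW sZ Z0; apply: csmooth_Im; apply: csmooth_hdot => //; exact: csmoothr_Hf.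
Qed.

Lemma smooth_gram W Z : open W -> csmoothr_on W Z -> (forall x, W x -> Z x != 0) ->
  smooth_on W (gram Z).
Proof.
move=> oW sZ Z0; rewrite /gram; under eq_fun do rewrite expr2.
by apply: smoothB => //; apply: smoothM => //; apply: smooth_metric.
Qed.

Lemma open_nz W (f : 'rV[R]_2 -> R) : open W -> smooth_on W f -> open (W `&` [set x | f x != 0]).
Proof.
move=> oW sf; have := csmooth_nz oW (csmoothR sf).
suff -> : [set x | (f x)%:C != 0] = [set x | f x != 0] by [].
by apply/seteqP; split=> x /=; rewrite fmorph_eq0.
Qed.

Lemma frame_sub P W Z x W' y : frame P W Z x -> open W' -> W' `<=` W -> W' y -> frame P W' Z y.
Proof.
move=> [Wx [oW WP rZ] sZ g0] oW' sW W'x; split=> //.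
- by split=> // z /sW //; [exact: WP|exact: rZ].
- exact: csmoothr_sub sZ.
- by move=> z /sW /g0.
Qed.

Lemma Re_hdot_quad (a b : R) (x y : vec) :
  Re (hdot (a%:C *: x + b%:C *: y) (a%:C *: x + b%:C *: y)) =
  a ^+ 2 * Re (hdot x x) + 2 * a * b * Re (hdot x y) + b ^+ 2 * Re (hdot y y).
Proof.
rewrite Re_hdot_comb2 (Re_hdotC (_ + _) x) Re_hdot_comb2 (Re_hdotC (_ + _) y) Re_hdot_comb2.
by rewrite (Re_hdotC x y); ring.
Qed.

Lemma null_vector (a b c : R) : a * c - b ^+ 2 = 0 ->
  (- b) ^+ 2 * a + 2 * (- b) * a * b + a ^+ 2 * c = 0.
Proof. by move=> E; transitivity (a * (a * c - b ^+ 2)); [ring|rewrite E mulr0]. Qed.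

Lemma gram_neq0 Z x : cdiffr Z x -> (forall v, v != 0 -> Hf Z v x != 0) -> gram Z x != 0.
Proof.
move=> cZ inj; apply/eqP => g0.
have e10 : (delta_mx 0 1 : 'rV[R]_2) 0 0 = 0 by rewrite mxE.
have m0 : metric Z x 0 0 != 0.
  rewrite /metric hdotxx_eq0 inj //; apply/eqP => /matrixP/(_ 0 0)/eqP.
  by rewrite !mxE !eqxx oner_eq0.
pose v : 'rV[R]_2 := (- metric Z x 0 1) *: delta_mx 0 0 + metric Z x 0 0 *: delta_mx 0 1.
have v0 : v != 0.
  apply/eqP => /matrixP/(_ 0 1)/eqP; rewrite !mxE !eqxx /= mulr0 add0r mulr1.
  by rewrite (negPf m0).
have /eqP := inj v v0; apply; apply/eqP; rewrite -hdotxx_eq0.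
rewrite /v HfD // HfZ // HfZ //.
rewrite Re_hdot_quad; apply/eqP; apply: null_vector; exact: g0.
Qed.

Lemma immersed_frame A P x : immersion F A -> A P -> pdom P x -> exists W Z, frame P W Z x.
Proof.
move=> imm AP Px; have [W [Z [Wx lZ sZ inj]]] := imm P x AP Px.
have [oW WP rZ] := lZ.
have Z0 y : W y -> Z y != 0 by exact: lifts_neq0 lZ.
exists (W `&` [set y | gram Z y != 0]), Z; split.
- split=> //=; apply: gram_neq0; first exact: csmoothr_cdiffr sZ Wx.
  exact: inj.
- split; [|by move=> y [/WP]|by move=> y [/rZ]].
  by apply: open_nz => //; apply: smooth_gram.
- exact: csmoothr_sub sZ.
- by move=> y [].
Qed.

End Dichotomy.

Section Flat.
Context {R : realType} {M : topologicalType} {m : nat}.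
Variable F : M -> CP R m.+1.
Local Notation C := R[i].
Local Notation Re := complex.Re.
Local Notation Im := complex.Im.
Local Notation vec := 'rV[C]_m.+2.
Variable A : set (param R M).
Hypothesis aus : austere F A.

Lemma flat_unit P W Z x : A P -> frame F P W Z x -> hdot (Z x) (Z x) = 1 ->
  kahler_form Z x ^+ 2 != gram Z x ->
  forall xi j l, hdot xi (Z x) = 0 -> (forall k, Re (hdot xi (Hf Z (delta_mx 0 k) x)) = 0) ->
  Re (hdot xi (sff Z x j l)) = 0.
Proof.
have [phi H] := aus.
move=> AP [Wx lZ sZ g0] zz nc xi j l xz xH.
have Px : pdom P x by case: lZ => _ WP _; apply: WP.
apply: (@austere_sff0 _ _ _ F P W Z x lZ sZ Wx zz g0 phi _ nc xi j l (conj xz xH)).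
by move=> xi' /(H P x (Z x) xi' AP Px) [].
Qed.

(** [flat_unit] asks for a unit lift at the point; a constant factor achieves this. *)
Lemma flat_scaled P W Z x : A P -> frame F P W Z x -> kahler_form Z x ^+ 2 != gram Z x ->
  forall xi j l, hdot xi (Z x) = 0 -> (forall k, Re (hdot xi (Hf Z (delta_mx 0 k) x)) = 0) ->
  Re (hdot xi (cov Z (delta_mx 0 j) (Hf Z (delta_mx 0 l)) x)) = 0.
Proof.
move=> AP fr nc xi j l xz xH; have [Wx lZ sZ g0] := fr.
have [oW _ _] := lZ; have Z0 y : W y -> Z y != 0 by exact: lifts_neq0 lZ.
have [k0 zz] := unit_scaled (Z0 x Wx); set k := _^-1 in k0 zz.
have kC0 : k%:C != 0 :> C by rewrite fmorph_eq0.
have k4 : k ^+ 4 != 0 by rewrite expf_neq0.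
have fr' : frame F P W (scaled Z k%:C) x.
  split=> //; [exact: lifts_scaled|exact: smooth_scaled|].
  by move=> y Wy; rewrite (gram_scaled sZ k0 Wy) mulf_neq0 // g0.
have nc' : kahler_form (scaled Z k%:C) x ^+ 2 != gram (scaled Z k%:C) x.
  rewrite (gram_scaled sZ k0 Wx) (kahler_form_scaled sZ k0 Wx) exprMn -exprM.
  by apply: contra nc => /eqP /(mulfI k4) /eqP.
have xz' : hdot xi (scaled Z k%:C x) = 0 by rewrite /scaled hdotZr xz mulr0.
have xH' l' : Re (hdot xi (Hf (scaled Z k%:C) (delta_mx 0 l') x)) = 0.
  by rewrite (Hf_scaled sZ kC0 _ Wx) (Re_hdotZr k) xH mulr0.
have := flat_unit AP fr' zz nc' j l xz' xH'.
have cH : cdiffr (Hf Z (delta_mx 0 l)) x.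
  exact: csmoothr_cdiffr (csmoothr_Hf oW sZ Z0 _) Wx.
have -> : sff (scaled Z k%:C) x j l = k%:C *: cov Z (delta_mx 0 j) (Hf Z (delta_mx 0 l)) x.
  rewrite /sff (conn_scaled sZ kC0 _ Wx) (Hf_scaled sZ kC0 _ Wx).
  rewrite (@cderiver_on _ _ _ W (Hf (scaled Z k%:C) (delta_mx 0 l)) (fun y => k%:C *: Hf Z (delta_mx 0 l) y)) //.
    by rewrite (cderiverZc k%:C _ cH) /cov; exact: scale_cov.
  by move=> y; rewrite inE => Wy; exact: (Hf_scaled sZ kC0 _ Wy).
rewrite (Re_hdotZr k) => /eqP; rewrite mulf_eq0 (negPf k0) => /eqP.
by [].
Qed.

(** If no tangent plane is complex, the surface is totally geodesic and some normal
    vector has pairing 1 with H_0, so that the Codazzi equation kills the Kaehler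
    form. *)
Lemma kahler_form0 P W Z x : A P -> frame F P W Z x -> (forall y, W y -> kahler_form Z y ^+ 2 != gram Z y) ->
  kahler_form Z x = 0.
Proof.
move=> AP [Wx lZ sZ g0] nc.
have [oW _ _] := lZ; have Z0 y : W y -> Z y != 0 by exact: lifts_neq0 lZ.
have [k0 zz] := unit_scaled (Z0 x Wx); set k := _^-1 in k0 zz.
have k4 : k ^+ 4 != 0 by rewrite expf_neq0.
have gk y : W y -> gram (scaled Z k%:C) y != 0.
  by move=> Wy; rewrite (gram_scaled sZ k0 Wy) mulf_neq0 // g0.
have sk : csmoothr_on W (scaled Z k%:C) by exact: smooth_scaled.
have lk : lifts F P W (scaled Z k%:C) by apply: lifts_scaled => //; rewrite fmorph_eq0.
have nk y : W y -> kahler_form (scaled Z k%:C) y ^+ 2 != gram (scaled Z k%:C) y.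
  move=> Wy; rewrite (gram_scaled sZ k0 Wy) (kahler_form_scaled sZ k0 Wy) exprMn -exprM.
  by apply: contra (nc y Wy) => /eqP /(mulfI k4) /eqP.
have Zk0 y : W y -> scaled Z k%:C y != 0 by exact: lifts_neq0 lk.
have HZ l : hdot (Hf (scaled Z k%:C) (delta_mx 0 l) x) (scaled Z k%:C x) = 0.
  by apply: horizontal_orth; apply: Zk0.
have [xi [xz h0 h1 b0 _]] := rot_onto 1 0 (HZ 0) (HZ 1) erefl erefl erefl erefl (gk x Wx) (nk x Wx).
have fl y eta j l : W y -> hdot eta (scaled Z k%:C y) = 0 ->
  (forall k', Re (hdot eta (Hf (scaled Z k%:C) (delta_mx 0 k') y)) = 0) ->
  Re (hdot eta (cov (scaled Z k%:C) (delta_mx 0 j) (Hf (scaled Z k%:C) (delta_mx 0 l)) y)) = 0.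
  by move=> Wy; exact: (flat_scaled AP (And4 Wy lk sk gk) (nk y Wy)).
have xiH k' : Re (hdot xi (Hf (scaled Z k%:C) (delta_mx 0 k') x)) = 0.
  by have [->|->] := ord2_cases k'.
have cod := mul_eq0_1 (codazzi lk sk Wx zz gk fl xz xiH) b0.
have := kahler_form_scaled sZ k0 Wx; rewrite [LHS]cod => /esym/eqP.
by rewrite mulf_eq0 expf_eq0 /= (negPf k0) => /eqP.
Qed.

End Flat.

Lemma connected_cover (M : topologicalType) (S T : set M) p0 : connected [set: M] -> open S -> open T ->
  (forall p, S p \/ T p) -> (forall p, S p -> T p -> False) -> S p0 -> forall p, S p.
Proof.
move=> conM oS oT cov_ disj Sp0 p.
have SE : S = ~` T.
  by apply/seteqP; split=> q; [move=> h1 h2; exact: (disj q)|case: (cov_ q)].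
suff -> : S = setT by [].
apply: conM; first by exists p0.
  by exists S; [exact: oS|rewrite setTI].
exists S; last by rewrite setTI.
by rewrite SE; apply: open_closedC.
Qed.

Section PointTypes.
Context {R : realType} {M : topologicalType} {n : nat}.
Variable F : M -> CP R n.
Variable A : set (param R M).
Local Notation C := R[i].
Local Notation Re := complex.Re.
Local Notation Im := complex.Im.
Local Notation vec := 'rV[C]_n.+1.
Implicit Types (Z : 'rV[R]_2 -> vec) (W : set 'rV[R]_2) (P : param R M).

Definition locally_frame (T : ('rV[R]_2 -> vec) -> 'rV[R]_2 -> Prop) (p : M) :=
  exists P W Z x, [/\ A P, P x = p, frame F P W Z x & forall y, W y -> T Z y].

Definition complex_point := locally_frame (fun Z y => kahler_form Z y ^+ 2 = gram Z y).
Definition isotropic_point := locally_frame (fun Z y => kahler_form Z y = 0).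

Hypothesis surf : smooth_surface A.

Lemma open_locally_frame T : open (locally_frame T).
Proof.
rewrite openE => p [P [W [Z [x [AP Pxp [Wx lZ sZ g0] TW]]]]]; rewrite /interior /=.
have [_ _ [par _ _]] := surf; have [_ _ _ opn] := par P AP.
have [oW WP _] := lZ.
have oPW := opn W oW WP.
apply: filterS (open_nbhs_nbhs (conj oPW _)); last by exists x.
by move=> _ [y Wy <-]; exists P, W, Z, y.
Qed.

Lemma open_preimage_smooth p q (U : set 'rV[R]_p) (W : set 'rV[R]_q) (tau : 'rV[R]_p -> 'rV[R]_q) :
  open U -> open W -> smoothr_on U tau -> open (U `&` tau @^-1` W).
Proof.
move=> oU oW st; rewrite openE => x [Ux Wx]; apply: filterI.
  exact: open_nbhs_nbhs (conj oU Ux).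
have ct : {for x, continuous tau}.
  by apply: differentiable_continuous; exact: smoothr_diff st Ux.
by apply: ct; exact: open_nbhs_nbhs (conj oW Wx).
Qed.

Lemma conjM_real (c z : C) : c * (c^*%C * z) = (Re c ^+ 2 + Im c ^+ 2)%:C * z.
Proof.
rewrite mulrA; congr (_ * _); apply: complex_ext; rewrite ?cReM ?cImM ?cReJ ?cImJ /=; ring.
Qed.

Lemma Im_real_comb (a b c d : R) (x y : vec) : Im (hdot x y) = 0 ->
  Im (hdot (a%:C *: x + b%:C *: y) (c%:C *: x + d%:C *: y)) = 0.
Proof.
move=> h; have h' : Im (hdot y x) = 0 by rewrite Im_hdotC h oppr0.
rewrite Im_hdot_comb2 (Im_hdotC (_ + _) x) (Im_hdotC (_ + _) y) !Im_hdot_comb2.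
by rewrite h h' !Im_hdotxx !mulr0 !addr0 !oppr0 !mulr0 addr0.
Qed.

Lemma frame_change P Q W W' Z Z' x y : A P -> A Q -> frame F P W Z x -> frame F Q W' Z' y ->
  P x = Q y -> exists c : C, [/\ c != 0, Z' y = c *: Z x &
    forall v, exists u, Hf Z' v y = c *: Hf Z u x].
Proof.
move=> AP AQ [Wx lZ sZ _] [W'y lZ' sZ' _] PQ.
have [_ _ [_ _ tr]] := surf.
have Px : pdom P x by case: lZ => _ h _; exact: h.
have Qy : pdom Q y by case: lZ' => _ h _; exact: h.
have [U [tau [oU Uy UQ stau Htau]]] := tr Q P AQ AP y x Qy Px (esym PQ).
have [par _ _] := let: And3 _ _ h := surf in h.
have tauy : tau y = x.
  have [_ _ inj _] := par P AP; have [h1 h2] := Htau y Uy.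
  by apply: inj => //; rewrite h2.
have [oW _ _] := lZ; have [oW' _ _] := lZ'.
pose U' := (U `&` tau @^-1` W) `&` W'.
have oU' : open U' by apply: openI => //; exact: open_preimage_smooth.
have U'y : U' y by split=> //; split=> //=; rewrite tauy.
have st : smoothr_on U' tau by move=> k; apply: smooth_sub (stau k) => z [[]].
have sz' : csmoothr_on U' Z' by apply: csmoothr_sub sZ' => z [].
have [c [c0 Zc HH]] := @Hf_change _ _ U' W Z' Z tau y oU' U'y oW sz' sZ st
  (fun z h => h.1.2) (fun z h => lifts_neq0 lZ h.1.2)
  (fun z h => lifts_prop lZ lZ' h.1.2 h.2 (Htau z h.1.1).2).
exists c; split=> //; first by rewrite Zc tauy.
by move=> v; exists ('D_v tau y); rewrite HH tauy.
Qed.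

Lemma kahler_form_change P Q W W' Z Z' x y : A P -> A Q -> frame F P W Z x -> frame F Q W' Z' y ->
  P x = Q y -> kahler_form Z x = 0 -> kahler_form Z' y = 0.
Proof.
move=> AP AQ fr fr' PQ k0; have [c [_ _ HH]] := frame_change AP AQ fr fr' PQ.
have [Wx _ sZ _] := fr; have cZ := csmoothr_cdiffr sZ Wx.
have [u Hu] := HH (delta_mx 0 0); have [v Hv] := HH (delta_mx 0 1).
rewrite /kahler_form Hu Hv (Hf_row u cZ) (Hf_row v cZ).
by rewrite (hdotZl c) (hdotZr c) conjM_real Im_realM Im_real_comb ?mulr0.
Qed.

(** The two conditions are open and exclude each other: the square of the Kaehler form
    is the determinant of the metric, which is not 0, or it is 0. *)
Lemma complex_or_real : connected [set: M] ->
  (forall p, complex_point p \/ isotropic_point p) ->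
  (forall p, complex_point p) \/ ((exists p : M, True) /\ forall p, isotropic_point p).
Proof.
move=> conM cov_.
have disj p : complex_point p -> isotropic_point p -> False.
  move=> [P [W [Z [x [AP Px fr cW]]]]] [Q [W' [Z' [y [AQ Qy fr' rW]]]]].
  have [W'y _ _ _] := fr'; have [Wx _ _ g0] := fr.
  have k0 := kahler_form_change AQ AP fr' fr (etrans Qy (esym Px)) (rW y W'y).
  by have := g0 x Wx; rewrite -(cW x Wx) k0 expr0n eqxx.
have [[p rp]|no] := pselect (exists p, isotropic_point p); [right|left].
  split; first by exists p.
  apply: (@connected_cover _ isotropic_point complex_point p conM _ _ _ _ rp).
  - exact: open_locally_frame.
  - exact: open_locally_frame.
  - by move=> q; case: (cov_ q); [right|left].
  by move=> q h1 h2; exact: disj h2 h1.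
by move=> p; case: (cov_ p) => // rp; case: no; exists p.
Qed.

End PointTypes.

Section Cover.
Context {R : realType} {M : topologicalType}.
Local Notation C := R[i].

(** Where the tangent plane is not complex, [kahler_form0] applies on an open set.
    Where it is complex, the Kaehler form is nonzero, and remains so nearby, so that by
    [kahler_form0] the tangent planes nearby are complex. *)
Lemma kahler_form_dichotomy (m : nat) (F : M -> CP R m.+1) (A : set (param R M)) P W Z x :
  austere F A -> A P -> frame F P W Z x ->
  exists W', [/\ open W', W' x, W' `<=` W & (forall y, W' y -> kahler_form Z y ^+ 2 = gram Z y) \/
     (forall y, W' y -> kahler_form Z y = 0)].
Proof.
move=> aus AP fr; have [Wx lZ sZ g0] := fr.
have [oW _ _] := lZ; have Z0 y : W y -> Z y != 0 by exact: lifts_neq0 lZ.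
have sk : smooth_on W (kahler_form Z) by exact: smooth_kahler_form.
have sd : smooth_on W (fun y => kahler_form Z y ^+ 2 - gram Z y).
  apply: smoothB => //; last exact: smooth_gram.
  by under eq_fun do rewrite expr2; apply: smoothM.
pose D := W `&` [set y | kahler_form Z y ^+ 2 - gram Z y != 0].
have oD : open D by exact: open_nz.
have rD y : D y -> kahler_form Z y = 0.
  move=> Dy; apply: (kahler_form0 aus AP (frame_sub fr oD (@subIsetl _ _ _) Dy)).
  by move=> z [_ /=]; rewrite subr_eq0.
have [Dx|nDx] := pselect (D x).
  by exists D; split=> //; [move=> y []|right].
exists (W `&` [set y | kahler_form Z y != 0]); split.
- exact: open_nz.
- split=> //=; apply/eqP => k0; apply: nDx; split=> //=.
  by rewrite k0 expr0n sub0r oppr_eq0 g0.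
- by move=> y [].
left=> y [Wy /= ky]; apply/eqP; rewrite -subr_eq0; apply: contraT => h.
by case/eqP: ky; apply: rD.
Qed.

Lemma row1_orth (y z : 'rV[C]_1) : hdot y z = 0 -> z != 0 -> y = 0.
Proof.
move=> yz z0; have z00 : z 0 0 != 0.
  by apply: contra z0 => /eqP h; apply/eqP/rowP => j; rewrite !ord1 h mxE.
have yE : y = (y 0 0 / z 0 0) *: z by apply/rowP => j; rewrite !ord1 !mxE divfK.
rewrite yE; move: yz; rewrite {1}yE hdotZl => /eqP; rewrite mulf_eq0 => /orP[/eqP ->|].
  by rewrite scale0r.
by rewrite (negPf (hdotxx_neq0 z0)).
Qed.

Lemma immersion_dim (n : nat) (F : M -> CP R n) P W Z x : frame F P W Z x -> (0 < n)%N.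
Proof.
case: n F Z => // F Z [Wx lZ sZ g0].
have Zx : Z x != 0 by exact: lifts_neq0 lZ Wx.
have H0 l : Hf Z (delta_mx 0 l) x = 0.
  have Ho : hdot (Hf Z (delta_mx 0 l) x) (Z x) = 0 by exact: horizontal_orth.
  exact: row1_orth Ho Zx.
have := g0 x Wx; rewrite /gram /metric !H0 hdot0l /= mul0r expr0n subr0 eqxx.
by [].
Qed.

Theorem austere_dichotomy (n : nat) (F : M -> CP R n) (A : set (param R M)) :
  smooth_surface A -> connected [set: M] -> immersion F A -> austere F A ->
  (forall p, complex_point F A p) \/ ((exists p : M, True) /\ forall p, isotropic_point F A p).
Proof.
move=> surf conM imm aus; apply: complex_or_real => // p.
have [_ _ [_ cov_ _]] := surf; have [P [x AP [Px Pxp]]] := cov_ p.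
have [W [Z fr]] := immersed_frame imm AP Px.
have n0 := immersion_dim fr.
case: n F imm aus Z fr n0 => // m F imm aus Z fr _.
have [W' [oW' W'x sW' H]] := kahler_form_dichotomy aus AP fr.
have fr' := frame_sub fr oW' sW' W'x.
by case: H => H; [left|right]; exists P, W', Z, x.
Qed.

End Cover.

(** * Complex tangent planes: holomorphic curves *)
Section ComplexPlane.
Context {R : realType} {n : nat}.
Local Notation C := R[i].
Local Notation Re := complex.Re.
Local Notation Im := complex.Im.
Implicit Types (x y z v : 'rV[C]_n) (d a b : R).

Lemma Re_hdot_i x y : Re (hdot x ('i%C *: y)) = Im (hdot x y).
Proof. by rewrite (hdotZr 'i%C) conj_i cReM /=; ring. Qed.

Lemma Re_hdot_rot v d a b x y z :
  Re (hdot v ('i%C *: (d%:C *: x) + (a%:C *: y - b%:C *: z))) =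
  d * Im (hdot v x) + (a * Re (hdot v y) - b * Re (hdot v z)).
Proof.
rewrite hdotDr cReD Re_hdot_i (Im_hdotZr d) hdotBr cReB (Re_hdotZr a) (Re_hdotZr b).
by [].
Qed.

Lemma rot_solve d a b x y z : d != 0 ->
  'i%C *: (d%:C *: x) + (a%:C *: y - b%:C *: z) = 0 ->
  'i%C *: x = (d^-1 * b)%:C *: z + (- (d^-1 * a))%:C *: y.
Proof.
move=> d0 E; have dC : d%:C != 0 :> C by rewrite fmorph_eq0.
apply: (scalerI dC); rewrite scaler_swap scalerDr !scalerA -!rmorphM /=.
have -> : d * (d^-1 * b) = b by rewrite mulVKf.
have -> : d * - (d^-1 * a) = - a by rewrite mulrN mulVKf.
move: E => /eqP; rewrite addr_eq0 => /eqP; rewrite scalerA => ->.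
by rewrite rmorphN scaleNr opprB.
Qed.

(** Equality in Wirtinger's inequality: the vectors d (i e_0) - w (g1 e_0 - g0 e_1) and
    its analogue for e_1 have norm 0. *)
Lemma complex_plane (e0 e1 : 'rV[C]_n) (g0 g1 g2 w : R) :
  Re (hdot e0 e0) = g0 -> Re (hdot e0 e1) = g1 -> Re (hdot e1 e1) = g2 -> Im (hdot e0 e1) = w ->
  w ^+ 2 = g0 * g2 - g1 ^+ 2 -> g0 * g2 - g1 ^+ 2 != 0 ->
  (exists a b : R, 'i%C *: e0 = a%:C *: e0 + b%:C *: e1) /\
  (exists a b : R, 'i%C *: e1 = a%:C *: e0 + b%:C *: e1).
Proof.
move=> G0 G1 G2 Hw wd d0.
have G1' : Re (hdot e1 e0) = g1 by rewrite -(Re_hdotC e1 e0).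
have Hw' : Im (hdot e1 e0) = - w by rewrite -Hw -(Im_hdotC e0 e1).
have I0 := Im_hdotxx e0; have I1 := Im_hdotxx e1.
have [d dE] : exists d, d = g0 * g2 - g1 ^+ 2 by exists (g0 * g2 - g1 ^+ 2).
have dn0 : d != 0 by rewrite dE.
split.
  exists (d^-1 * (w * g1)), (- (d^-1 * (w * g0))); apply: rot_solve => //.
  apply/eqP; rewrite -hdotxx_eq0 Re_hdot_rot Re_rot Re_rot Im_rot.
  rewrite I0 G0 G1 G1' Hw Hw'; apply/eqP.
  transitivity (d * g0 * (d - w ^+ 2) + (w * g0) * w * (g0 * g2 - g1 ^+ 2 - d)).
    by rewrite G2; ring.
  by rewrite wd -dE !subrr !mulr0 addr0.
exists (d^-1 * (w * g2)), (- (d^-1 * (w * g1))); apply: rot_solve => //.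
apply/eqP; rewrite -hdotxx_eq0 Re_hdot_rot Re_rot Re_rot Im_rot.
rewrite I1 G0 G1 G2 G1' Hw Hw'; apply/eqP.
transitivity (d * g2 * (d - w ^+ 2) + w * g2 * w * (g0 * g2 - g1 ^+ 2 - d)).
  by ring.
by rewrite wd -dE !subrr !mulr0 addr0.
Qed.

Lemma complex_comb x y a b c d (p q : R) :
  'i%C *: x = a%:C *: x + b%:C *: y -> 'i%C *: y = c%:C *: x + d%:C *: y ->
  (p * a + q * c)%:C *: x + (p * b + q * d)%:C *: y = 'i%C *: (p%:C *: x + q%:C *: y).
Proof.
move=> Ex Ey; rewrite scalerDr (scaler_swap 'i%C p%:C x) Ex (scaler_swap 'i%C q%:C y) Ey.
by rewrite !scalerDr !scalerA !rmorphD !rmorphM /= !scalerDl addrACA.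
Qed.

Lemma affine_cancel (x y z : 'rV[C]_n) (i : 'I_n) (p q : C) : z 0 i = 1 -> x 0 i = 0 -> y 0 i = 0 ->
  x - p *: z = 'i%C *: (y - q *: z) -> x = 'i%C *: y.
Proof.
move=> zi xi yi E; have /(congr1 (fun X : 'rV[C]_n => X 0 i)) := E.
rewrite !mxE zi xi yi !mulr1 !add0r mulrN => /oppr_inj pq.
by move: E; rewrite pq scalerBr scalerA => /(addIr _).
Qed.

Lemma gram_indep (e0 e1 : 'rV[C]_n) a b :
  Re (hdot e0 e0) * Re (hdot e1 e1) - Re (hdot e0 e1) ^+ 2 != 0 ->
  a%:C *: e0 + b%:C *: e1 = 0 -> a = 0 /\ b = 0.
Proof.
move=> d0 E; have E0 := Re_hdot_comb2 a b e0 e1 e0; have E1 := Re_hdot_comb2 a b e0 e1 e1.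
rewrite E hdot0l (Re_hdotC e0 e1) in E0; rewrite E hdot0l in E1.
move: E0 E1 d0; move: (Re (hdot e0 e0)) (Re (hdot e0 e1)) (Re (hdot e1 e1)) => p q r /= E0 E1 d0.
split; apply: (mulfI d0); rewrite mulr0.
  by transitivity (r * (a * p + b * q) - q * (a * q + b * r)); [ring|rewrite -E0 -E1; ring].
by transitivity (p * (a * q + b * r) - q * (a * p + b * q)); [ring|rewrite -E0 -E1; ring].
Qed.

End ComplexPlane.

Section AffineLift.
Context {R : realType} {M : topologicalType} {n : nat}.
Variable F : M -> CP R n.
Local Notation C := R[i].
Local Notation Re := complex.Re.
Local Notation Im := complex.Im.
Local Notation vec := 'rV[C]_n.+1.
Implicit Types (Z : 'rV[R]_2 -> vec) (W : set 'rV[R]_2) (P : param R M).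

Lemma Hf_inj Z y v : cdiffr Z y -> gram Z y != 0 -> Hf Z v y = 0 -> v = 0.
Proof.
move=> cZ g0; rewrite (Hf_row v cZ) => E.
have [v0 v1] := gram_indep g0 E.
by apply/rowP => j; rewrite mxE; have [->|->] := ord2_cases j.
Qed.

Lemma complex_frame P W Z x : frame F P W Z x -> kahler_form Z x ^+ 2 = gram Z x ->
  forall v, exists u, Hf Z u x = 'i%C *: Hf Z v x.
Proof.
move=> [Wx lZ sZ g0] kg v; have cZ := csmoothr_cdiffr sZ Wx.
have [[a [b Ea]] [c [d Ec]]] := complex_plane erefl erefl erefl erefl kg (g0 x Wx).
exists ((v 0 0 * a + v 0 1 * c) *: delta_mx 0 0 + (v 0 0 * b + v 0 1 * d) *: delta_mx 0 1).
rewrite (HfD _ _ cZ) (HfZ _ _ cZ) (HfZ _ _ cZ) (Hf_row v cZ).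
exact: complex_comb Ea Ec.
Qed.

(** For a lift with one coordinate equal to 1, complex tangent planes mean that the
    image of the differential of the lift itself is stable under i. *)
Definition affine_lift Z (i : 'I_n.+1) (y : 'rV[R]_2) : vec := (Z y 0 i)^-1 *: Z y.

Lemma affine_frame P W Z x : frame F P W Z x -> exists i W',
  [/\ frame F P W' (affine_lift Z i) x, W' `<=` W, forall y, W' y -> affine_lift Z i y 0 i = 1 &
   forall y, W' y -> exists2 k : C, k != 0 & forall v, Hf (affine_lift Z i) v y = k *: Hf Z v y].
Proof.
move=> fr; have [Wx lZ sZ g0] := fr; have [oW WP rZ] := lZ.
have Z0 y : W y -> Z y != 0 by exact: lifts_neq0 lZ.
have [i Zi] : exists i, Z x 0 i != 0.
  apply: contrapT => h; case/eqP: (Z0 x Wx); apply/rowP => i; rewrite mxE.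
  by apply: contrapT => /eqP h'; apply: h; exists i.
pose W' := W `&` [set y | Z y 0 i != 0].
have oW' : open W' by apply: csmooth_nz.
have sW : W' `<=` W by move=> y [].
have sZ' : csmoothr_on W' (affine_lift Z i).
  apply: csmoothrZ => //; last exact: csmoothr_sub sZ.
  by apply: csmoothV => //; [move=> y []|apply: csmooth_sub sW (sZ i)].
have HH y : W' y -> exists2 k : C, k != 0 & forall v, Hf (affine_lift Z i) v y = k *: Hf Z v y.
  move=> W'y; have [k [k0 _ Hk]] := @Hf_change _ _ W' W (affine_lift Z i) Z (fun y => y) y oW' W'y oW sZ' sZ
    (@smoothr_id _ W') sW (fun y h => Z0 y (sW y h))
    (fun y h => ex_intro2 _ _ (Z y 0 i)^-1 (invr_neq0 h.2) erefl).
  exists k; first exact: k0.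
  have dv v : 'D_v (fun y : 'rV[R]_2 => y) y = v by exact: derive_id.
  by move=> v; have := Hk v; rewrite dv.
exists i, W'; split=> //; last by move=> y [_ /= Zi0]; rewrite mxE mulVf.
split=> //.
- split=> // [y /sW /WP //|y [Wy /= Zy]]; apply: representsZ; first exact: invr_neq0.
  exact: rZ.
- move=> y W'y; have [k k0 Hk] := HH y W'y; have Wy := sW y W'y.
  apply: gram_neq0; first exact: csmoothr_cdiffr sZ' W'y.
  move=> v v0; rewrite Hk scaler_eq0 negb_or k0 /=.
  by apply: contra v0 => /eqP /(Hf_inj (csmoothr_cdiffr sZ Wy) (g0 y Wy)) ->.
Qed.

Local Transparent Hf.
Lemma cderiver_affine_inj W Z y v : csmoothr_on W Z -> W y -> gram Z y != 0 ->
  cderiver Z y v = 0 -> v = 0.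
Proof.
move=> sZ Wy g0 D0; apply: (Hf_inj (csmoothr_cdiffr sZ Wy) g0).
by have := horizontalZ (Z y) (0 : vec) 0; rewrite !scale0r => h; rewrite /Hf D0.
Qed.
Local Opaque Hf.

Lemma cderiver_affine_J W Z i y : open W -> csmoothr_on W Z -> W y ->
  (forall y, W y -> Z y 0 i = 1) -> (forall v, exists u, Hf Z u y = 'i%C *: Hf Z v y) ->
  forall v, exists u, cderiver Z y u = 'i%C *: cderiver Z y v.
Proof.
move=> oW sZ Wy Zi J v; have [u E] := J v; exists u.
have D0 w : cderiver Z y w 0 i = 0.
  rewrite mxE (cderive_on w oW Wy (g := fun=> 1)) ?cderive_cst // => z.
  by rewrite inE => /Zi.
move: E; rewrite !HfE => E.
exact: affine_cancel (Zi y Wy) (D0 u) (D0 v) E.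
Qed.

End AffineLift.

Section Charts.
Context {R : realType} {M : topologicalType} {n : nat}.
Variable F : M -> CP R n.
Variable A : set (param R M).
Local Notation C := R[i].
Local Notation Re := complex.Re.
Local Notation Im := complex.Im.
Local Notation vec := 'rV[C]_n.+1.
Implicit Types (Z : 'rV[R]_2 -> vec) (W : set 'rV[R]_2) (P Q : param R M).

Definition point2 (c : C) : 'rV[R]_2 := \row_j (if j == 0 then Re c else Im c).

Lemma point2K c : (point2 c 0 0 +i* point2 c 0 1) = c.
Proof. by rewrite !mxE /=; case: c. Qed.

Lemma point2E (y : 'rV[R]_2) : point2 (y 0 0 +i* y 0 1) = y.
Proof. by apply/rowP => j; rewrite mxE; have [->|->] := ord2_cases j. Qed.

Lemma smooth_point2 (U : set 'rV[R]_2) (f : 'rV[R]_2 -> C) : csmooth_on U f -> smoothr_on U (fun y => point2 (f y)).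
Proof.
move=> [h1 h2] j; under eq_fun do rewrite mxE.
by have [->|->] := ord2_cases j.
Qed.

(** A chart of the complex structure: the affine coordinates of F are holomorphic in
    it, and one of them is the coordinate itself. *)
Definition holo_chart Q := [/\ is_param Q,
  exists P k, [/\ A P, smoothr_on (pdom Q) k & forall y, pdom Q y -> pdom P (k y) /\ P (k y) = Q y]
  & exists i a Z, [/\ lifts F Q (pdom Q) Z, forall y, pdom Q y -> Z y 0 i = 1,
      forall y, pdom Q y -> Z y 0 a = y 0 0 +i* y 0 1
    & forall j, holomorphic_on (pdom Q) (fun y => Z y 0 j)]].

Lemma continuous_param P x V : is_param P -> pdom P x -> open V -> V (P x) ->
  exists U, [/\ open U, U x, U `<=` pdom P & forall y, U y -> V (P y)].
Proof.
move=> [oP cP _ _] Px oV Vx.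
have nU : nbhs x [set y | V (P y)] by apply: (cP x Px); exact: open_nbhs_nbhs.
have nP : nbhs x (pdom P) by exact: open_nbhs_nbhs.
have : nbhs x ([set y | V (P y)] `&` pdom P) by apply: filterI.
rewrite nbhsE => -[U [oU Ux] sU]; exists U; split=> //.
- by move=> y /sU [].
- by move=> y /sU [].
Qed.

(** In the target chart the component a of the lift with component i equal to 1 is the
    coordinate itself; this component is a quotient of components of any lift. *)
Lemma transition_quotient P Q W Z x y i a Z' : is_param P -> is_param Q ->
  lifts F P W Z -> W x -> pdom Q y -> P x = Q y ->
  lifts F Q (pdom Q) Z' -> (forall y, pdom Q y -> Z' y 0 i = 1) ->
  (forall y, pdom Q y -> Z' y 0 a = y 0 0 +i* y 0 1) ->
  exists U, [/\ open U, U x, U `<=` W, forall z, U z -> Z z 0 i != 0 &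
     forall z, U z -> pdom Q (point2 (Z z 0 a / Z z 0 i)) /\ Q (point2 (Z z 0 a / Z z 0 i)) = P z].
Proof.
move=> parP [oQ cQ injQ opQ] lZ Wx Qy PQ lZ' Zi Za.
have [oW WP rZ] := lZ.
have oV : open (Q @` pdom Q) by apply: opQ.
have [U [oU Ux UP UV]] := continuous_param parP (WP _ Wx) oV (ex_intro2 _ _ y Qy (esym PQ)).
have key z : (U `&` W) z -> Z z 0 i != 0 /\
    (pdom Q (point2 (Z z 0 a / Z z 0 i)) /\ Q (point2 (Z z 0 a / Z z 0 i)) = P z).
  move=> [Uz Wz]; have [y' Qy' Qy'E] := UV z Uz.
  have [k k0 E] := lifts_prop lZ' lZ Qy' Wz Qy'E.
  have Ei : Z z 0 i = k by rewrite E mxE Zi // mulr1.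
  have Ea : Z z 0 a = k * (y' 0 0 +i* y' 0 1) by rewrite E mxE Za.
  split; first by rewrite Ei.
  have -> : Z z 0 a / Z z 0 i = y' 0 0 +i* y' 0 1 by rewrite Ei Ea mulrC mulKf.
  by rewrite point2E.
exists (U `&` W); split.
- exact: openI.
- by split.
- by move=> z [].
- by move=> z /key [].
- by move=> z /key [].
Qed.

Lemma csmooth_quotient (U : set 'rV[R]_2) (f g : 'rV[R]_2 -> C) : open U -> csmooth_on U f -> csmooth_on U g ->
  (forall x, U x -> g x != 0) -> csmooth_on U (fun x => f x / g x).
Proof. by move=> oU sf sg g0; apply: csmoothM => //; apply: csmoothV. Qed.

Lemma holomorphic_quotient (U : set 'rV[R]_2) (f g : 'rV[R]_2 -> C) : open U ->
  holomorphic_on U f -> holomorphic_on U g ->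
  (forall x, U x -> g x != 0) -> holomorphic_on U (fun x => f x / g x).
Proof.
move=> oU [sf hf] [sg hg] g0; have sq := csmooth_quotient oU sf sg g0.
split=> // x Ux.
have gE v : cderive f x v = cderive (fun x => f x / g x) x v * g x + f x / g x * cderive g x v.
  rewrite -(cderiveM v (csmooth_cdiff sq Ux) (csmooth_cdiff sg Ux)).
  by apply: (cderive_on v oU Ux) => y; rewrite inE => /g0 gy; rewrite divfK.
apply: (mulIf (g0 x Ux)).
have := gE (delta_mx 0 1); rewrite (hf x Ux) (hg x Ux) (gE (delta_mx 0 0)).
move: (cderive _ x _) (cderive _ x _) (cderive g x _) => p q r.
rewrite mulrDr => /eqP; rewrite [X in _ + X]mulrCA mulrA.
by rewrite (inj_eq (addIr _)) => /eqP.
Qed.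

Lemma transition_holo Q1 Q2 : holo_chart Q1 -> holo_chart Q2 ->
  transition (fun W tau => smoothr_on W tau /\
    holomorphic_on W (fun x => tau x 0 0 +i* tau x 0 1)) Q1 Q2.
Proof.
move=> [par1 _ [i1 [a1 [Z1 [lZ1 _ _ hol1]]]]] [par2 _ [i [a [Z2 [lZ2 Zi Za _]]]]] x y Qx Qy E.
have [U [oU Ux UP Zi0 HU]] := transition_quotient par1 par2 lZ1 Qx Qy E lZ2 Zi Za.
have holU j : holomorphic_on U (fun y => Z1 y 0 j).
  by have [s1 h1] := hol1 j; split; [exact: csmooth_sub s1|move=> z /UP; exact: h1].
have hq := holomorphic_quotient oU (holU a) (holU i) Zi0.
exists U, (fun z => point2 (Z1 z 0 a / Z1 z 0 i)); split=> //.
split; first by apply: smooth_point2; case: hq.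
by under eq_fun do rewrite point2K.
Qed.

Hypothesis surf : smooth_surface A.
Hypothesis imm : immersion F A.

Lemma transition_into P Q : A P -> holo_chart Q -> transition (fun W tau => smoothr_on W tau) P Q.
Proof.
move=> AP [par2 _ [i [a [Z2 [lZ2 Zi Za _]]]]] x y Px Qy E.
have [_ _ [par _ _]] := surf.
have [W [Z [Wx lZ sZ _]]] := imm AP Px.
have [U [oU Ux UW Zi0 HU]] := transition_quotient (par P AP) par2 lZ Wx Qy E lZ2 Zi Za.
exists U, (fun z => point2 (Z z 0 a / Z z 0 i)); split=> //.
  by move=> z /UW; case: lZ => _ h _; exact: h.
apply: smooth_point2; apply: csmooth_quotient => //; exact: csmooth_sub UW (sZ _).
Qed.

Lemma transition_out P Q : A P -> holo_chart Q -> transition (fun W tau => smoothr_on W tau) Q P.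
Proof.
move=> AP [[oQ _ _ _] [P0 [k [AP0 sk kP]]] _] x y Qx Py E.
have [_ _ [_ _ tr]] := surf; have [k1 k2] := kP x Qx.
have [W [tau [oW Wk WP st Ht]]] := tr P0 P AP0 AP (k x) y k1 Py (etrans k2 E).
have oU := open_preimage_smooth oQ oW sk.
exists (pdom Q `&` k @^-1` W), (tau \o k); split=> //.
- move=> j; apply: (smooth_comp oU (U' := W) (tau := k) (f := fun z => tau z 0 j)) => //.
    by move=> z [].
  by move=> l; apply: smooth_sub (sk l) => z [].
move=> z [Qz Wz]; have [h1 h2] := Ht (k z) Wz; split=> //.
by rewrite h2; case: (kP z Qz).
Qed.

(** A coordinate function whose differential is complex linear for some complex
    structure on the plane and does not vanish is a local diffeomorphism. *)
Lemma coordinate_jac (f : 'rV[R]_2 -> C) x u : cdiff f x ->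
  cderive f x (delta_mx 0 0) != 0 -> cderive f x u = 'i%C * cderive f x (delta_mx 0 0) ->
  jac (fun y => point2 (f y)) x \in unitmx.
Proof.
move=> cf; rewrite unitmxE unitfE det2 !mxE.
have uE : u = u 0 0 *: delta_mx 0 0 + u 0 1 *: delta_mx 0 1.
  by apply/rowP => j; rewrite !mxE; have [->|->] := ord2_cases j; rewrite /= ?mulr1 ?mulr0 ?addr0 ?add0r.
rewrite uE (cderive_dirD _ _ cf) (cderive_dirZ _ _ cf) (cderive_dirZ _ _ cf).
have E0 : (fun y => point2 (f y) 0 0) = (fun y => Re (f y)) by apply/funext => y; rewrite mxE.
have E1 : (fun y => point2 (f y) 0 1) = (fun y => Im (f y)) by apply/funext => y; rewrite mxE.
rewrite E0 E1 /cderive.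
move: ('D_(delta_mx 0 0) _ x) ('D_(delta_mx 0 0) _ x) ('D_(delta_mx 0 1) _ x) ('D_(delta_mx 0 1) _ x).
move: (u 0 0) (u 0 1) => {uE E0 E1} p q b a d c n0.
move=> E; have h1 : p * a + q * c = - b.
  by have := congr1 (fun c : C => Re c) E; rewrite cReD !cReM /=; lra.
have h2 : p * b + q * d = a.
  by have := congr1 (fun c : C => Im c) E; rewrite cImD !cImM /=; lra.
apply/eqP => d0; case/eqP: n0.
have s0 : a ^+ 2 + b ^+ 2 = 0.
  transitivity (a * (p * b + q * d) - b * (p * a + q * c)); last first.
    by transitivity (q * (a * d - b * c)); [ring|rewrite d0 mulr0].
  by rewrite h1 h2; ring.
have a0 : a = 0.
  apply/eqP; rewrite -sqrf_eq0; apply/eqP; apply: le_anti; rewrite sqr_ge0 andbT -s0 lerDl sqr_ge0.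
  by [].
move: s0; rewrite a0 expr0n add0r => /eqP; rewrite sqrf_eq0 => /eqP ->.
by [].
Qed.

Lemma derive_coord (x v : 'rV[R]_2) l : 'D_v (fun y : 'rV[R]_2 => y 0 l) x = v 0 l.
Proof. by rewrite (derive_row (tau := fun y => y)) ?derive_id. Qed.

(** In the coordinate given by the component a of the lift, the complex structure of the
    tangent plane is multiplication by i, which is the Cauchy-Riemann equation. *)
Lemma holo_param W W2 V Z k a : open W2 -> W2 `<=` W -> open V ->
  csmoothr_on W Z ->
  smoothr_on W (fun y => point2 (Z y 0 a)) ->
  (forall x, W2 x -> V (point2 (Z x 0 a)) /\ k (point2 (Z x 0 a)) = x) ->
  (forall y, V y -> W2 (k y) /\ point2 (Z (k y) 0 a) = y) -> smoothr_on V k ->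
  (forall y, V y -> Z (k y) 0 a = y 0 0 +i* y 0 1) ->
  (forall y, W y -> forall v, exists u, cderiver Z y u = 'i%C *: cderiver Z y v) ->
  forall j, holomorphic_on V (fun y => Z (k y) 0 j).
Proof.
move=> oW2 W2W oV sZ sphi Wf Vk sk ZkE J j; pose phi (y : 'rV[R]_2) := point2 (Z y 0 a).
have VW2 y : V y -> W2 (k y) by case/Vk.
have VW y : V y -> W (k y) by move=> /VW2 /W2W.
split=> [|y Vy]; first exact: (csmoothr_comp oV VW sk sZ).
have dk : differentiable k y by exact: smoothr_diff sk Vy.
have Wky := VW _ Vy; have W2ky := VW2 _ Vy.
have cZ := csmoothr_cdiffr sZ Wky.
have Dk v : cderiver (fun y => Z (k y)) y v = cderiver Z (k y) ('D_v k y).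
  by rewrite cderiver_comp.
have [w Hw] := J (k y) Wky ('D_(delta_mx 0 0) k y).
have Dza v : cderiver Z (k y) ('D_v k y) 0 a = v 0 0 +i* v 0 1.
  rewrite -Dk mxE (cderive_on v oV Vy (g := fun y : 'rV[R]_2 => y 0 0 +i* y 0 1)); last first.
    by move=> z; rewrite inE => /ZkE.
  by rewrite /cderive /= !derive_coord.
have dphi : differentiable phi (k y) by exact: smoothr_diff sphi Wky.
have [_ fk] := Vk y Vy.
have kphi v : 'D_('D_v phi (k y)) k y = v.
  apply/rowP => l; rewrite -derive_row //.
  have dkl : differentiable (fun z => k z 0 l) (phi (k y)).
    by rewrite /phi fk; exact: smooth_diff (sk l) Vy.
  have := derive_comp_row v dphi dkl; rewrite {2}/phi fk => <-.
  rewrite -(derive_coord (k y) v l); apply: (eq_derive_on oW2); last by rewrite inE.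
  by move=> z; rewrite inE => W2z /=; have [_ ->] := Wf z W2z.
have Dphi v : 'D_v phi (k y) = point2 (cderiver Z (k y) v 0 a).
  apply/rowP => l; rewrite -derive_row // !mxE.
  by have [->|->] := ord2_cases l; rewrite /= /cderive /=; congr ('D_v _ _); apply/funext => z; rewrite mxE.
have wE : w = 'D_(delta_mx 0 1) k y.
  rewrite -(kphi w) Dphi Hw mxE Dza; congr ('D_(_) k y).
  apply/rowP => l; rewrite !mxE /=.
  by have [->|->] := ord2_cases l; rewrite /= ?cReM ?cImM /= ?mulr0 ?mul0r ?mulr1 ?subr0 ?addr0 ?add0r.
have E0 := Dk (delta_mx 0 0); have E1 := Dk (delta_mx 0 1).
rewrite -wE Hw -E0 in E1.
by have /rowP/(_ j) := E1; rewrite !mxE.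
Qed.

Lemma complex_point_chart p : complex_point F A p -> exists Q x, [/\ holo_chart Q, pdom Q x & Q x = p].
Proof.
move=> [P [W [Z [x [AP Px fr kg]]]]].
have [i [W' [fr' W'W Zi HH]]] := affine_frame fr.
set Z' := affine_lift Z i in fr' Zi HH.
have [_ _ [par _ _]] := surf; have [oP cP injP opP] := par P AP.
have [W'x lZ' sZ' g0] := fr'; have [oW' WP rZ'] := lZ'.
have J y : W' y -> forall v, exists u, cderiver Z' y u = 'i%C *: cderiver Z' y v.
  move=> W'y; apply: (cderiver_affine_J oW' sZ' W'y Zi) => v.
  have Wy := W'W _ W'y; have [k k0 Hk] := HH y W'y.
  have fry : frame F P W Z y by case: fr => _ h1 h2 h3; split.
  have [u Hu] := complex_frame fry (kg y Wy) v.
  by exists u; rewrite (Hk u) (Hk v) Hu scaler_swap.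
have D0 : cderiver Z' x (delta_mx 0 0) != 0.
  apply/eqP => /(cderiver_affine_inj sZ' W'x (g0 x W'x)) /matrixP/(_ 0 0)/eqP.
  by rewrite !mxE !eqxx oner_eq0.
have [a Da] : exists a, cderiver Z' x (delta_mx 0 0) 0 a != 0.
  apply: contrapT => h; case/eqP: D0; apply/rowP => j; rewrite [RHS]mxE.
  by apply: contrapT => /eqP h'; apply: h; exists j.
pose phi y := point2 (Z' y 0 a).
have sphi : smoothr_on W' phi by apply: smooth_point2; exact: sZ'.
have [u Hu] := J x W'x (delta_mx 0 0).
have uJ : jac phi x \in unitmx.
  apply: (@coordinate_jac (fun y => Z' y 0 a) x u).
  - exact: csmooth_cdiff (sZ' a) W'x.
  - by move: Da; rewrite mxE.
  - by have /rowP/(_ a) := Hu; rewrite !mxE.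
have [W2 [V [k [[oW2 W2x W2W oV] Wf Vk sk]]]] := inverse_function oW' W'x sphi uJ.
pose Q := Param V (P \o k).
have VW2 y : V y -> W2 (k y) by case/Vk.
have VW y : V y -> W' (k y) by move=> /VW2 /W2W.
exists Q, (phi x); have [Vx kx] := Wf x W2x; split=> //; last by rewrite /Q /= kx.
split.
- split=> /=.
  + exact: oV.
  + move=> y Vy; apply: continuous_comp.
      by apply: differentiable_continuous; exact: smoothr_diff sk Vy.
    by apply: cP; apply: WP; exact: VW.
  + move=> y z Vy Vz E; have := injP _ _ (WP _ (VW _ Vy)) (WP _ (VW _ Vz)) E.
    by move=> kyz; have [_ <-] := Vk y Vy; have [_ <-] := Vk z Vz; rewrite kyz.
  + move=> U oU UV.
    have -> : (P \o k) @` U = P @` (W2 `&` phi @^-1` U).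
      apply/seteqP; split=> q [y Hy <-].
        exists (k y) => //; have [h1 h2] := Vk y (UV _ Hy); split=> //.
        by rewrite /preimage /= h2.
      by case: Hy => W2y Uy; exists (phi y) => //=; have [_ ->] := Wf y W2y.
    apply: opP; last by move=> y [/W2W /WP].
    apply: open_preimage_smooth => // j; exact: smooth_sub W2W (sphi j).
- exists P, k; split=> // y Vy; split=> //; by apply: WP; exact: VW.
have ZkE y : V y -> Z' (k y) 0 a = y 0 0 +i* y 0 1.
  by move=> Vy; have [_ fk] := Vk y Vy; rewrite -{2 3}fk point2K.
have sZk : csmoothr_on V (fun y => Z' (k y)) by exact: (csmoothr_comp oV VW sk sZ').
exists i, a, (fun y => Z' (k y)); split.
- split=> // y Vy; exact: rZ' (VW _ Vy).
- by move=> y /VW; exact: Zi.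
- exact: ZkE.
move=> j; exact: (holo_param oW2 W2W oV sZ' sphi Wf Vk sk ZkE).
Qed.

Theorem complex_points_holomorphic : (forall p, complex_point F A p) -> holomorphic_curve F A.
Proof.
move=> cplx; exists holo_chart; split.
- split=> [Q [] //|p|Q1 Q2]; last exact: transition_holo.
  by have [Q [x [hQ Qx E]]] := complex_point_chart (cplx p); exists Q, x.
- by move=> P Q AP hQ; split; [exact: transition_into|exact: transition_out].
move=> Q x [_ _ [i [a [Z [lZ _ _ hol]]]]] Qx.
by exists (pdom Q), Z.
Qed.

End Charts.

(** * The real form spanned by a totally real frame *)
Section MatrixCalculus.
Context {R : realType} {V : normedModType R}.
Local Notation C := R[i].
Local Notation conjm := (map_mx (@conjc R)).

Definition cdiffm p q (A : V -> 'M[C]_(p, q)) x := forall i j, cdiff (fun y => A y i j) x.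
Definition mder p q (A : V -> 'M[C]_(p, q)) x v : 'M[C]_(p, q) :=
  \matrix_(i, j) cderive (fun y => A y i j) x v.

Lemma mderM p q r (A : V -> 'M[C]_(p, q)) (B : V -> 'M[C]_(q, r)) x v : cdiffm A x -> cdiffm B x ->
  mder (fun y => A y *m B y) x v = mder A x v *m B x + A x *m mder B x v.
Proof.
move=> dA dB; apply/matrixP => i j; rewrite mxE.
under eq_fun do rewrite mxE.
rewrite cderive_sum => [|k]; last exact: cdiffM.
rewrite 3!mxE -big_split; apply: eq_bigr => k _.
by rewrite cderiveM // !mxE.
Qed.

Lemma cdiffmM p q r (A : V -> 'M[C]_(p, q)) (B : V -> 'M[C]_(q, r)) x : cdiffm A x -> cdiffm B x ->
  cdiffm (fun y => A y *m B y) x.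
Proof.
move=> dA dB i j; under eq_fun do rewrite mxE.
by apply: cdiff_sum => k; apply: cdiffM.
Qed.

Lemma cdiffm_tr p q (A : V -> 'M[C]_(p, q)) x : cdiffm A x -> cdiffm (fun y => (A y)^T) x.
Proof. by move=> dA i j; under eq_fun do rewrite mxE; apply: dA. Qed.

Lemma cdiffm_conj p q (A : V -> 'M[C]_(p, q)) x : cdiffm A x -> cdiffm (fun y => conjm (A y)) x.
Proof. by move=> dA i j; under eq_fun do rewrite mxE; apply: cdiffJ. Qed.

Lemma mder_tr p q (A : V -> 'M[C]_(p, q)) x v : mder (fun y => (A y)^T) x v = (mder A x v)^T.
Proof. by apply/matrixP => i j; rewrite !mxE; apply: eq_cderive => y; rewrite mxE. Qed.

Lemma mder_conj p q (A : V -> 'M[C]_(p, q)) x v : cdiffm A x ->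
  mder (fun y => conjm (A y)) x v = conjm (mder A x v).
Proof.
move=> dA; apply/matrixP => i j; rewrite !mxE -cderiveJ //.
by apply: eq_cderive => y; rewrite mxE.
Qed.

Lemma mder_on (U : set V) p q (A B : V -> 'M[C]_(p, q)) x v : open U -> U x ->
  (forall y, U y -> A y = B y) -> mder A x v = mder B x v.
Proof.
move=> oU Ux E; apply/matrixP => i j; rewrite !mxE; apply: (cderive_on v oU Ux) => y.
by rewrite inE => /E ->.
Qed.

End MatrixCalculus.

Section RealStructure.
Context {R : realType}.
Local Notation C := R[i].
Local Notation conjm := (map_mx (@conjc R)).
Local Notation toC := (map_mx (real_complex R)).

(** Q = \sum_k v_k^T v_k for an orthonormal basis v_k of the real span of the rows of
    f, when their Hermitian products are real.  It determines this span and, unlike a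
    basis, is canonical; the equations say that Q comes from the span and that
    conj v Q = v for all v in it. *)
Definition is_real_form p n (f : 'M[C]_(p, n)) (Q : 'M[C]_n) :=
  conjm f *m Q = f /\ exists Y, Q = f^T *m Y *m f.

Lemma conjmM p q r (A : 'M[C]_(p, q)) (B : 'M[C]_(q, r)) : conjm (A *m B) = conjm A *m conjm B.
Proof. exact: (map_mxM (@conjc R)). Qed.

Lemma conjm_real p q (A : 'M[R]_(p, q)) : conjm (toC A) = toC A.
Proof. by apply/matrixP => i j; rewrite !mxE conjcR. Qed.

Lemma frame_form_eq0 p n (f : 'M[C]_(p, n)) (D : 'M[C]_n) (Y' : 'M[C]_p) : conjm f *m f^T \in unitmx ->
  D = f^T *m Y' *m f -> conjm f *m D = 0 -> D = 0.
Proof.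
move=> uK -> h; have : Y' *m f = 0.
  by rewrite -[LHS](mulKmx uK) -mulmxA [f^T *m _]mulmxA h mulmx0.
by move=> E; rewrite -mulmxA E mulmx0.
Qed.

Lemma conjm_scalar n (a : C) : conjm (a%:M : 'M[C]_n) = (a^*%C)%:M.
Proof. by apply/matrixP => i j; rewrite !mxE; case: eqP => _; rewrite ?mulr1n ?mulr0n ?conjc0. Qed.

Lemma Q_form_alg p n (f : 'M[C]_(p, n)) (E S S' : 'M[C]_p) :
  (f^T *m E^T *m S + f^T *m S') *m f + f^T *m S *m (E *m f) =
  f^T *m (E^T *m S + S' + S *m E) *m f.
Proof. by rewrite !mulmxDr !mulmxDl !mulmxA. Qed.

(** The real combination G moves f inside its real span and does not change Q; the
    common scalar a multiplies f by a phase up to a real factor.  The proof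
    differentiates the equation conj f Q = f, by which Q is determined. *)
Lemma real_form_derive (V : normedModType R) p n (f : V -> 'M[C]_(p, n)) (Q : V -> 'M[C]_n)
    (S : V -> 'M[C]_p) (U : set V) x v (a : C) (G : 'M[R]_p) :
  open U -> U x -> cdiffm f x -> cdiffm S x ->
  (forall y, U y -> Q y = (f y)^T *m S y *m f y) ->
  (forall y, U y -> conjm (f y) *m Q y = f y) ->
  conjm (f x) *m (f x)^T \in unitmx ->
  mder f x v = (a%:M + toC G) *m f x ->
  mder Q x v = (a - a^*%C) *: Q x.
Proof.
move=> oU Ux df dS QE fQ uK dfE; set E := a%:M + toC G in dfE.
have dft := cdiffm_tr df; have dfS := cdiffmM dft dS.
have dQ : mder Q x v = (f x)^T *m (E^T *m S x + mder S x v + S x *m E) *m f x.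
  rewrite (mder_on v oU Ux QE) (mderM v dfS df) (mderM v dft dS) mder_tr dfE trmx_mul.
  exact: Q_form_alg.
have cQ : cdiffm Q x.
  have h := cdiffmM dfS df => i j.
  by apply: (cdiff_on oU Ux _ (h i j)) => y; rewrite inE => /QE ->.
have h1 : conjm (f x) *m mder Q x v = (a - a^*%C) *: (conjm (f x) *m Q x).
  have := mder_on v oU Ux fQ; rewrite (mderM v (cdiffm_conj df) cQ) (mder_conj v df) dfE.
  rewrite conjmM map_mxD conjm_scalar conjm_real -mulmxA fQ // => /eqP.
  rewrite addrC eq_sym -subr_eq => /eqP <-.
  by rewrite /E !mulmxDl !mul_scalar_mx opprD addrACA subrr addr0 scalerBl.
apply/eqP; rewrite -subr_eq0; apply/eqP.
apply: (@frame_form_eq0 _ _ (f x) _ (E^T *m S x + mder S x v + S x *m E - (a - a^*%C) *: S x) uK).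
  rewrite dQ (QE x Ux) mulmxBr mulmxBl -scalemxAr -scalemxAl.
  by [].
by rewrite mulmxBr h1 -scalemxAr subrr.
Qed.

Lemma zero_derive_const (f : 'rV[R]_2 -> R) (x : 'rV[R]_2) (e : R) y :
  (forall z, ball x e z -> differentiable f z) ->
  (forall z v, ball x e z -> 'D_v f z = 0) -> ball x e y -> f y = f x.
Proof.
move=> df Df xy.
have inb s : 0 <= s <= 1 -> ball x e (x + s *: (y - x)).
  move=> /andP[s0 s1]; move: xy; rewrite -!ball_normE /ball_ /= opprD addNKr normrN normrZ.
  rewrite ger0_norm // distrC; apply: le_lt_trans.
  by rewrite ler_piMl.
have [s /andP[s0 s1]] := @mvt_line _ _ f x (y - x) 1 ltr01 (fun s hs => df _ (inb s hs)).
rewrite Df; last by apply: inb; rewrite !ltW.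
by rewrite mulr0 scale1r [x + _]addrC subrK => /eqP; rewrite subr_eq0 => /eqP.
Qed.

Lemma zero_cderive_const (f : 'rV[R]_2 -> C) (x : 'rV[R]_2) (e : R) y :
  csmooth_on (ball x e) f ->
  (forall z j, ball x e z -> cderive f z (delta_mx 0 j) = 0) -> ball x e y -> f y = f x.
Proof.
move=> sf Df xy.
have Dv z v : ball x e z -> cderive f z v = 0.
  move=> Bz; have vE : v = v 0 0 *: delta_mx 0 0 + v 0 1 *: delta_mx 0 1.
    by apply/rowP => j; rewrite !mxE; have [->|->] := ord2_cases j; rewrite /= ?mulr1 ?mulr0 ?addr0 ?add0r.
  have cf := csmooth_cdiff sf Bz.
  by rewrite vE (cderive_dirD _ _ cf) !(cderive_dirZ _ _ cf) !Df // !mulr0 addr0.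
apply: complex_ext.
  apply: (@zero_derive_const (fun z => complex.Re (f z)) x e) => // z.
    by move=> Bz; case: (csmooth_cdiff sf Bz).
  by move=> v Bz; exact: (congr1 (fun c : C => complex.Re c) (Dv z v Bz)).
apply: (@zero_derive_const (fun z => complex.Im (f z)) x e) => // z.
  by move=> Bz; case: (csmooth_cdiff sf Bz).
by move=> v Bz; exact: (congr1 (fun c : C => complex.Im c) (Dv z v Bz)).
Qed.

Lemma quotient_derive0 (p q d k : C) : q != 0 -> k * p = d * q + p / q * (k * q) -> d = 0.
Proof.
move=> q0; have -> : p / q * (k * q) = k * p by field.
move=> /eqP; rewrite -subr_eq subrr eq_sym mulf_eq0 (negPf q0) orbF => /eqP.
by [].
Qed.

(** The quotients of the entries of Q by a nonzero one have zero derivative. *)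
Lemma form_locally_const n (Q : 'rV[R]_2 -> 'M[C]_n) (W : set 'rV[R]_2) x : open W -> W x ->
  (forall i j, csmooth_on W (fun y => Q y i j)) ->
  (forall y l, W y -> exists k, mder Q y (delta_mx 0 l) = k *: Q y) -> Q x != 0 ->
  exists W', [/\ open W', W' x, W' `<=` W & forall y, W' y -> exists2 k : C, k != 0 & Q y = k *: Q x].
Proof.
move=> oW Wx sQ DQ Qx0.
have [a [b qx]] : exists a b, Q x a b != 0.
  apply: contrapT => h; case/eqP: Qx0; apply/matrixP => i j; rewrite mxE.
  by apply: contrapT => /eqP h'; apply: h; exists i, j.
pose q (y : 'rV[R]_2) : C := Q y a b.
have oU : open (W `&` [set y | q y != 0]) by exact: (csmooth_nz oW (sQ a b)).
have nU : nbhs x (W `&` [set y | q y != 0]) by apply: open_nbhs_nbhs; split.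
have [e /= e0 eU] := (nbhs_ballP _ _).1 nU.
exists (ball x e); split.
- exact: ball_open.
- exact: ballxx.
- by move=> y /eU [].
move=> y By; have [Wy qy] := eU y By.
have oB : open (ball x e) by exact: ball_open.
have BW : ball x e `<=` W by move=> z /eU [].
exists (q y / q x); first by rewrite mulf_neq0 // invr_eq0.
apply/matrixP => i j; rewrite mxE.
have sq : csmooth_on (ball x e) (fun z => Q z i j / q z).
  apply: csmooth_quotient => //; [exact: csmooth_sub BW (sQ i j)|exact: csmooth_sub BW (sQ a b)|].
  by move=> z /eU [].
have : Q y i j / q y = Q x i j / q x.
  apply: (zero_cderive_const sq) => // z l Bz; have [Wz qz] := eU z Bz.
  have [k Dk] := DQ z l Wz.
  have DE c d : cderive (fun y => Q y c d) z (delta_mx 0 l) = k * Q z c d.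
    by have /matrixP/(_ c d) := Dk; rewrite !mxE.
  have := cderiveM (delta_mx 0 l) (csmooth_cdiff sq Bz) (csmooth_cdiff (sQ a b) Wz).
  rewrite (cderive_on _ oB Bz (g := fun y => Q y i j)); last first.
    by move=> w; rewrite inE => /eU [_ qw]; rewrite divfK.
  rewrite !DE; exact: quotient_derive0.
move=> E; have qx' : q x != 0 by exact: qx.
have qy' : q y != 0 by exact: qy.
by apply: (mulIf (invr_neq0 qy')); rewrite E; field; rewrite qx' qy'.
Qed.

End RealStructure.

Lemma sub_add3 (V : zmodType) (x a b c : V) : x = x - a - b - c + (a + b + c).
Proof. by rewrite -(addrA x (- a) (- b)) -opprD -(addrA x (- (a + b)) (- c)) -opprD subrK. Qed.

Lemma sum_ord2 (V : nmodType) (f : 'I_2 -> V) : \sum_i f i = f 0 + f 1.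
Proof.
rewrite !big_ord_recl big_ord0 addr0; congr (_ + f _).
exact: val_inj.
Qed.

Section RealFrames.
Context {R : realType} {n : nat}.
Local Notation C := R[i].
Local Notation Re := complex.Re.
Local Notation Im := complex.Im.
Local Notation conjm := (map_mx (@conjc R)).
Local Notation toC := (map_mx (real_complex R)).
Local Notation vec := 'rV[C]_n.+1.
Implicit Types (Z : 'rV[R]_2 -> vec) (W : set 'rV[R]_2) (y : 'rV[R]_2).

Lemma hdot_residual (eta X z h0 h1 : vec) (s : C) (c0 c1 : R) :
  X = eta + (s *: z + c0%:C *: h0 + c1%:C *: h1) ->
  hdot eta z = 0 -> Re (hdot eta h0) = 0 -> Re (hdot eta h1) = 0 -> Re (hdot eta X) = 0 ->
  Re (hdot eta eta) = 0.
Proof.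
move=> -> o n0 n1; rewrite hdotDr cReD hdotDr cReD hdotDr cReD (hdotZr s) o mulr0.
by rewrite (Re_hdotZr c0) (Re_hdotZr c1) n0 n1 !mulr0 !addr0.
Qed.

(** A vector orthogonal to all normals is equal to its tangential part. *)
Lemma proj_normal_eq0 (X z h0 h1 : vec) : z != 0 -> hdot h0 z = 0 -> hdot h1 z = 0 ->
  Re (hdot h0 h0) * Re (hdot h1 h1) - Re (hdot h0 h1) ^+ 2 != 0 ->
  (forall eta, hdot eta z = 0 -> Re (hdot eta h0) = 0 -> Re (hdot eta h1) = 0 -> Re (hdot eta X) = 0) ->
  exists c0 c1 : R, X = (hdot X z / hdot z z) *: z + c0%:C *: h0 + c1%:C *: h1.
Proof.
move=> z0 e0 e1 d0 HX.
have o := proj_normal_orth X z0 e0 e1; have [n0 n1] := proj_normal_normal X e0 e1 d0.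
have := HX _ o n0 n1; move: o n0 n1; rewrite /proj_normal.
set s := hdot X z / hdot z z.
set c0 := (X in X%:C *: h0); set c1 := (X in X%:C *: h1).
set eta := X - _ - _ - _ => o n0 n1 hX.
have XE : X = eta + (s *: z + c0%:C *: h0 + c1%:C *: h1).
  exact: sub_add3.
have := hdot_residual XE o n0 n1 hX.
move/eqP; rewrite hdotxx_eq0 => /eqP eta0.
by exists c0, c1; rewrite {1}XE eta0 add0r.
Qed.

(** Where the Kaehler form vanishes, Z and its two horizontal derivatives span a real
    space of dimension 3 on which the Hermitian product is real. *)
Definition frame_vec Z (r : 'I_(1 + 2)) y : vec :=
  match fintype.split r with inl _ => Z y | inr l => Hf Z (delta_mx 0 l) y end.

Definition frame_mx Z y : 'M[C]_(1 + 2, n.+1) := \matrix_r frame_vec Z r y.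

Lemma frame_vecl Z a y : frame_vec Z (lshift 2 a) y = Z y.
Proof. by rewrite /frame_vec split_l. Qed.
Lemma frame_vecr Z l y : frame_vec Z (rshift 1 l) y = Hf Z (delta_mx 0 l) y.
Proof. by rewrite /frame_vec split_r. Qed.

Lemma sum_frame_vec Z (G : 'I_(1 + 2) -> C) y : \sum_k G k *: frame_vec Z k y =
  G (lshift 2 0) *: Z y + (G (rshift 1 0) *: Hf Z (delta_mx 0 0) y + G (rshift 1 1) *: Hf Z (delta_mx 0 1) y).
Proof.
rewrite big_split_ord big_ord1 frame_vecl; congr (_ + _).
by rewrite sum_ord2 !frame_vecr.
Qed.

Definition frame_gram Z y : 'M[R]_(1 + 2) := \matrix_(r, s) Re (hdot (frame_vec Z r y) (frame_vec Z s y)).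

(** The second fundamental form vanishes. *)
Definition flat_at Z y := forall xi j l, hdot xi (Z y) = 0 ->
  (forall k, Re (hdot xi (Hf Z (delta_mx 0 k) y)) = 0) ->
  Re (hdot xi (cov Z (delta_mx 0 j) (Hf Z (delta_mx 0 l)) y)) = 0.

Section OnOpen.
Variables (W : set 'rV[R]_2) (Z : 'rV[R]_2 -> vec).
Hypotheses (oW : open W) (sZ : csmoothr_on W Z) (Z0 : forall y, W y -> Z y != 0).
Hypothesis g0 : forall y, W y -> gram Z y != 0.

Lemma smooth_frame_vec r : csmoothr_on W (frame_vec Z r).
Proof.
case: (split_ordP r) => l ->.
  by have -> : frame_vec Z (lshift 2 l) = Z by apply/funext => y; rewrite frame_vecl.
have -> : frame_vec Z (rshift 1 l) = Hf Z (delta_mx 0 l) by apply/funext => y; rewrite frame_vecr.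
exact: csmoothr_Hf.
Qed.

Lemma Hf_orth l y : W y -> hdot (Hf Z (delta_mx 0 l) y) (Z y) = 0.
Proof. by move=> Wy; apply: horizontal_orth; apply: Z0. Qed.

Lemma hdot_frame_vec r s y : W y -> kahler_form Z y = 0 ->
  hdot (frame_vec Z r y) (frame_vec Z s y) = (frame_gram Z y r s)%:C.
Proof.
move=> Wy k0; rewrite mxE; apply: complex_ext => //; rewrite [RHS]/=.
case: (split_ordP r) => l ->; case: (split_ordP s) => m ->; rewrite ?frame_vecl ?frame_vecr.
- exact: Im_hdotxx.
- by rewrite hdotC (Hf_orth _ Wy) conjc0.
- by rewrite (Hf_orth _ Wy).
have [->|->] := ord2_cases l; have [->|->] := ord2_cases m.
- exact: Im_hdotxx.
- exact: k0.
- by rewrite Im_hdotC; have := k0; rewrite /kahler_form => ->; rewrite oppr0.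
- exact: Im_hdotxx.
Qed.

Lemma frame_gram_unit y : W y -> frame_gram Z y \in unitmx.
Proof.
move=> Wy; have zz := hdotxx_gt0 (Z0 Wy).
have -> : frame_gram Z y = block_mx (Re (hdot (Z y) (Z y)))%:M 0 0
    (\matrix_(j, l) Re (hdot (Hf Z (delta_mx 0 j) y) (Hf Z (delta_mx 0 l) y))).
  rewrite -[LHS]submxK; congr block_mx; apply/matrixP => j l; rewrite !mxE ?frame_vecl ?frame_vecr.
  - by rewrite !ord1 eqxx mulr1n.
  - by rewrite hdotC (Hf_orth _ Wy) conjc0.
  - by rewrite (Hf_orth _ Wy).
  - by [].
rewrite unitmxE det_ublock det_scalar1 unitfE mulf_neq0 //; first by rewrite gt_eqF.
by rewrite det_gram; exact: g0 Wy.
Qed.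

Lemma mul_frame_mx y : W y -> kahler_form Z y = 0 -> conjm (frame_mx Z y) *m (frame_mx Z y)^T = toC (frame_gram Z y).
Proof.
move=> Wy k0; apply/matrixP => r s; rewrite [RHS]mxE.
have -> : frame_gram Z y r s = frame_gram Z y s r by rewrite !mxE Re_hdotC.
rewrite -(hdot_frame_vec s r Wy k0) mxE.
transitivity (\sum_j frame_vec Z s y 0 j * (frame_vec Z r y 0 j)^*%C); last by [].
by apply: eq_bigr => j _; rewrite !mxE mulrC.
Qed.

Definition real_form y : 'M[C]_n.+1 := (frame_mx Z y)^T *m toC (invmx (frame_gram Z y)) *m frame_mx Z y.

Lemma real_formP y : W y -> kahler_form Z y = 0 -> is_real_form (frame_mx Z y) (real_form y).
Proof.
move=> Wy k0; split; last by exists (toC (invmx (frame_gram Z y))).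
rewrite /real_form !mulmxA (mul_frame_mx Wy k0) -map_mxM mulmxV; last exact: frame_gram_unit.
by rewrite map_mx1 mul1mx.
Qed.

(** The second fundamental form being 0, covariant derivatives of the frame have only
    components along Z, which are real as products of frame vectors, and tangential
    ones, with real coefficients. *)
Lemma cov_frame_vec y l r : W y -> kahler_form Z y = 0 -> flat_at Z y ->
  exists G : 'rV[R]_(1 + 2), cov Z (delta_mx 0 l) (frame_vec Z r) y = \sum_k (G 0 k)%:C *: frame_vec Z k y.
Proof.
move=> Wy k0 fl.
have sumE (G : 'rV[R]_(1 + 2)) : \sum_k (G 0 k)%:C *: frame_vec Z k y =
    (G 0 (lshift 2 0))%:C *: Z y + ((G 0 (rshift 1 0))%:C *: Hf Z (delta_mx 0 0) y +
     (G 0 (rshift 1 1))%:C *: Hf Z (delta_mx 0 1) y).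
  exact: (sum_frame_vec Z (fun k => (G 0 k)%:C) y).
case: (split_ordP r) => j ->.
  have -> : frame_vec Z (lshift 2 j) = Z by apply/funext => z; rewrite frame_vecl.
  exists (row_mx 0 (delta_mx 0 l)); rewrite sumE !row_mxEr row_mxEl !mxE.
  rewrite scale0r add0r; have [->|->] := ord2_cases l; rewrite /= ?scale1r ?scale0r ?addr0 ?add0r.
    by [].
  by [].
have -> : frame_vec Z (rshift 1 j) = Hf Z (delta_mx 0 j) by apply/funext => z; rewrite frame_vecr.
have [|c0 [c1 E]] := @proj_normal_eq0 (cov Z (delta_mx 0 l) (Hf Z (delta_mx 0 j)) y) (Z y)
  (Hf Z (delta_mx 0 0) y) (Hf Z (delta_mx 0 1) y) (Z0 Wy) (Hf_orth 0 Wy) (Hf_orth 1 Wy) (g0 Wy).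
  move=> eta ez e0 e1; apply: (fl eta l j ez) => k.
  by have [->|->] := ord2_cases k; [exact: e0|exact: e1].
have sH := csmoothr_Hf oW sZ Z0 (delta_mx 0 j).
have cZ := cov_orth sZ (delta_mx 0 l) oW Wy (@subset_refl _ _) sH (fun z => @Hf_orth j z).
have [s Es] : exists s : R, hdot (cov Z (delta_mx 0 l) (Hf Z (delta_mx 0 j)) y) (Z y) / hdot (Z y) (Z y) = s%:C.
  have := hdot_frame_vec (rshift 1 j) (rshift 1 l) Wy k0; rewrite !frame_vecr => hjl.
  exists (- frame_gram Z y (rshift 1 j) (rshift 1 l) / Re (hdot (Z y) (Z y))).
  by rewrite [LHS](congr1 (fun c => c / _) cZ) hjl (hdotxx_real (Z y)) rmorphM rmorphN fmorphV.
exists (row_mx s%:M (\row_k (if k == 0 then c0 else c1))).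
rewrite sumE !row_mxEr row_mxEl !mxE eqxx mulr1n -Es addrA.
exact: E.
Qed.

Lemma mder_frame_mx y l : W y -> kahler_form Z y = 0 -> flat_at Z y ->
  exists G : 'M[R]_(1 + 2), mder (frame_mx Z) y (delta_mx 0 l) =
    ((conn Z (delta_mx 0 l) y)%:M + toC G) *m frame_mx Z y.
Proof.
move=> Wy k0 fl.
have /choice [G HG] := fun r => cov_frame_vec l r Wy k0 fl.
exists (\matrix_r G r); rewrite mulmxDl mul_scalar_mx; apply/row_matrixP => r.
have rE : row r (frame_mx Z y) = frame_vec Z r y by rewrite rowK.
have -> : row r (mder (frame_mx Z) y (delta_mx 0 l)) = cderiver (frame_vec Z r) y (delta_mx 0 l).
  by apply/rowP => j; rewrite !mxE; apply: eq_cderive => z; rewrite mxE.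
have -> : cderiver (frame_vec Z r) y (delta_mx 0 l) =
   conn Z (delta_mx 0 l) y *: frame_vec Z r y + cov Z (delta_mx 0 l) (frame_vec Z r) y.
  by rewrite /cov addrC subrK.
rewrite HG linearD linearZ /= rE; congr (_ + _).
rewrite row_mul mulmx_sum_row; apply: eq_bigr => k _.
by rewrite rowK !mxE.
Qed.

Lemma csmooth_inv_frame_gram r s : csmooth_on W (fun y => (invmx (frame_gram Z y) r s)%:C).
Proof.
apply: csmoothR; apply/smooth_onP => k; apply: Ck_invmx => //; last exact: frame_gram_unit.
move=> a b; under eq_fun do rewrite mxE.
by move: k; apply/smooth_onP; apply: csmooth_Re; apply: csmooth_hdot => //; exact: smooth_frame_vec.
Qed.

Lemma mder_real_form y l : W y -> (forall z, W z -> kahler_form Z z = 0 /\ flat_at Z z) ->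
  exists k, mder real_form y (delta_mx 0 l) = k *: real_form y.
Proof.
move=> Wy KF; have [k0 fl] := KF y Wy.
have [G HG] := mder_frame_mx l Wy k0 fl.
exists (conn Z (delta_mx 0 l) y - (conn Z (delta_mx 0 l) y)^*%C).
apply: (real_form_derive oW Wy _ _ (fun z _ => erefl (real_form z)) _ _ HG).
- by move=> r j; under eq_fun do rewrite mxE; apply: csmooth_cdiff (smooth_frame_vec r j) Wy.
- by move=> r s; under eq_fun do rewrite mxE; apply: csmooth_cdiff (csmooth_inv_frame_gram r s) Wy.
- by move=> z Wz; have [kz _] := KF z Wz; have [] := real_formP Wz kz.
- by rewrite mul_frame_mx // map_unitmx frame_gram_unit.
Qed.

Lemma csmooth_real_form i j : csmooth_on W (fun y => real_form y i j).
Proof.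
rewrite /real_form; under eq_fun do rewrite mxE.
apply: csmooth_sum => // k; under eq_fun do rewrite mxE.
apply: csmoothM => //; last by under eq_fun do rewrite mxE; exact: smooth_frame_vec.
apply: csmooth_sum => // s; apply: csmoothM => //.
  by under eq_fun do rewrite !mxE; exact: smooth_frame_vec.
by under eq_fun do rewrite mxE; exact: csmooth_inv_frame_gram.
Qed.

Lemma real_form_neq0 y : W y -> kahler_form Z y = 0 -> real_form y != 0.
Proof.
move=> Wy k0; apply/eqP => Q0; have [E _] := real_formP Wy k0.
have /eqP := Z0 Wy; apply; rewrite -(frame_vecl Z ord0 y).
have -> : frame_vec Z (lshift 2 ord0) y = row (lshift 2 ord0) (frame_mx Z y) by rewrite rowK.
by rewrite -E Q0 mulmx0 linear0.
Qed.

End OnOpen.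

End RealFrames.

(** * Totally real tangent planes: the real projective plane *)
Section RealForms.
Context {R : realType}.
Local Notation C := R[i].
Local Notation conjm := (map_mx (@conjc R)).
Local Notation toC := (map_mx (real_complex R)).

Lemma is_real_form_unique p n (f : 'M[C]_(p, n)) Q1 Q2 : conjm f *m f^T \in unitmx ->
  is_real_form f Q1 -> is_real_form f Q2 -> Q1 = Q2.
Proof.
move=> uK [h1 [Y1 E1]] [h2 [Y2 E2]]; apply/eqP; rewrite -subr_eq0; apply/eqP.
apply: (@frame_form_eq0 _ _ _ f _ (Y1 - Y2) uK); last by rewrite mulmxBr h1 h2 subrr.
by rewrite E1 E2 mulmxBr mulmxBl.
Qed.

Lemma is_real_form_change p n (f f' : 'M[C]_(p, n)) (G : 'M[R]_p) (c : C) Q Q' : c != 0 ->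
  conjm f *m f^T \in unitmx -> conjm f' *m f'^T \in unitmx -> f' = c *: (toC G *m f) ->
  is_real_form f Q -> is_real_form f' Q' -> exists2 k : C, k != 0 & Q' = k *: Q.
Proof.
move=> c0 uK uK' E iQ [h' [Y' E']].
have cc0 : c^*%C != 0 by rewrite conjc_eq0.
have cE : conjm f' = c^*%C *: (toC G *m conjm f).
  by rewrite E map_mxZ conjmM conjm_real.
have uG : toC G \in unitmx.
  move: uK'; rewrite cE -scalemxAl unitmxZ ?unitfE // -mulmxA unitmx_mul.
  by case/andP.
have kE : is_real_form f ((c^*%C / c) *: Q').
  split.
    apply: (can_inj (mulKmx uG)); rewrite -scalemxAr -scalemxAr.
    have : (c^*%C *: (toC G *m conjm f)) *m Q' = c *: (toC G *m f) by rewrite -cE h' E.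
    rewrite -scalemxAl mulmxA => h; rewrite mulrC -scalerA h scalerA mulVf //.
    by rewrite scale1r.
  exists ((c^*%C / c * (c * c)) *: ((toC G)^T *m Y' *m toC G)).
  have tr : (c *: (toC G *m f))^T = c *: (f^T *m (toC G)^T) by rewrite linearZ /= trmx_mul.
  have fE : f'^T *m Y' *m f' = (c * c) *: (f^T *m ((toC G)^T *m Y' *m toC G) *m f).
    by rewrite E tr -!scalemxAl -!scalemxAr scalerA !mulmxA.
  by rewrite E' fE scalerA -scalemxAr -scalemxAl.
exists (c / c^*%C); first by rewrite mulf_neq0 // invr_eq0.
rewrite (is_real_form_unique uK iQ kE) scalerA.
have -> : c / c^*%C * (c^*%C / c) = 1 by field; rewrite cc0 c0.
by rewrite scale1r.
Qed.

(** Gram-Schmidt for three vectors, the first being orthogonal to the other two. *)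
Lemma normalize_gram (a g0 g1 g2 : R) (K : 'M[R]_(1 + 2)) : 0 < a -> 0 < g0 -> 0 < g0 * g2 - g1 ^+ 2 ->
  K = block_mx a%:M 0 0 (\matrix_(j, l) (if j == 0 then (if l == 0 then g0 else g1) else (if l == 0 then g1 else g2))) ->
  exists T : 'M[R]_(1 + 2), T *m K *m T^T = 1%:M.
Proof.
move=> a0 g00 d0 ->; set G := \matrix_(j, l) _.
pose al := (Num.sqrt a)^-1; pose be := (Num.sqrt g0)^-1; pose ga := (Num.sqrt (g0 * (g0 * g2 - g1 ^+ 2)))^-1.
have alE : al * al * a = 1.
  by rewrite /al -expr2 exprVn sqr_sqrtr ?ltW // mulVf // gt_eqF.
have beE : be * be * g0 = 1.
  by rewrite /be -expr2 exprVn sqr_sqrtr ?ltW // mulVf // gt_eqF.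
have gaE : ga * ga * (g0 * (g0 * g2 - g1 ^+ 2)) = 1.
  have h : 0 < g0 * (g0 * g2 - g1 ^+ 2) by rewrite mulr_gt0.
  by rewrite /ga -expr2 exprVn sqr_sqrtr ?ltW // mulVf // gt_eqF.
(* The rows of T2 are e_0 and g0 e_1 - g1 e_0, normalized. *)
pose T2 : 'M[R]_2 := \matrix_(j, l) (if j == 0 then (if l == 0 then be else 0)
   else (if l == 0 then - g1 * ga else g0 * ga)).
have T2E : T2 *m G *m T2^T = 1%:M.
  apply/matrixP => j l; rewrite !mxE sum_ord2 !mxE !sum_ord2 !mxE /=.
  have [->|->] := ord2_cases j; have [->|->] := ord2_cases l; rewrite /= ?mulr1n ?mulr0n.
  - by rewrite -[RHS]beE; ring.
  - by ring.
  - by ring.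
  - by rewrite -[RHS]gaE; ring.
exists (block_mx al%:M 0 0 T2).
rewrite tr_block_mx mulmx_block mulmx_block !(trmx0, mul0mx, mulmx0, addr0, add0r).
rewrite T2E [RHS]scalar_mx_block; congr block_mx.
by rewrite tr_scalar_mx -!scalar_mxM -[1]alE mulrAC.
Qed.

(** Multiply conj f Q = f by the adjoint of V. *)
Lemma real_form_orthonormal p q n (f : 'M[C]_(p, n)) (V : 'M[C]_(q, n)) (k : C) :
  V *m (conjm V)^T = 1%:M -> is_real_form f (k *: (V^T *m V)) ->
  f = f *m (conjm V)^T *m V /\ f *m (conjm V)^T = k *: conjm (f *m (conjm V)^T).
Proof.
move=> VV [fQ _].
have E : f *m (conjm V)^T = k *: (conjm f *m V^T).
  by rewrite -[in LHS]fQ -scalemxAr -scalemxAl -!mulmxA VV mulmx1.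
split; first by rewrite E -{1}fQ -scalemxAr -scalemxAl mulmxA.
have cc : conjm (conjm V) = V by apply/matrixP => i j; rewrite !mxE conjcK.
by rewrite conjmM E -map_trmx cc.
Qed.

Lemma real_ratio_entry q (z : 'rV[C]_q) (k : C) (a b : 'I_q) : z = k *: conjm z -> z 0 a != 0 ->
  z 0 b / z 0 a = (complex.Re (z 0 b / z 0 a))%:C.
Proof.
move=> E za; apply: complex_ext => //=.
have zE c : z 0 c = k * (z 0 c)^*%C by have /rowP/(_ c) := E; rewrite !mxE.
have k0 : k != 0 by apply: contra za => /eqP k0; rewrite zE k0 mul0r.
have zc0 : (z 0 a)^*%C != 0 by rewrite conjc_eq0.
have : (z 0 b / z 0 a)^*%C = z 0 b / z 0 a.
  rewrite [in RHS]zE [in X in _ = _ / X]zE -mulf_div divff // mul1r.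
  by rewrite conjcM conjc_inv.
move=> /(congr1 (fun c : C => complex.Im c)); rewrite cImJ => h; lra.
Qed.

Lemma real_ratio q (z : 'rV[C]_q) (k : C) (a : 'I_q) : z = k *: conjm z -> z 0 a != 0 ->
  z = z 0 a *: toC (\row_b complex.Re (z 0 b / z 0 a)).
Proof.
move=> E za; apply/rowP => b; rewrite !mxE -(real_ratio_entry b E za).
by rewrite mulrC divfK.
Qed.

(** Orthonormalize a basis of the orthogonal complement of the rows of V. *)
Lemma unitary_completion k (V : 'M[C]_(3, 3 + k)) : V *m (conjm V)^T = 1%:M ->
  exists Y : 'M[C]_(k, 3 + k), (col_mx V Y : 'M[C]_(3 + k)) \is unitarymx.
Proof.
move=> VV.
have tE p q (B : 'M[C]_(p, q)) : (B ^t*)%sesqui = (conjm B)^T by rewrite map_trmx.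
have VU : V \is unitarymx by apply/unitarymxP; rewrite tE.
pose K := kermx (conjm V)^T.
have rK : \rank K = k.
  by rewrite mxrank_ker mxrank_tr mxrank_map (mxrank_unitary VU) addKn.
pose B : 'M[C]_(k, 3 + k) := rowsub (cast_ord (esym rK)) (row_base K).
have fB : row_free B by apply: row_free_cast; exact: row_base_free.
pose Y := schmidt B.
have YU : Y \is unitarymx by apply: schmidt_unitarymx; exact: leq_addl.
have YV : Y *m (conjm V)^T = 0.
  apply/eqP; rewrite -sub_kermx -/K (eqmx_schmidt_free fB).
  apply/row_subP => i; rewrite row_rowsub; apply: submx_trans (row_sub _ _) _.
  by rewrite eq_row_base.
exists Y; apply/unitarymxP; rewrite tE map_col_mx tr_col_mx mul_col_row VV YV.
have -> : V *m (conjm Y)^T = 0.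
  have cc : conjm (conjm V) = V by apply/matrixP => i j; rewrite !mxE conjcK.
  have := congr1 (fun X => (conjm X)^T) YV; rewrite conjmM -map_trmx cc trmx_mul trmxK => ->.
  by apply/matrixP => i j; rewrite !mxE conjc0.
have /unitarymxP := YU; rewrite tE => ->.
by rewrite [RHS]scalar_mx_block.
Qed.

End RealForms.

Section BlockCoefficients.
Context {R : realType}.
Implicit Types (u : 'I_2 -> 'rV[R]_2).

Lemma blk_ll u i j : block_mx (1%:M : 'M[R]_1) 0 0 (\matrix_l u l) (lshift 2 i) (lshift 2 j) = 1.
Proof. by rewrite block_mxEul !ord1 mxE. Qed.
Lemma blk_lr u i j : block_mx (1%:M : 'M[R]_1) 0 0 (\matrix_l u l) (lshift 2 i) (rshift 1 j) = 0.
Proof. by rewrite block_mxEur mxE. Qed.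
Lemma blk_rl u i j : block_mx (1%:M : 'M[R]_1) 0 0 (\matrix_l u l) (rshift 1 i) (lshift 2 j) = 0.
Proof. by rewrite block_mxEdl mxE. Qed.
Lemma blk_rr u i j : block_mx (1%:M : 'M[R]_1) 0 0 (\matrix_l u l) (rshift 1 i) (rshift 1 j) = u i 0 j.
Proof. by rewrite block_mxEdr mxE. Qed.

Lemma comb100 n (x y z : 'rV[R[i]]_n) : x = (1 : R)%:C *: x + ((0 : R)%:C *: y + (0 : R)%:C *: z).
Proof. by rewrite scale1r !scale0r !addr0. Qed.
Lemma comb0 n (x y : 'rV[R[i]]_n) : y = (0 : R)%:C *: x + y.
Proof. by rewrite scale0r add0r. Qed.

Lemma sym2E (g : 'I_2 -> 'I_2 -> R) j l : g 0 1 = g 1 0 ->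
  g j l = (if j == 0 then (if l == 0 then g 0 0 else g 0 1) else (if l == 0 then g 0 1 else g 1 1)).
Proof. by move=> s; have [->|->] := ord2_cases j; have [->|->] := ord2_cases l. Qed.

Lemma gram_ge0 n (x y : 'rV[R[i]]_n) : 0 < complex.Re (hdot x x) ->
  0 <= complex.Re (hdot x x) * complex.Re (hdot y y) - complex.Re (hdot x y) ^+ 2.
Proof.
move=> a0; have := hdotxx_ge0 ((- complex.Re (hdot x y))%:C *: x + (complex.Re (hdot x x))%:C *: y).
have -> : complex.Re (hdot ((- complex.Re (hdot x y))%:C *: x + (complex.Re (hdot x x))%:C *: y)
  ((- complex.Re (hdot x y))%:C *: x + (complex.Re (hdot x x))%:C *: y)) =
  complex.Re (hdot x x) * (complex.Re (hdot x x) * complex.Re (hdot y y) - complex.Re (hdot x y) ^+ 2).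
  rewrite Re_hdot_comb2 (Re_hdotC (_ + _) x) Re_hdot_comb2 (Re_hdotC (_ + _) y) Re_hdot_comb2.
  rewrite (Re_hdotC x y); move: (complex.Re (hdot x x)) (complex.Re (hdot x y)) (complex.Re (hdot y y)) => a b c.
  by ring.
by rewrite pmulr_rge0.
Qed.

End BlockCoefficients.

Section RealLine.
Context {R : realType} {M : topologicalType} {n : nat}.
Variable F : M -> CP R n.
Variable A : set (param R M).
Local Notation C := R[i].
Local Notation Re := complex.Re.
Local Notation Im := complex.Im.
Local Notation conjm := (map_mx (@conjc R)).
Local Notation toC := (map_mx (real_complex R)).
Local Notation vec := 'rV[C]_n.+1.
Implicit Types (Z : 'rV[R]_2 -> vec) (W : set 'rV[R]_2) (P : param R M).

Hypothesis surf : smooth_surface A.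

Definition totally_real Z y := kahler_form Z y = 0 /\ flat_at Z y.

Lemma frame_mx_unit P W Z x : frame F P W Z x -> kahler_form Z x = 0 -> conjm (frame_mx Z x) *m (frame_mx Z x)^T \in unitmx.
Proof.
move=> [Wx lZ sZ g0] k0; have Z0 y : W y -> Z y != 0 by exact: lifts_neq0 lZ.
by rewrite (mul_frame_mx Z0 Wx k0) map_unitmx; apply: (frame_gram_unit Z0 g0).
Qed.

Lemma is_real_form_frame P W Z x : frame F P W Z x -> kahler_form Z x = 0 -> is_real_form (frame_mx Z x) (real_form Z x).
Proof.
move=> [Wx lZ sZ g0] k0; have Z0 y : W y -> Z y != 0 by exact: lifts_neq0 lZ.
exact: (real_formP Z0 g0).
Qed.

Lemma real_form_change P Q W W' Z Z' x y : A P -> A Q -> frame F P W Z x -> frame F Q W' Z' y ->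
  P x = Q y -> kahler_form Z x = 0 -> kahler_form Z' y = 0 -> exists2 k : C, k != 0 & real_form Z' y = k *: real_form Z x.
Proof.
move=> AP AQ fr1 fr2 E k1 k2; have [c [c0 Zc HH]] := frame_change surf AP AQ fr1 fr2 E.
have [Wx _ sZ _] := fr1; have cZ := csmoothr_cdiffr sZ Wx.
have /choice [u Hu] := fun l => HH (delta_mx 0 l).
apply: (@is_real_form_change _ _ _ (frame_mx Z x) (frame_mx Z' y) (block_mx 1%:M 0 0 (\matrix_l u l)) c _ _ c0).
- exact: frame_mx_unit fr1 k1.
- exact: frame_mx_unit fr2 k2.
- apply/row_matrixP => r; rewrite rowK linearZ /= row_mul mulmx_sum_row.
  transitivity (c *: \sum_k (block_mx 1%:M 0 0 (\matrix_l u l) r k)%:C *: frame_vec Z k x); last first.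
    by congr (_ *: _); apply: eq_bigr => k _; rewrite rowK !mxE.
  rewrite sum_frame_vec; case: (split_ordP r) => l ->; rewrite ?frame_vecl ?frame_vecr.
    by rewrite blk_ll !blk_lr Zc; congr (_ *: _); exact: comb100.
  rewrite blk_rl !blk_rr Hu (Hf_row (u l) cZ); congr (_ *: _).
  exact: comb0.
- exact: is_real_form_frame fr1 k1.
- exact: is_real_form_frame fr2 k2.
Qed.

(** The lines spanned by the forms are locally constant, and do not depend on the
    frame; M is connected. *)
Lemma real_form_line_const Q0 p0 : connected [set: M] ->
  (forall p, locally_frame F A totally_real p) ->
  locally_frame F A (fun Z y => totally_real Z y /\ exists2 k : C, k != 0 & real_form Z y = k *: Q0) p0 ->
  forall p, locally_frame F A (fun Z y => totally_real Z y /\ exists2 k : C, k != 0 & real_form Z y = k *: Q0) p.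
Proof.
move=> conM tr Sp0.
apply: (@connected_cover _ _ (locally_frame F A (fun Z y => totally_real Z y /\ ~ exists2 k : C, k != 0 & real_form Z y = k *: Q0)) p0 conM _ _ _ _ Sp0).
- exact: open_locally_frame.
- exact: open_locally_frame.
- move=> p; have [P [W [Z [x [AP Px fr1 TW]]]]] := tr p.
  have [Wx lZ sZ g0] := fr1; have [oW _ _] := lZ.
  have Z0 y : W y -> Z y != 0 by exact: lifts_neq0 lZ.
  have [kx _] := TW x Wx.
  have [W' [oW' W'x W'W QW]] := form_locally_const oW Wx (csmooth_real_form oW sZ Z0 g0)
    (fun y l Wy => mder_real_form oW sZ Z0 g0 l Wy TW) (real_form_neq0 Z0 g0 Wx kx).
  have fr2 := frame_sub fr1 oW' W'W W'x.
  have [[k k0 E]|no] := pselect (exists2 k : C, k != 0 & real_form Z x = k *: Q0); [left|right].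
    exists P, W', Z, x; split; [exact: AP|exact: Px|exact: fr2|move=> y W'y]; split; first exact: TW (W'W _ W'y).
    have [k' k'0 E'] := QW y W'y; exists (k' * k); first by rewrite mulf_neq0.
    by rewrite E' E scalerA.
  exists P, W', Z, x; split; [exact: AP|exact: Px|exact: fr2|move=> y W'y]; split; first exact: TW (W'W _ W'y).
  move=> [k k0 E]; apply: no; have [k' k'0 E'] := QW y W'y.
  exists (k'^-1 * k); first by rewrite mulf_neq0 ?invr_eq0.
  by rewrite -scalerA -E E' scalerA mulVf // scale1r.
move=> p [P [W [Z [x [AP Px fr1 TW]]]]] [Q [W' [Z' [y [AQ Qy fr2 TW']]]]].
have [Wx _ _ _] := fr1; have [W'y _ _ _] := fr2.
have [[k1 _] [k k0 E]] := TW x Wx; have [[k2 _] no] := TW' y W'y.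
have [k' k'0 E'] := real_form_change AP AQ fr1 fr2 (etrans Px (esym Qy)) k1 k2.
by apply: no; exists (k' * k); rewrite ?mulf_neq0 // E' E scalerA.
Qed.

Lemma gram_gt0 P W Z x : frame F P W Z x -> 0 < gram Z x /\ 0 < metric Z x 0 0.
Proof.
move=> [Wx lZ sZ g0]; have cZ := csmoothr_cdiffr sZ Wx.
have m0 : 0 < metric Z x 0 0.
  rewrite hdotxx_gt0 //; apply/eqP => h; have := g0 x Wx.
  by rewrite /gram /metric h hdot0l /= hdot0l mul0r expr0n subrr eqxx.
split=> //; rewrite lt_def g0 //=.
exact: gram_ge0 m0.
Qed.

Lemma orthonormal_frame P W Z x : frame F P W Z x -> kahler_form Z x = 0 ->
  exists V : 'M[C]_(1 + 2, n.+1), V *m (conjm V)^T = 1%:M /\ is_real_form (frame_mx Z x) (V^T *m V).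
Proof.
move=> fr1 k0; have [Wx lZ sZ g0] := fr1.
have Z0 y : W y -> Z y != 0 by exact: lifts_neq0 lZ.
have [d0 m0] := gram_gt0 fr1.
have [T HT] : exists T : 'M[R]_(1 + 2), T *m frame_gram Z x *m T^T = 1%:M.
  apply: (normalize_gram (hdotxx_gt0 (Z0 x Wx)) m0 d0).
  rewrite -[LHS]submxK; congr block_mx; apply/matrixP => j l; rewrite !mxE ?frame_vecl ?frame_vecr.
  - by rewrite !ord1 eqxx mulr1n.
  - by rewrite hdotC (Hf_orth Z0 _ Wx) conjc0.
  - by rewrite (Hf_orth Z0 _ Wx).
  exact: (sym2E j l (metricC Z x 0 1)).
have K1 := mul_frame_mx Z0 Wx k0; set f := frame_mx Z x in K1 *; set K := frame_gram Z x in K1 HT *.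
have cc p q (B : 'M[C]_(p, q)) : conjm (conjm B) = B by apply/matrixP => i j; rewrite !mxE conjcK.
have K2 : f *m (conjm f)^T = toC K.
  by have := congr1 (fun X => conjm X) K1; rewrite conjmM cc conjm_real map_trmx.
exists (toC T *m f); split.
  rewrite conjmM conjm_real trmx_mul mulmxA -[toC T *m f *m _]mulmxA K2 map_trmx -!map_mxM HT.
  exact: map_mx1.
split; last by exists ((toC T)^T *m toC T); rewrite trmx_mul !mulmxA.
rewrite trmx_mul !mulmxA K1 map_trmx -!map_mxM.
have -> : K *m T^T *m T = 1%:M by apply: mulmx1C; rewrite mulmxA.
by rewrite map_mx1 mul1mx.
Qed.

Lemma real_coordinates P W Z y (V : 'M[C]_(1 + 2, n.+1)) (k : C) : frame F P W Z y -> kahler_form Z y = 0 -> k != 0 ->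
  V *m (conjm V)^T = 1%:M -> real_form Z y = k *: (V^T *m V) ->
  frame_mx Z y = frame_mx Z y *m (conjm V)^T *m V /\ Z y *m (conjm V)^T = k *: conjm (Z y *m (conjm V)^T).
Proof.
move=> fr1 k0 kn0 VV QE; have := is_real_form_frame fr1 k0; rewrite QE => iQ.
have [E1 E2] := real_form_orthonormal VV iQ; split=> //.
have rE : row (lshift 2 ord0) (frame_mx Z y) = Z y by rewrite rowK frame_vecl.
have := congr1 (row (lshift 2 ord0)) E2; rewrite linearZ /= -map_row row_mul rE.
by [].
Qed.

End RealLine.

Section OpenImage.
Context {R : realType} {M : topologicalType} {n : nat}.
Variable F : M -> CP R n.
Local Notation C := R[i].
Local Notation Re := complex.Re.
Local Notation Im := complex.Im.
Local Notation conjm := (map_mx (@conjc R)).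
Local Notation toC := (map_mx (real_complex R)).
Local Notation vec := 'rV[C]_n.+1.
Variables (P : param R M) (W : set 'rV[R]_2) (Z : 'rV[R]_2 -> vec).
Variable V : 'M[C]_(3, n.+1).
Hypotheses (lZ : lifts F P W Z) (sZ : csmoothr_on W Z).
Hypothesis g0 : forall y, W y -> gram Z y != 0.
Hypothesis spanV : forall y, W y -> frame_mx Z y = frame_mx Z y *m (conjm V)^T *m V.
Hypothesis VV : V *m (conjm V)^T = 1%:M.

(** Coordinates of the lift in the orthonormal system V, and the chart of the real
    projective plane that they give: they are real up to a common factor. *)
Definition coords y : 'rV[C]_3 := Z y *m (conjm V)^T.

Hypothesis real_coords : forall y, W y -> exists k : C, coords y = k *: conjm (coords y).

Let oW : open W. Proof. by case: lZ. Qed.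
Let Z0 y : W y -> Z y != 0. Proof. exact: lifts_neq0 lZ. Qed.

Lemma fr_span r y : W y -> frame_vec Z r y = frame_vec Z r y *m (conjm V)^T *m V.
Proof.
by move=> Wy; have := congr1 (row r) (spanV Wy); rewrite !row_mul rowK.
Qed.

Lemma Z_span y : W y -> Z y = coords y *m V.
Proof. by move=> Wy; have := fr_span (lshift 2 ord0) Wy; rewrite frame_vecl. Qed.

Lemma Hf_span v y : W y -> Hf Z v y = Hf Z v y *m (conjm V)^T *m V.
Proof.
move=> Wy; have cZ := csmoothr_cdiffr sZ Wy; rewrite (Hf_row v cZ).
have := fr_span (rshift 1 0) Wy; have := fr_span (rshift 1 1) Wy; rewrite !frame_vecr.
move: (Hf Z _ y) (Hf Z _ y) => h1 h0 E1 E0.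
by rewrite !mulmxDl -!scalemxAl -E0 -E1.
Qed.

Lemma coords_smooth b : csmooth_on W (fun y => coords y 0 b).
Proof.
under eq_fun do rewrite mxE; apply: csmooth_sum => // c.
by apply: csmoothM => //; exact: csmooth_cst.
Qed.

Lemma coords_derive y v b : W y ->
  cderive (fun y => coords y 0 b) y v = (cderiver Z y v *m (conjm V)^T) 0 b.
Proof.
move=> Wy; have cZ := csmoothr_cdiffr sZ Wy; under eq_fun do rewrite mxE.
have cc c d : cdiff (fun _ : 'rV[R]_2 => (conjm V)^T c d) y by exact: cdiff_cst.
rewrite cderive_sum => [|c]; last exact: cdiffM (cZ c) (cc c b).
rewrite [RHS]mxE; apply: eq_bigr => c _.
by rewrite (cderiveM v (cZ c) (cc c b)) cderive_cst mulr0 addr0 [cderiver _ _ _ _ _]mxE.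
Qed.

Variable a : 'I_3.

Definition ratio (y : 'rV[R]_2) : 'rV[R]_2 := \row_l Re (coords y 0 (lift a l) / coords y 0 a).

Let W1 := W `&` [set y | coords y 0 a != 0].

Lemma open_W1 : open W1.
Proof. exact: (csmooth_nz oW (coords_smooth a)). Qed.

Lemma csmooth_ratio b : csmooth_on W1 (fun y => coords y 0 b / coords y 0 a).
Proof.
apply: csmooth_quotient; [exact: open_W1| | |by move=> y []].
  by apply: csmooth_sub (coords_smooth b) => y [].
by apply: csmooth_sub (coords_smooth a) => y [].
Qed.

Lemma smooth_ratio : smoothr_on W1 ratio.
Proof. by move=> l; under eq_fun do rewrite mxE; apply: csmooth_Re; exact: csmooth_ratio. Qed.

Lemma ratio_real y b : W1 y -> coords y 0 b / coords y 0 a = (Re (coords y 0 b / coords y 0 a))%:C.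
Proof.
move=> [Wy /= za]; have [k kE] := real_coords Wy.
exact: real_ratio_entry kE za.
Qed.

(** If the ratios of coordinates are stationary in a direction, the lift moves there
    along its own line, and its horizontal derivative is 0. *)
Lemma jac_ratio y : W1 y -> jac ratio y \in unitmx.
Proof.
move=> W1y; have [Wy /= za] := W1y; have cZ := csmoothr_cdiffr sZ Wy.
rewrite -row_free_unit; apply: inj_row_free => v.
rewrite -derive_jac; last exact: smoothr_diff smooth_ratio W1y.
move=> D0; apply: (Hf_inj cZ (g0 Wy)).
pose q b y := coords y 0 b / coords y 0 a.
have Dq b : cderive (q b) y v = 0.
  case: (unliftP a b) => [l|] ->; last first.
    rewrite (cderive_on v open_W1 W1y (g := fun=> 1)) ?cderive_cst // => z.
    by rewrite inE => -[_ /= z0]; rewrite /q divff.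
  rewrite (cderive_on v open_W1 W1y (g := fun y => (ratio y 0 l)%:C)); last first.
    by move=> z; rewrite inE => W1z; rewrite /q (ratio_real _ W1z) [ratio z 0 l]mxE.
  rewrite cderiveR derive_row; last exact: smoothr_diff smooth_ratio W1y.
  by rewrite D0 mxE.
pose k := cderive (fun y => coords y 0 a) y v / coords y 0 a.
have DZ : cderiver Z y v *m (conjm V)^T = k *: coords y.
  apply/rowP => b; rewrite -(coords_derive v b Wy) [RHS]mxE.
  have E : cderive (fun y => coords y 0 b) y v = cderive (fun y => q b y * coords y 0 a) y v.
    by apply: (cderive_on v open_W1 W1y) => z; rewrite inE => -[_ /= z0]; rewrite /q divfK.
  rewrite E (cderiveM v (csmooth_cdiff (csmooth_ratio b) W1y) (csmooth_cdiff (coords_smooth a) Wy)).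
  rewrite (Dq b) mul0r add0r /q /k; move: (cderive _ y v) => d.
  by field.
have HE : Hf Z v y = (k - conn Z v y) *: Z y.
  rewrite (Hf_span v Wy) HfE mulmxBl -scalemxAl DZ -/(coords y) -scalerBl -scalemxAl.
  by rewrite -(Z_span Wy).
have : hdot (Hf Z v y) (Z y) = 0 by apply: horizontal_orth; exact: Z0.
rewrite HE (hdotZl (k - conn Z v y)) => /eqP.
 rewrite mulf_eq0 (negPf (hdotxx_neq0 (Z0 Wy))) orbF => /eqP ->.
by rewrite scale0r.
Qed.

Lemma coords_ratio y (x : 'rV[R]_3) : W1 y -> x 0 a != 0 ->
  (forall l, x 0 (lift a l) / x 0 a = ratio y 0 l) ->
  toC x *m V = ((x 0 a)%:C / coords y 0 a) *: Z y.
Proof.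
move=> W1y xa xE; have [Wy /= za] := W1y.
rewrite [in RHS](Z_span Wy) scalemxAl; congr (_ *m _); apply/rowP => b; rewrite [LHS]mxE [RHS]mxE.
case: (unliftP a b) => [l|] ->; last by rewrite divfK.
have h : coords y 0 (lift a l) / coords y 0 a = (x 0 (lift a l) / x 0 a)%:C.
  by rewrite xE (ratio_real _ W1y) [ratio y 0 l]mxE.
rewrite mulrAC -mulrA h -rmorphM /= mulrC divfK //.
Qed.

End OpenImage.

Section RealPlane.
Context {R : realType} {M : topologicalType} {n : nat}.
Variable F : M -> CP R n.
Variable A : set (param R M).
Local Notation C := R[i].
Local Notation Re := complex.Re.
Local Notation conjm := (map_mx (@conjc R)).
Local Notation toC := (map_mx (real_complex R)).
Variable V : 'M[C]_(3, n.+1).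
Hypothesis surf : smooth_surface A.
Hypothesis VV : V *m (conjm V)^T = 1%:M.
Hypothesis line : forall p, locally_frame F A
  (fun Z y => totally_real Z y /\ exists2 k : C, k != 0 & real_form Z y = k *: (V^T *m V)) p.

Lemma frame_coords p : exists P W Z x, [/\ A P, P x = p, frame F P W Z x,
   forall y, W y -> frame_mx Z y = frame_mx Z y *m (conjm V)^T *m V &
   forall y, W y -> exists k : C, coords Z V y = k *: conjm (coords Z V y)].
Proof.
have [P [W [Z [x [AP Px fr1 TW]]]]] := line p; exists P, W, Z, x.
have fry y : W y -> frame F P W Z y by case: fr1 => _ h1 h2 h3 Wy; split.
split; [exact: AP|exact: Px|exact: fr1| |].
  move=> y Wy; have [[k0 _] [k kn0 E]] := TW y Wy.
  by have [] := real_coordinates (fry y Wy) k0 kn0 VV E.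
move=> y Wy; have [[k0 _] [k kn0 E]] := TW y Wy; exists k.
by have [] := real_coordinates (fry y Wy) k0 kn0 VV E.
Qed.

Lemma real_representative p : exists x : 'rV[R]_3, represents (toC x *m V) (F p).
Proof.
have [P [W [Z [x [AP Px fr1 sp rc]]]]] := frame_coords p; have [Wx lZ sZ g0] := fr1.
have ZE := Z_span sp Wx; have Zx := lifts_neq0 lZ Wx.
have [a za] : exists a, coords Z V x 0 a != 0.
  apply: contrapT => h; case/eqP: Zx; rewrite ZE.
  have -> : coords Z V x = 0; last by rewrite mul0mx.
  apply/rowP => i; rewrite [RHS]mxE; apply: contrapT => /eqP h'; apply: h; by exists i.
have [k kE] := rc x Wx; have E := real_ratio kE za.
exists (\row_b Re (coords Z V x 0 b / coords Z V x 0 a)).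
have -> : toC (\row_b Re (coords Z V x 0 b / coords Z V x 0 a)) *m V = (coords Z V x 0 a)^-1 *: Z x.
  rewrite [in RHS]ZE scalemxAl; congr (_ *m _).
  by rewrite [X in _ = _ *: X]E scalerA mulVf // scale1r.
apply: representsZ; first exact: invr_neq0.
by rewrite -Px; case: lZ => _ _; apply.
Qed.

(** Near x, the surface is parametrized by the ratios of coordinates, by the inverse
    function theorem; the points x' near x have ratios near those of x. *)
Lemma open_representatives (U : set M) : open U ->
  open [set x : 'rV[R]_3 | exists2 p, U p & represents (toC x *m V) (F p)].
Proof.
move=> oU; rewrite openE => x [p Up rx]; rewrite /interior.
have [P [W [Z [y0 [AP Py fr1 sp rc]]]]] := frame_coords p; have [Wy0 lZ sZ g0] := fr1.
have [oW WP rZ] := lZ.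
have [_ _ [par _ _]] := surf.
have UP : U (P y0) by rewrite Py.
have [U' [oU' U'y U'P U'U]] := continuous_param (par P AP) (WP _ Wy0) oU UP.
have [c c0 xE] : exists2 c : C, c != 0 & Z y0 = c *: (toC x *m V).
  by apply: (represents_scale rx); rewrite -Py; exact: rZ.
have zE : coords Z V y0 = c *: toC x.
  by rewrite /coords xE -scalemxAl -mulmxA VV mulmx1.
have [a xa] : exists a, x 0 a != 0.
  apply: contrapT => h; have := lifts_neq0 lZ Wy0; rewrite xE => /eqP; apply.
  have -> : x = 0; last by rewrite map_mx0 mul0mx scaler0.
  by apply/rowP => i; rewrite mxE; apply: contrapT => /eqP h'; apply: h; exists i.
have za : coords Z V y0 0 a != 0 by rewrite zE !mxE mulf_neq0 // fmorph_eq0.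
pose W1 := W `&` [set y | coords Z V y 0 a != 0].
have oW1 : open W1 by exact: open_W1 lZ sZ a.
pose W3 := W1 `&` U'.
have oW3 : open W3 by exact: openI.
have W3y : W3 y0 by [].
have sr : smoothr_on W3 (ratio Z V a).
  move=> l.
  have h : smooth_on W1 (fun x' => ratio Z V a x' 0 l) by exact: (smooth_ratio (a := a) (V := V) lZ sZ l).
  have sub : W3 `<=` W1 by move=> z [].
  exact: smooth_sub sub h.
have uJ : jac (ratio Z V a) y0 \in unitmx by apply: (jac_ratio lZ sZ g0 sp rc); split.
have [W2 [V2 [k [[oW2 W2y W2W oV2] Wf Vk sk]]]] := inverse_function oW3 W3y sr uJ.
pose s (x' : 'rV[R]_3) : 'rV[R]_2 := \row_l (x' 0 (lift a l) / x' 0 a).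
pose X := [set x' : 'rV[R]_3 | x' 0 a != 0].
have oX : open X.
  have sc : csmooth_on setT (fun x' : 'rV[R]_3 => (x' 0 a)%:C) by apply: csmoothR; exact: smooth_coord.
  have := csmooth_nz openT sc; rewrite setTI; congr open.
  by apply/seteqP; split=> z /=; rewrite fmorph_eq0.
have ss : smoothr_on X s.
  move=> l; under eq_fun do rewrite mxE; apply: smoothM => //; first exact: smooth_coord.
  by apply: smoothV => //; exact: smooth_coord.
have oN := open_preimage_smooth oX oV2 ss.
have Nx : (X `&` s @^-1` V2) x.
  split=> //; rewrite /preimage /=; have [Vr _] := Wf y0 W2y.
  suff -> : s x = ratio Z V a y0 by [].
  apply/rowP => l; rewrite [LHS]mxE [RHS]mxE zE !mxE -mulf_div divff // mul1r -fmorphV -rmorphM /=.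
  by [].
apply: filterS (open_nbhs_nbhs (conj oN Nx)) => x' [x'a Vs].
have [W2k rk] := Vk _ Vs; have [[Wk zk] Uk] := W2W _ W2k.
exists (P (k (s x'))); first exact: U'U.
have rE l : x' 0 (lift a l) / x' 0 a = ratio Z V a (k (s x')) 0 l by rewrite rk mxE.
rewrite (coords_ratio sp rc (conj Wk zk) x'a rE); apply: representsZ; last exact: rZ.
by rewrite mulf_neq0 ?invr_eq0 // fmorph_eq0.
Qed.

End RealPlane.

Section RealProjectivePlane.
Context {R : realType} {M : topologicalType}.
Local Notation C := R[i].
Local Notation conjm := (map_mx (@conjc R)).
Local Notation toC := (map_mx (real_complex R)).

Lemma isotropic_points_totally_real m (F : M -> CP R m.+1) (A : set (param R M)) p :
  austere F A -> isotropic_point F A p -> locally_frame F A totally_real p.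
Proof.
move=> aus [P [W [Z [x [AP Px fr1 kW]]]]]; exists P, W, Z, x.
split; [exact: AP|exact: Px|exact: fr1|move=> y Wy; split; first exact: kW].
have fry : frame F P W Z y by case: fr1 => _ h1 h2 h3; split.
move=> xi j l; apply: (flat_scaled aus AP fry).
by rewrite (kW y Wy) expr0n /= eq_sym; case: fry => _ _ _; exact.
Qed.

Lemma real_pointE k (V : 'M[C]_(3, k.+3)) (Y : 'M[C]_(k, k.+3)) (x : 'rV[R]_3) :
  @real_point R k.+2 x *m (col_mx V Y : 'M[C]_(k.+3)) = toC x *m V.
Proof.
have -> : @real_point R k.+2 x = row_mx (toC x) (0 : 'rV[C]_k).
  apply/rowP => j; rewrite [LHS]mxE; case: (@split_ordP 3 k j) => l ->.
    by rewrite [RHS](@row_mxEl _ 1 3 k) mxE /= valK.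
  rewrite [RHS](@row_mxEr _ 1 3 k) mxE; by case: insubP.
by rewrite (@mul_row_col _ 1 3 k) mul0mx addr0.
Qed.

Lemma isotropic_points_span m (F : M -> CP R m.+1) (A : set (param R M)) :
  smooth_surface A -> connected [set: M] -> austere F A ->
  (exists p : M, True) -> (forall p, isotropic_point F A p) ->
  exists2 V : 'M[C]_(3, m.+2), V *m (conjm V)^T = 1%:M &
    forall p, locally_frame F A
      (fun Z y => totally_real Z y /\ exists2 k : C, k != 0 & real_form Z y = k *: (V^T *m V)) p.
Proof.
move=> surf conM aus [p0 _] rp.
have tr p := isotropic_points_totally_real aus (rp p).
have [P [W [Z [x [AP Px fr1 TW]]]]] := tr p0.
have [Wx lZ sZ g0] := fr1; have [oW _ _] := lZ.
have Z0 y : W y -> Z y != 0 by exact: lifts_neq0 lZ.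
have [kx _] := TW x Wx.
have [V [VV VQ]] := orthonormal_frame fr1 kx.
have QV : real_form Z x = V^T *m V := is_real_form_unique (frame_mx_unit fr1 kx) (is_real_form_frame fr1 kx) VQ.
have [W' [oW' W'x W'W QW]] := form_locally_const oW Wx (csmooth_real_form oW sZ Z0 g0)
  (fun y l Wy => mder_real_form oW sZ Z0 g0 l Wy TW) (real_form_neq0 Z0 g0 Wx kx).
exists V => //; apply: (real_form_line_const surf (p0 := p0) conM tr).
exists P, W', Z, x; split; [exact: AP|exact: Px|exact: frame_sub fr1 oW' W'W W'x|].
by move=> y W'y; split; [exact: TW (W'W _ W'y)|rewrite -QV; exact: QW].
Qed.

Theorem isotropic_points_RP2 m (F : M -> CP R m.+1) (A : set (param R M)) :
  smooth_surface A -> connected [set: M] -> austere F A ->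
  (exists p : M, True) -> (forall p, isotropic_point F A p) -> open_in_RP2 F.
Proof.
move=> surf conM aus ne rp; have [V VV line] := isotropic_points_span surf conM aus ne rp.
have VU : V \is unitarymx by apply/unitarymxP; rewrite -VV map_trmx.
have n2 : (3 <= m.+2)%N by have := rank_leq_col V; rewrite (mxrank_unitary VU).
case: m F V VV VU n2 {aus rp} line => // k F V VV _ _ line.
have [Y YU] := unitary_completion VV.
split=> //; exists (col_mx V Y); first exact: YU.
split=> [p|U oU].
  have [x xr] := real_representative VV line p.
  by exists x; rewrite real_pointE.
have -> : [set x | exists2 p, U p & represents (real_point x *m (col_mx V Y : 'M[C]_(k.+3))) (F p)]
  = [set x | exists2 p, U p & represents (toC x *m V) (F p)].
  by apply/seteqP; split=> x [p Up]; [rewrite real_pointE|rewrite -(real_pointE V Y)] => h; exists p.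
exact: open_representatives surf VV line U oU.
Qed.

End RealProjectivePlane.

Theorem theorem7 (R : realType) (n : nat) (M : topologicalType)
    (A : set (param R M)) (F : M -> CP R n) :
  smooth_surface A ->
  connected [set: M]%classic ->
  immersion F A ->
  austere F A ->
  holomorphic_curve F A \/ open_in_RP2 F.
Proof.
move=> surf conM imm aus.
have [cplx|[p0 rp]] := austere_dichotomy surf conM imm aus.
  by left; exact: complex_points_holomorphic.
right; have [p _] := p0; have [P [W [Z [x [_ _ fr1 _]]]]] := rp p.
have := immersion_dim fr1; case: n F imm aus rp {P W Z x fr1} => // m F imm aus rp _.
exact: isotropic_points_RP2 surf conM aus p0 rp.
Qed.
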